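(* Let $\Lambda$ be a ribbon graph order, $k$ its base field, $G$ the graph of a complete gentle quiver $(Q,I)$ of $\Lambda$, $m:G_0\to\mathbb{N}^+$ any map on the set of its $\sigma$-orbits and $\varepsilon$ any polarization of $\Lambda$. View $\Lambda$ as an $R$-order via the map $R\to\Lambda$, $t\mapsto z=\sum_{a\in Q_1}c_a^{m(v_a)}$ and set $w=\sum_{a\in Q_1}\varepsilon_a c_a^{m(v_a)}$. Consider the following six conditions: (1) The ribbon graph order $\Lambda$ is symmetric. (2) The twisted Brauer graph algebra $A=\Lambda/z\Lambda$ is symmetric. (3) The graph $G$ is bipartite or the field $k$ has characteristic two. (4) There is a polarization $\epsilon$ of $\Lambda$ such that its involution $\epsilon^\star$ is trivial (that is, $\epsilon^\star=\mathrm{id}_\Lambda$). (5) The algebra $A$ is isomorphic to some Brauer graph algebra. (6) The algebra $A$ is isomorphic to the Brauer graph algebra $B=\Lambda/\Lambda w\Lambda$. Then the following statements hold: (i) The implications $(1)\Leftrightarrow(2)\Leftrightarrow(3)\Leftrightarrow(4)\Leftarrow(5)\Leftarrow(6)$ are true. (ii) If the field $k$ has a root of the polynomial $x^{m(v)}+1$ for each node $v\in G_0$, then all six conditions are equivalent.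
   Context: $k$ is a field, $R=k[[t]]$. All modules are finitely generated left modules. Paths are composed from right to left; products of non-composable arrows are zero; $s(a)$ is the start vertex of an arrow $a$. A finite quiver with relations $(Q,I)$ is complete gentle if (1) there are exactly two arrows starting and exactly two arrows ending at each vertex; (2) for any arrow $b\in Q_1$ there are unique arrows $a,c\in Q_1$ such that $cb\notin I$ and $ba\notin I$; (3) the ideal $I$ is generated by paths of length two. For $a\in Q_1$ let $\sigma(a)$ be the unique arrow with $\sigma(a)a\notin I$; this defines a permutation $\sigma$ of $Q_1$. Let $v_a$ be the $\sigma$-orbit of $a$, $n(a)$ its length and $c_a=\sigma^{n(a)-1}(a)\cdots\sigma(a)a$. Orders are assumed basic, so the ribbon graph order $\Lambda$ of $(Q,I)$ over the base field $k$ is the arrow ideal completion of $kQ/I$; $e_i$ is the idempotent of the vertex $i$. Graph: $G$ has as set of nodes $G_0$ the set of $\sigma$-orbits in $Q_1$ and, for each vertex $i\in Q_0$, one edge between $v_a$ and $v_b$, where $a,b$ are the two distinct arrows starting at $i$ (a loop if $v_a=v_b$). A graph is bipartite if its nodes can be coloured with two colours such that each edge is incident to nodes of different colours. A polarization of $\Lambda$ is a map $\varepsilon:Q_1\to\{+,-\}$, $a\mapsto\varepsilon_a$, such that $\varepsilon_a\ne\varepsilon_b$ for any two different arrows $a,b$ with the same start vertex; $\varepsilon_a x$ means $\pm x$ according to the sign. The involution of $\varepsilon$ is the unique $R$-algebra morphism $\varepsilon^\star:\Lambda\to\Lambda$ with $\varepsilon^\star(e_i)=e_i$ for $i\in Q_0$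 and $\varepsilon^\star(a)=\varepsilon_{\sigma(a)}\varepsilon_a a$ for $a\in Q_1$. An $R$-order (an $R$-algebra free of finite rank over $R$) $\Lambda$ is symmetric if $\Lambda\cong\mathrm{Hom}_R(\Lambda,R)$ as $\Lambda$-bimodules; a finite-dimensional $k$-algebra $A$ is symmetric if $A\cong\mathrm{Hom}_k(A,k)$ as $A$-bimodules. A Brauer graph algebra is a finite-dimensional $k$-algebra Morita equivalent to $kQ'/(I'+J_-)$ for some complete gentle quiver $(Q',I')$ and some map $m'$ from its $\sigma$-orbits to $\mathbb{N}^+$, where $J_-$ is the ideal generated by $c_a^{m'(v_a)}-c_b^{m'(v_b)}$ for all arrows $a,b$ with $s(a)=s(b)$. Isomorphisms of algebras are $k$-algebra isomorphisms. *)

(* Defs.v *)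
From HB Require Import structures.
From mathcomp Require Import all_boot all_order all_algebra all_fingroup generic_quotient.
From mathcomp Require Import boolp functions.


Set Implicit Arguments.
Unset Strict Implicit.
Unset Printing Implicit Defensive.

Import GRing.Theory.
Local Open Scope ring_scope.

(* An algebra over S is a ring with a ring morphism from S into its center.
   The library's [algType] excludes the zero ring, which is the path algebra of
   the empty quiver. *)
HB.mixin Record PzRing_isAlgebraOver (S : comPzRingType) A of GRing.PzRing A := {
  strmap : S -> A;
  strmap_zmod : zmod_morphism strmap;
  strmap_monoid : monoid_morphism strmap;
  strmap_central : forall (c : S) (x : A), strmap c * x = x * strmap c
}.

#[short(type="algebraOver")]
HB.structure Definition AlgebraOver (S : comPzRingType) :=
  {A of GRing.PzRing A & PzRing_isAlgebraOver S A}.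

Section UnderlyingModule.
Variables (S : comPzRingType) (A : algebraOver S).

HB.instance Definition _ := GRing.isZmodMorphism.Build S A strmap strmap_zmod.
HB.instance Definition _ := GRing.isMonoidMorphism.Build S A strmap strmap_monoid.

Definition alg_mod : Type := A.
HB.instance Definition _ := GRing.Zmodule.on alg_mod.

Definition alg_scale (c : S) (x : alg_mod) : alg_mod := (strmap c : A) * (x : A).

Lemma alg_scaleA a b x : alg_scale a (alg_scale b x) = alg_scale (a * b) x.
Proof. by rewrite /alg_scale rmorphM mulrA. Qed.
Lemma alg_scale1 : left_id 1 alg_scale.
Proof. by move=> x; rewrite /alg_scale rmorph1 mul1r. Qed.
Lemma alg_scaleDr : right_distributive alg_scale +%R.
Proof. by move=> c x y; exact: (@mulrDr A). Qed.
Lemma alg_scaleDl x : {morph alg_scale^~ x : a b / a + b}.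
Proof. by move=> a b; rewrite /alg_scale rmorphD; exact: (@mulrDl A). Qed.

HB.instance Definition _ := GRing.Zmodule_isLmodule.Build S alg_mod
  alg_scaleA alg_scale1 alg_scaleDr alg_scaleDl.

End UnderlyingModule.

Section AlgebraNotions.
Variable S : comPzRingType.

Definition alg_morphism (A B : algebraOver S) (f : A -> B) : Prop :=
  [/\ zmod_morphism f, monoid_morphism f & forall c : S, f (strmap c) = strmap c].

Definition alg_iso (A B : algebraOver S) : Prop :=
  exists f : A -> B, alg_morphism f /\ bijective f.

(* The bimodule structure on Hom_S(A, S) is (a f b)(u) = f (b u a). *)
Definition symmetric_alg (A : algebraOver S) : Prop :=
  exists phi : A -> {linear alg_mod A -> S^o},
    [/\ bijective phi,
        forall x y u : A, phi (x + y) u = phi x u + phi y u &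
        forall a x b u : A, phi (a * x * b) u = phi x (b * u * a)].

Definition findim (A : algebraOver S) : Prop :=
  exists s : seq A, forall x : A, exists c : 'I_(size s) -> S,
    x = \sum_(i < size s) strmap (c i) * s`_i.

End AlgebraNotions.

#[local] Obligation Tactic := idtac.

Section Ideals.
Variable A : pzRingType.

Record ideal := Ideal {
  ideal_mem :> A -> Prop;
  ideal0 : ideal_mem 0;
  idealD : forall x y, ideal_mem x -> ideal_mem y -> ideal_mem (x + y);
  idealMl : forall a x, ideal_mem x -> ideal_mem (a * x);
  idealMr : forall x a, ideal_mem x -> ideal_mem (x * a) }.

Lemma idealN (I : ideal) x : I x -> I (- x).
Proof. by rewrite -mulN1r; exact: idealMl. Qed.

Lemma idealB (I : ideal) x y : I x -> I y -> I (x - y).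
Proof. by move=> Ix Iy; apply: idealD => //; apply: idealN. Qed.

Definition ideal_top : ideal :=
  @Ideal (fun=> True) I (fun _ _ _ _ => I) (fun _ _ _ => I) (fun _ _ _ => I).

Program Definition ideal_gen (X : A -> Prop) : ideal :=
  @Ideal (fun x => forall I : ideal, (forall y, X y -> I y) -> I x) _ _ _ _.
Next Obligation. by move=> X I _; exact: ideal0. Qed.
Next Obligation. by move=> X x y Hx Hy I XI; apply: idealD; [exact: Hx|exact: Hy]. Qed.
Next Obligation. by move=> X a x Hx I XI; apply: idealMl; exact: Hx. Qed.
Next Obligation. by move=> X x a Hx I XI; apply: idealMr; exact: Hx. Qed.

Lemma mem_ideal_gen (X : A -> Prop) x : X x -> ideal_gen X x.
Proof. by move=> Xx I; apply. Qed.

Program Definition ideal_add (I J : ideal) : ideal :=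
  @Ideal (fun x => exists2 y, I y & exists2 z, J z & x = y + z) _ _ _ _.
Next Obligation.
by move=> I J; exists 0; [exact: ideal0|exists 0; [exact: ideal0|rewrite addr0]].
Qed.
Next Obligation.
move=> I J _ _ [y Iy [z Jz ->]] [y' Iy' [z' Jz' ->]].
exists (y + y'); first exact: idealD.
by exists (z + z'); [exact: idealD|rewrite addrACA].
Qed.
Next Obligation.
move=> I J a _ [y Iy [z Jz ->]]; exists (a * y); first exact: idealMl.
by exists (a * z); [exact: idealMl|rewrite mulrDr].
Qed.
Next Obligation.
move=> I J _ a [y Iy [z Jz ->]]; exists (y * a); first exact: idealMr.
by exists (z * a); [exact: idealMr|rewrite mulrDl].
Qed.

Definition ideal_mul (I J : ideal) : ideal :=
  ideal_gen (fun x => exists2 y, I y & exists2 z, J z & x = y * z).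

Definition ideal_exp (J : ideal) (n : nat) : ideal :=
  iter n (ideal_mul J) ideal_top.

Lemma ideal_exp_pow (J : ideal) x n : J x -> ideal_exp J n (x ^+ n).
Proof.
move=> Jx; elim: n => [|n IHn] //=; rewrite exprS.
by apply: mem_ideal_gen; exists x => //; exists (x ^+ n).
Qed.

Lemma ideal_expS (J : ideal) n x : ideal_exp J n.+1 x -> ideal_exp J n x.
Proof. by apply=> _ [y Jy [z Jz ->]]; exact: idealMl. Qed.

Lemma ideal_sum (I : ideal) (T : Type) (r : seq T) (P : pred T) (F : T -> A) :
  (forall i, P i -> I (F i)) -> I (\sum_(i <- r | P i) F i).
Proof.
by move=> IF; apply: (big_ind (ideal_mem I));
   [exact: ideal0|move=> x y; exact: idealD|exact: IF].
Qed.

Program Definition ideal_central (z : A) (zC : forall x, z * x = x * z) : ideal :=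
  @Ideal (fun x => exists y, x = z * y) _ _ _ _.
Next Obligation. by move=> z _; exists 0; rewrite mulr0. Qed.
Next Obligation. by move=> z _ _ _ [x ->] [y ->]; exists (x + y); rewrite mulrDr. Qed.
Next Obligation. by move=> z zC a _ [x ->]; exists (a * x); rewrite mulrA -zC mulrA. Qed.
Next Obligation. by move=> z _ _ a [x ->]; exists (x * a); rewrite mulrA. Qed.

End Ideals.

Section Quotient.
Local Open Scope quotient_scope.
Variables (S : comPzRingType) (A : algebraOver S) (I : ideal A).

Definition quot_equiv (x y : A) : bool := `[< I (x - y) >].

Lemma quot_equiv_class : equiv_class_of quot_equiv.
Proof.
split=> [x|x y|y x z]; rewrite /quot_equiv.
- by apply/asboolP; rewrite subrr; exact: ideal0.
- by apply/asboolP/asboolP => /(@idealN _ _ _); rewrite opprB.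
- move=> /asboolP h1 /asboolP h2; apply/asboolP.
  by rewrite -[x](addrNK y) -addrA; exact: idealD.
Qed.

Canonical quot_equiv_rel := EquivRelPack quot_equiv_class.
Canonical quot_enc := defaultEncModRel quot_equiv.

Definition quot := {eq_quot quot_equiv}.

HB.instance Definition _ : EqQuotient A quot_equiv quot := EqQuotient.on quot.
HB.instance Definition _ := Choice.on quot.

Definition qpi (x : A) : quot := \pi_quot x.

Lemma qpiP x y : reflect (I (x - y)) (qpi x == qpi y).
Proof. by rewrite /qpi piE; apply: (iffP (asboolP _)). Qed.

Lemma qpi_eq x y : I (x - y) -> qpi x = qpi y.
Proof. by move=> h; apply/eqP/qpiP. Qed.

Lemma qreprK (u : quot) : qpi (repr u) = u.
Proof. exact: reprK. Qed.

Lemma qrepr x : I (repr (qpi x) - x).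
Proof. by apply/qpiP; rewrite qreprK. Qed.

Definition quot_add (u v : quot) : quot := qpi (repr u + repr v).
Definition quot_opp (u : quot) : quot := qpi (- repr u).
Definition quot_mul (u v : quot) : quot := qpi (repr u * repr v).

Lemma qpi_add x y : quot_add (qpi x) (qpi y) = qpi (x + y).
Proof. by apply: qpi_eq; rewrite opprD addrACA; apply: idealD; exact: qrepr. Qed.

Lemma qpi_opp x : quot_opp (qpi x) = qpi (- x).
Proof. by apply: qpi_eq; rewrite -opprD; apply: idealN; exact: qrepr. Qed.

Lemma qpi_mul x y : quot_mul (qpi x) (qpi y) = qpi (x * y).
Proof.
apply: qpi_eq; set x' := repr _; set y' := repr _.
have -> : x' * y' - x * y = x' * (y' - y) + (x' - x) * y.
  by rewrite mulrBr mulrBl addrA subrK.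
by apply: idealD; [apply: idealMl|apply: idealMr]; exact: qrepr.
Qed.

Lemma quot_ind (P : quot -> Prop) : (forall x, P (qpi x)) -> forall u, P u.
Proof. by move=> h u; rewrite -[u]qreprK. Qed.

Lemma quot_addA : associative quot_add.
Proof.
by elim/quot_ind=> x; elim/quot_ind=> y; elim/quot_ind=> z; rewrite !qpi_add addrA.
Qed.
Lemma quot_addC : commutative quot_add.
Proof. by elim/quot_ind=> x; elim/quot_ind=> y; rewrite !qpi_add addrC. Qed.
Lemma quot_add0 : left_id (qpi 0) quot_add.
Proof. by elim/quot_ind=> x; rewrite qpi_add add0r. Qed.
Lemma quot_addN : left_inverse (qpi 0) quot_opp quot_add.
Proof. by elim/quot_ind=> x; rewrite qpi_opp qpi_add addNr. Qed.

HB.instance Definition _ :=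
  GRing.isZmodule.Build quot quot_addA quot_addC quot_add0 quot_addN.

Lemma qpiD x y : qpi (x + y) = qpi x + qpi y.
Proof. by rewrite -qpi_add. Qed.

Lemma quot_mulA : associative quot_mul.
Proof.
by elim/quot_ind=> x; elim/quot_ind=> y; elim/quot_ind=> z; rewrite !qpi_mul mulrA.
Qed.
Lemma quot_mul1l : left_id (qpi 1) quot_mul.
Proof. by elim/quot_ind=> x; rewrite qpi_mul mul1r. Qed.
Lemma quot_mul1r : right_id (qpi 1) quot_mul.
Proof. by elim/quot_ind=> x; rewrite qpi_mul mulr1. Qed.
Lemma quot_mulDl : left_distributive quot_mul +%R.
Proof.
elim/quot_ind=> x; elim/quot_ind=> y; elim/quot_ind=> z.
by rewrite -qpiD !qpi_mul -qpiD mulrDl.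
Qed.
Lemma quot_mulDr : right_distributive quot_mul +%R.
Proof.
elim/quot_ind=> x; elim/quot_ind=> y; elim/quot_ind=> z.
by rewrite -qpiD !qpi_mul -qpiD mulrDr.
Qed.

HB.instance Definition _ := GRing.Zmodule_isPzRing.Build quot
  quot_mulA quot_mul1l quot_mul1r quot_mulDl quot_mulDr.

Lemma qpiM x y : qpi (x * y) = qpi x * qpi y.
Proof. by rewrite -qpi_mul. Qed.

Lemma qpi_zmod : zmod_morphism qpi.
Proof. by move=> x y; rewrite qpiD -qpi_opp. Qed.
Lemma qpi_monoid : monoid_morphism qpi.
Proof. by split => // x y; rewrite qpiM. Qed.
HB.instance Definition _ := GRing.isZmodMorphism.Build A quot qpi qpi_zmod.
HB.instance Definition _ := GRing.isMonoidMorphism.Build A quot qpi qpi_monoid.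

Definition quot_str (c : S) : quot := qpi (strmap c).
Lemma quot_str_zmod : zmod_morphism quot_str.
Proof. by move=> a b; rewrite /quot_str !rmorphB. Qed.
Lemma quot_str_monoid : monoid_morphism quot_str.
Proof. by split=> [|a b]; rewrite /quot_str ?rmorph1 ?rmorphM. Qed.
Lemma quot_str_central c u : quot_str c * u = u * quot_str c.
Proof. by elim/quot_ind: u => x; rewrite /quot_str -!rmorphM strmap_central. Qed.
HB.instance Definition _ := PzRing_isAlgebraOver.Build S quot
  quot_str_zmod quot_str_monoid quot_str_central.

End Quotient.

Section Completion.
Variables (S : comPzRingType) (A : algebraOver S) (J : ideal A).

Local Notation level n := (quot (ideal_exp J n)).

Definition level_map n (u : level n.+1) : level n := qpi _ (repr u).

Lemma level_map_qpi n x : level_map (qpi _ x : level n.+1) = qpi _ x.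
Proof. by apply: qpi_eq; apply: ideal_expS; exact: qrepr. Qed.

Lemma level_map_zmod n : zmod_morphism (@level_map n).
Proof.
elim/quot_ind=> x; elim/quot_ind=> y.
by rewrite -rmorphB !level_map_qpi rmorphB.
Qed.
Lemma level_map_monoid n : monoid_morphism (@level_map n).
Proof.
split; first by rewrite -(rmorph1 (qpi _)) level_map_qpi rmorph1.
elim/quot_ind=> x; elim/quot_ind=> y.
by rewrite -rmorphM !level_map_qpi rmorphM.
Qed.
HB.instance Definition _ n := GRing.isZmodMorphism.Build (level n.+1) (level n)
  (@level_map n) (@level_map_zmod n).
HB.instance Definition _ n := GRing.isMonoidMorphism.Build (level n.+1) (level n)
  (@level_map n) (@level_map_monoid n).

(* The inverse limit of the quotients A / J^n. *)
Record completion := Completion {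
  lev :> forall n, level n;
  lev_compat : forall n, level_map (lev n.+1) = lev n }.

HB.instance Definition _ := gen_eqMixin completion.
HB.instance Definition _ := gen_choiceMixin completion.

Lemma completionP (x y : completion) : (forall n, x n = y n) -> x = y.
Proof.
case: x y => [x xc] [y yc] /= exy.
have e : x = y by exact: functional_extensionality_dep.
by rewrite -e in yc *; rewrite (Prop_irrelevance xc yc).
Qed.

Program Definition cpl0 : completion := @Completion (fun=> 0) _.
Next Obligation. by move=> n; rewrite rmorph0. Qed.
Program Definition cpl1 : completion := @Completion (fun=> 1) _.
Next Obligation. by move=> n; rewrite rmorph1. Qed.
Program Definition cpl_opp (x : completion) : completion :=
  @Completion (fun n => - x n) _.
Next Obligation. by move=> x n; rewrite rmorphN /= lev_compat. Qed.
Program Definition cpl_add (x y : completion) : completion :=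
  @Completion (fun n => x n + y n) _.
Next Obligation. by move=> x y n; rewrite rmorphD /= !lev_compat. Qed.
Program Definition cpl_mul (x y : completion) : completion :=
  @Completion (fun n => x n * y n) _.
Next Obligation. by move=> x y n; rewrite rmorphM /= !lev_compat. Qed.

Lemma cpl_addA : associative cpl_add.
Proof. by move=> x y z; apply: completionP => n; exact: addrA. Qed.
Lemma cpl_addC : commutative cpl_add.
Proof. by move=> x y; apply: completionP => n; exact: addrC. Qed.
Lemma cpl_add0 : left_id cpl0 cpl_add.
Proof. by move=> x; apply: completionP => n; exact: add0r. Qed.
Lemma cpl_addN : left_inverse cpl0 cpl_opp cpl_add.
Proof. by move=> x; apply: completionP => n; exact: addNr. Qed.

HB.instance Definition _ :=
  GRing.isZmodule.Build completion cpl_addA cpl_addC cpl_add0 cpl_addN.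

Lemma cpl_mulA : associative cpl_mul.
Proof. by move=> x y z; apply: completionP => n; exact: mulrA. Qed.
Lemma cpl_mul1l : left_id cpl1 cpl_mul.
Proof. by move=> x; apply: completionP => n; exact: mul1r. Qed.
Lemma cpl_mul1r : right_id cpl1 cpl_mul.
Proof. by move=> x; apply: completionP => n; exact: mulr1. Qed.
Lemma cpl_mulDl : left_distributive cpl_mul +%R.
Proof. by move=> x y z; apply: completionP => n; exact: mulrDl. Qed.
Lemma cpl_mulDr : right_distributive cpl_mul +%R.
Proof. by move=> x y z; apply: completionP => n; exact: mulrDr. Qed.

HB.instance Definition _ := GRing.Zmodule_isPzRing.Build completion
  cpl_mulA cpl_mul1l cpl_mul1r cpl_mulDl cpl_mulDr.

Definition lev_at n (x : completion) : level n := x n.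
Lemma lev_at_zmod n : zmod_morphism (lev_at n). Proof. by []. Qed.
Lemma lev_at_monoid n : monoid_morphism (lev_at n). Proof. by []. Qed.
HB.instance Definition _ n := GRing.isZmodMorphism.Build completion (level n)
  (lev_at n) (@lev_at_zmod n).
HB.instance Definition _ n := GRing.isMonoidMorphism.Build completion (level n)
  (lev_at n) (@lev_at_monoid n).

Definition to_completion (x : A) : completion :=
  @Completion (fun n => qpi _ x) (fun n => level_map_qpi n x).
Lemma to_completion_zmod : zmod_morphism to_completion.
Proof. by move=> x y; apply: completionP => n; exact: (rmorphB (qpi _)). Qed.
Lemma to_completion_monoid : monoid_morphism to_completion.
Proof.
split=> [|x y]; apply: completionP => n; first exact: (rmorph1 (qpi _)).
exact: (rmorphM (qpi _)).
Qed.
HB.instance Definition _ := GRing.isZmodMorphism.Build A completion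
  to_completion to_completion_zmod.
HB.instance Definition _ := GRing.isMonoidMorphism.Build A completion
  to_completion to_completion_monoid.

Definition cpl_str (c : S) : completion := to_completion (strmap c).
Lemma cpl_str_zmod : zmod_morphism cpl_str.
Proof. by move=> a b; rewrite /cpl_str !rmorphB. Qed.
Lemma cpl_str_monoid : monoid_morphism cpl_str.
Proof. by split=> [|a b]; rewrite /cpl_str ?rmorph1 ?rmorphM. Qed.
Lemma cpl_str_central c x : cpl_str c * x = x * cpl_str c.
Proof. by apply: completionP => n; exact: (strmap_central c (x n)). Qed.
HB.instance Definition _ := PzRing_isAlgebraOver.Build S completion
  cpl_str_zmod cpl_str_monoid cpl_str_central.

End Completion.

Section PowerSeries.
Variable k : comNzRingType.

(* r n is the coefficient of t^n. *)
Definition power_series : Type := nat -> k.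

HB.instance Definition _ := GRing.Zmodule.on power_series.

Definition ps_one : power_series := fun n => (n == 0%N)%:R.
Definition ps_mul (r s : power_series) : power_series :=
  fun n => \sum_(i < n.+1) r i * s (n - i)%N.

Let tr n (r : power_series) : {poly k} := \poly_(i < n.+1) r i.

Let tr_coef n r i : (i <= n)%N -> (tr n r)`_i = r i.
Proof. by move=> h; rewrite coef_poly ltnS h. Qed.

Let ps_mul_tr n r s i : (i <= n)%N -> ps_mul r s i = (tr n r * tr n s)`_i.
Proof.
move=> h; rewrite coefM; apply: eq_bigr => j _.
by rewrite !tr_coef //; [apply: leq_trans (leq_subr _ _) h|apply: leq_trans h; rewrite -ltnS].
Qed.

Lemma ps_mulA : associative ps_mul.
Proof.
move=> r s u; apply/funext => n.
rewrite [RHS](_ : _ = (tr n r * tr n s * tr n u)`_n).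
  rewrite -mulrA coefM; apply: eq_bigr => i _.
  have hi : (i <= n)%N by rewrite -ltnS.
  by rewrite (@ps_mul_tr n) ?leq_subr // tr_coef.
rewrite coefM; apply: eq_bigr => i _.
have hi : (i <= n)%N by rewrite -ltnS.
by rewrite (@ps_mul_tr n) // tr_coef ?leq_subr.
Qed.
Lemma ps_mulC : commutative ps_mul.
Proof.
by move=> r s; apply/funext => n; rewrite !(@ps_mul_tr n) // mulrC.
Qed.
Lemma ps_mul1 : left_id ps_one ps_mul.
Proof.
move=> r; apply/funext => n; rewrite /ps_mul big_ord_recl /ps_one /= mul1r subn0.
by rewrite big1 ?addr0 // => i _; rewrite mul0r.
Qed.
Lemma ps_mulDl : left_distributive ps_mul +%R.
Proof.
move=> r s u; apply/funext => n.
rewrite [RHS](_ : _ = ps_mul r u n + ps_mul s u n) // /ps_mul -big_split /=.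
by apply: eq_bigr => i _; rewrite -mulrDl.
Qed.
Lemma ps_one_neq0 : ps_one != 0.
Proof. by apply/eqP => /(congr1 (fun r => r 0%N)) /eqP; rewrite /ps_one oner_eq0. Qed.

HB.instance Definition _ := GRing.Zmodule_isComNzRing.Build power_series
  ps_mulA ps_mulC ps_mul1 ps_mulDl ps_one_neq0.

End PowerSeries.

Section OrderStructure.
Variables (k : comNzRingType) (A : algebraOver k) (J : ideal A).
Local Notation L := (completion J).
Variables (z : L) (z_nil : forall n, z n ^+ n = 0) (z_central : forall x : L, z * x = x * z).

Let z_nil_leq n i : (n <= i)%N -> z n ^+ i = 0.
Proof. by move=> h; rewrite -(subnK h) exprD z_nil mulr0. Qed.

(* The morphism k[[t]] -> L sending t to z: the value of sum_i r_i t^i is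
   sum_(i < n) r_i z^i modulo J^n. *)
Definition ps_eval_level (r : power_series k) n : quot (ideal_exp J n) :=
  \sum_(i < n) strmap (r i) * z n ^+ i.

Lemma ps_eval_compat r n : level_map (ps_eval_level r n.+1) = ps_eval_level r n.
Proof.
rewrite /ps_eval_level rmorph_sum big_ord_recr /=.
rewrite rmorphM rmorphXn /= lev_compat z_nil mulr0 addr0.
apply: eq_bigr => i _; rewrite rmorphM rmorphXn /= lev_compat; congr (_ * _).
exact: level_map_qpi.
Qed.

Definition ps_eval (r : power_series k) : L := Completion (ps_eval_compat r).

Lemma ps_eval_zmod : zmod_morphism ps_eval.
Proof.
move=> r s; apply: completionP => n; rewrite [RHS]/= /ps_eval_level -sumrB.
by apply: eq_bigr => i _; rewrite rmorphB mulrBl.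
Qed.

Lemma ps_eval_monoid : monoid_morphism ps_eval.
Proof.
split=> [|r s]; apply: completionP => n.
  rewrite /= /ps_eval_level; case: n => [|n].
    by rewrite big_ord0; apply: esym; apply: qpi_eq.
  rewrite big_ord_recl big1 ?addr0 => [|i _]; first by rewrite rmorph1 mul1r.
  by rewrite (_ : (1 : power_series k) _ = 0) // rmorph0 mul0r.
rewrite [RHS](_ : _ = ps_eval_level r n * ps_eval_level s n) // /= /ps_eval_level.
rewrite big_distrlr /=.
pose F i j : quot (ideal_exp J n) := strmap (r i * s j) * z n ^+ (i + j)%N.
transitivity (\sum_(i < n) \sum_(j < n) F i j); last first.
  apply: eq_bigr => i _; apply: eq_bigr => j _.
  rewrite /F rmorphM exprD -!mulrA; congr (_ * _); rewrite !mulrA; congr (_ * _).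
  exact: strmap_central.
transitivity (\sum_(l < n) \sum_(i < n) \sum_(j < n | (i + j == l)%N) F i j).
  apply: eq_bigr => l _.
  rewrite rmorph_sum mulr_suml /=.
  rewrite (big_ord_widen n (fun i => strmap (r i * s (l - i)%N) * z n ^+ l)) //.
  rewrite big_mkcond /=; apply: eq_bigr => i _; case: ltnP => hi.
    rewrite ltnS in hi.
    rewrite (big_pred1 (Ordinal (leq_ltn_trans (leq_subr i l) (ltn_ord l)))).
      by rewrite /F /= subnKC.
    move=> j; apply/eqP/eqP => [e|->]; last exact: subnKC.
    by apply: val_inj; rewrite /= -e addKn.
  rewrite big1 // => j /eqP e; move: hi; rewrite -e.
  by rewrite ltnNge leq_addr.
rewrite exchange_big /=; apply: eq_bigr => i _.
rewrite (exchange_big_dep xpredT) //=; apply: eq_bigr => j _.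
have [h|h] := ltnP (i + j)%N n.
  by rewrite (big_pred1 (Ordinal h)) // => l; rewrite [RHS]eq_sym.
rewrite big_pred0 => [|l]; first by rewrite /F z_nil_leq ?mulr0.
by apply/eqP => e; move: (ltn_ord l); rewrite -e ltnNge h.
Qed.

Lemma ps_eval_central r x : ps_eval r * x = x * ps_eval r.
Proof.
apply: completionP => n.
have zC m : z n ^+ m * x n = x n * z n ^+ m.
  have h : GRing.comm (x n) (z n) by exact: esym (congr1 (fun y : L => y n) (z_central x)).
  exact: esym (commrX m h).
transitivity (ps_eval_level r n * x n) => //.
transitivity (x n * ps_eval_level r n) => //.
rewrite /ps_eval_level mulr_suml mulr_sumr; apply: eq_bigr => i _.
by rewrite -mulrA zC mulrA strmap_central mulrA.
Qed.

End OrderStructure.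

(* The completion as an algebra over k[[t]] via t |-> z. *)
Definition order_via (k : comNzRingType) (A : algebraOver k) (J : ideal A)
  (z : completion J) (z_nil : forall n, z n ^+ n = 0)
  (z_central : forall x : completion J, z * x = x * z) : Type := completion J.

Section OrderVia.
Variables (k : comNzRingType) (A : algebraOver k) (J : ideal A) (z : completion J).
Variables (z_nil : forall n, z n ^+ n = 0).
Variables (z_central : forall x : completion J, z * x = x * z).
Local Notation L := (order_via z_nil z_central).

HB.instance Definition _ := GRing.PzRing.on L.
HB.instance Definition _ := PzRing_isAlgebraOver.Build (power_series k) L
  (ps_eval_zmod z_nil) (ps_eval_monoid z_nil) (ps_eval_central z_nil z_central).

End OrderVia.

Record quiver := Quiver {
  vertex : finType;
  arrow : finType;
  source : arrow -> vertex;
  target : arrow -> vertex }.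

Section PathAlgebra.
Variables (k : comNzRingType) (Q : quiver).

Fixpoint walk (i : vertex Q) (s : seq (arrow Q)) : bool :=
  if s is a :: s' then (source a == i) && walk (target a) s' else true.

Definition walk_end (i : vertex Q) (s : seq (arrow Q)) : vertex Q :=
  last i (map (@target Q) s).

Lemma walk_cat i s1 s2 : walk i (s1 ++ s2) = walk i s1 && walk (walk_end i s1) s2.
Proof. by elim: s1 i => //= a s1 IH i; rewrite IH andbA. Qed.

(* The path (i, [:: a1; ...; an]) starts at the vertex i and traverses a1 first:
   it is the product an ... a1 in the path algebra. *)
Definition qpath := {p : vertex Q * seq (arrow Q) | walk p.1 p.2}.

Definition qlen (p : qpath) : nat := size (val p).2.

Lemma walk_take (p : qpath) n : walk (val p).1 (take n (val p).2).
Proof.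
by case: p => -[i s] /= h; move: h; rewrite -{1}(cat_take_drop n s) walk_cat => /andP[].
Qed.

Lemma walk_drop (p : qpath) n :
  walk (walk_end (val p).1 (take n (val p).2)) (drop n (val p).2).
Proof.
by case: p => -[i s] /= h; move: h; rewrite -{1}(cat_take_drop n s) walk_cat => /andP[].
Qed.

Definition qtake n (p : qpath) : qpath :=
  exist (fun p => walk p.1 p.2) ((val p).1, take n (val p).2) (walk_take p n).

Definition qdrop n (p : qpath) : qpath :=
  exist (fun p => walk p.1 p.2)
    (walk_end (val p).1 (take n (val p).2), drop n (val p).2) (walk_drop p n).

Definition pathfun : Type := qpath -> k.
HB.instance Definition _ := GRing.Zmodule.on pathfun.

(* A path p factors as q r with r traversed first. *)
Definition pf_mul (f g : pathfun) : pathfun :=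
  fun p => \sum_(j < (qlen p).+1) f (qdrop j p) * g (qtake j p).

Definition pf_const (c : k) : pathfun := fun p => if qlen p == 0%N then c else 0.

Lemma qlen_take j p : (j <= qlen p)%N -> qlen (qtake j p) = j.
Proof. by move=> h; apply: size_takel. Qed.

Lemma qlen_drop j p : qlen (qdrop j p) = (qlen p - j)%N.
Proof. exact: size_drop. Qed.

Lemma qdrop_drop i j p : qdrop i (qdrop j p) = qdrop (i + j) p.
Proof.
apply: val_inj => /=; rewrite drop_drop; congr (_, _).
rewrite /walk_end -[in RHS](cat_take_drop j (take (i + j) _)) map_cat last_cat.
by rewrite take_takel ?leq_addl // take_drop.
Qed.

Lemma qtake_take i j p : (i <= j)%N -> qtake i (qtake j p) = qtake i p.
Proof. by move=> h; apply: val_inj; rewrite /= take_takel. Qed.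

Lemma qtake_drop i j p : qtake i (qdrop j p) = qdrop j (qtake (i + j) p).
Proof.
by apply: val_inj; rewrite /= take_drop take_takel // leq_addl.
Qed.

Lemma qtake_all p : qtake (qlen p) p = p.
Proof. by apply: val_inj; case: p => -[i s] h; rewrite /= /qlen /= take_size. Qed.

Lemma qdrop0 p : qdrop 0 p = p.
Proof. by apply: val_inj; case: p => -[i s] h; rewrite /= take0 drop0. Qed.

Lemma pf_mulA : associative pf_mul.
Proof.
move=> f g h; apply/funext => p; rewrite /pf_mul.
set n := qlen p.
pose F l j := f (qdrop l p) * g (qdrop j (qtake l p)) * h (qtake j p).
transitivity (\sum_(l < n.+1) \sum_(j < n.+1 | (j <= l)%N) F l j).
  apply: eq_bigr => l _; have hl : (l <= n)%N by rewrite -ltnS.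
  rewrite qlen_take // mulr_sumr.
  rewrite (big_ord_widen n.+1 (fun j => f (qdrop l p) *
    (g (qdrop j (qtake l p)) * h (qtake j (qtake l p))))) //.
  apply: eq_big => [j|j hj]; first by rewrite ltnS.
  by rewrite /F qtake_take ?mulrA // -ltnS.
rewrite (exchange_big_dep xpredT) //=; apply: eq_bigr => j _.
have hj : (j <= n)%N by rewrite -ltnS.
rewrite qlen_drop mulr_suml -(subSn hj).
rewrite -(big_mkord xpredT (fun i => f (qdrop i (qdrop j p)) *
  g (qtake i (qdrop j p)) * h (qtake j p))).
rewrite -(big_mkord (fun l => (j <= l)%N) (fun l => F l j)).
rewrite (big_cat_nat (n := j)) //=; last exact: leqW.
rewrite big_nat_cond big_pred0 ?add0r; last first.
  by move=> l; apply/negbTE; rewrite -andbA negb_and -ltnNge /=; case: ltnP.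
rewrite -{1}[j : nat]add0n big_addn big_nat_cond [RHS]big_nat_cond.
apply: eq_big => [i|i _]; first by rewrite leq_addl.
by rewrite /F qdrop_drop qtake_drop.
Qed.

Lemma pf_mul_const_l c (f : pathfun) : pf_mul (pf_const c) f = fun p => c * f p.
Proof.
apply/funext => p; rewrite /pf_mul big_ord_recr /= big1 => [|j _].
  by rewrite add0r /pf_const qlen_drop subnn eqxx qtake_all.
by rewrite /pf_const qlen_drop subn_eq0 leqNgt ltn_ord mul0r.
Qed.

Lemma pf_mul_const_r c (f : pathfun) : pf_mul f (pf_const c) = fun p => f p * c.
Proof.
apply/funext => p; rewrite /pf_mul big_ord_recl /= big1 => [|j _].
  by rewrite addr0 /pf_const qlen_take // eqxx qdrop0.
by rewrite /pf_const qlen_take ?mulr0 //; exact: ltn_ord.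
Qed.

Lemma pf_mul1l : left_id (pf_const 1) pf_mul.
Proof. by move=> f; rewrite pf_mul_const_l; apply/funext => p; rewrite mul1r. Qed.
Lemma pf_mul1r : right_id (pf_const 1) pf_mul.
Proof. by move=> f; rewrite pf_mul_const_r; apply/funext => p; rewrite mulr1. Qed.
Lemma pf_mulDl : left_distributive pf_mul +%R.
Proof.
move=> f g h; apply/funext => p.
rewrite [RHS](_ : _ = pf_mul f h p + pf_mul g h p) // /pf_mul -big_split /=.
by apply: eq_bigr => j _; rewrite -mulrDl.
Qed.
Lemma pf_mulDr : right_distributive pf_mul +%R.
Proof.
move=> f g h; apply/funext => p.
rewrite [RHS](_ : _ = pf_mul f g p + pf_mul f h p) // /pf_mul -big_split /=.
by apply: eq_bigr => j _; rewrite -mulrDr.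
Qed.

HB.instance Definition _ := GRing.Zmodule_isPzRing.Build pathfun
  pf_mulA pf_mul1l pf_mul1r pf_mulDl pf_mulDr.

Definition fin_supp : {pred pathfun} :=
  fun f => `[< exists s : seq qpath, forall p, p \notin s -> f p = 0 >].

Lemma fin_suppP (f : pathfun) :
  reflect (exists s : seq qpath, forall p, p \notin s -> f p = 0) (f \in fin_supp).
Proof. exact: asboolP. Qed.

Definition path_join (q r : qpath) : seq qpath :=
  pmap insub [:: ((val r).1, (val r).2 ++ (val q).2)].

Lemma path_joinP j p : p \in path_join (qdrop j p) (qtake j p).
Proof.
rewrite mem_pmap_sub /= mem_seq1 cat_take_drop.
by case: p => -[i s] h.
Qed.

Lemma fin_supp_const c : pf_const c \in fin_supp.
Proof.
apply/fin_suppP; exists (pmap insub [seq (i, [::]) | i <- enum (vertex Q)]) => p.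
rewrite mem_pmap_sub /pf_const /qlen; case: p => -[i [|a s]] h //=.
by rewrite map_f ?mem_enum.
Qed.

Lemma fin_supp_subring : subring_closed fin_supp.
Proof.
split; first exact: fin_supp_const.
- move=> f g /fin_suppP[s hs] /fin_suppP[s' hs']; apply/fin_suppP.
  exists (s ++ s') => p; rewrite mem_cat negb_or => /andP[h h'].
  by rewrite [LHS](_ : _ = f p - g p) // hs // hs' // subr0.
- move=> f g /fin_suppP[s hs] /fin_suppP[s' hs']; apply/fin_suppP.
  exists (flatten [seq path_join q r | q <- s, r <- s']) => p hp.
  apply: big1 => j _; case: (boolP (qdrop j p \in s)) => [h|/hs ->]; last by rewrite mul0r.
  case: (boolP (qtake j p \in s')) => [h'|/hs' ->]; last by rewrite mulr0.
  case/negP: hp; apply/flattenP; exists (path_join (qdrop j p) (qtake j p)).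
    by apply/allpairsP; exists (qdrop j p, qtake j p).
  exact: path_joinP.
Qed.

Record path_alg := PathAlg { path_coef :> pathfun; path_fin : path_coef \in fin_supp }.

HB.instance Definition _ := [isSub for path_coef].
HB.instance Definition _ := [Choice of path_alg by <:].
HB.instance Definition _ :=
  GRing.SubChoice_isSubPzRing.Build pathfun fin_supp path_alg fin_supp_subring.

Definition path_str (c : k) : path_alg := PathAlg (fin_supp_const c).
Lemma path_str_zmod : zmod_morphism path_str.
Proof.
move=> a b; apply: val_inj; rewrite rmorphB /=; apply/funext => p.
rewrite [RHS](_ : _ = pf_const a p - pf_const b p) // /pf_const.
by case: ifP => //; rewrite subr0.
Qed.
Lemma path_str_monoid : monoid_morphism path_str.
Proof.
split=> [|a b]; apply: val_inj; rewrite ?rmorphM //=.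
rewrite [RHS]pf_mul_const_l; apply/funext => p; rewrite /pf_const.
by case: ifP => //; rewrite mulr0.
Qed.
Lemma path_str_central c f : path_str c * f = f * path_str c.
Proof.
apply: val_inj; rewrite !rmorphM /= [LHS]pf_mul_const_l [RHS]pf_mul_const_r.
by apply/funext => p; rewrite mulrC.
Qed.
HB.instance Definition _ := PzRing_isAlgebraOver.Build k path_alg
  path_str_zmod path_str_monoid path_str_central.

Definition delta (p : qpath) : pathfun := fun q => (q == p)%:R.
Lemma delta_fin p : delta p \in fin_supp.
Proof. by apply/fin_suppP; exists [:: p] => q; rewrite mem_seq1 /delta => /negbTE->. Qed.
Definition path_elt (p : qpath) : path_alg := PathAlg (delta_fin p).

Lemma walk_arrow (a : arrow Q) : walk (source a) [:: a].
Proof. by rewrite /= eqxx. Qed.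

Definition idem_elt (i : vertex Q) : path_alg :=
  path_elt (exist (fun p => walk p.1 p.2) (i, [::]) erefl).

Definition arrow_elt (a : arrow Q) : path_alg :=
  path_elt (exist (fun p => walk p.1 p.2) (source a, [:: a]) (walk_arrow a)).

Lemma path_eltM (q r : qpath) (h : walk (val r).1 ((val r).2 ++ (val q).2)) :
  walk_end (val r).1 (val r).2 = (val q).1 ->
  path_elt q * path_elt r =
  path_elt (exist (fun p => walk p.1 p.2) ((val r).1, (val r).2 ++ (val q).2) h).
Proof.
move=> e; apply: val_inj; rewrite rmorphM /=; apply/funext => p.
set u := exist _ _ _.
have key j : qdrop j p = q -> qtake j p = r -> p = u.
  move=> /(congr1 val) eq /(congr1 val) er; apply: val_inj.
  by rewrite /= -eq -er /= cat_take_drop; case: (p) => -[].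
rewrite [LHS](_ : _ = pf_mul (delta q) (delta r) p) // /pf_mul /delta.
have [->|pu] := eqVneq p u; last first.
  apply: big1 => j _; have [h1|] := eqVneq (qdrop j p) q; last by rewrite mul0r.
  have [h2|] := eqVneq (qtake j p) r; last by rewrite mulr0.
  by rewrite (key j h1 h2) eqxx in pu.
have hr : (qlen r < (qlen u).+1)%N by rewrite ltnS /qlen /= size_cat leq_addr.
have er : qtake (qlen r) u = r.
  by apply: val_inj; rewrite /= take_size_cat //; case: (r) => -[].
have eq : qdrop (qlen r) u = q.
  by apply: val_inj; rewrite /= take_size_cat // drop_size_cat // e; case: (q) => -[].
rewrite (bigD1 (Ordinal hr)) //= er eq !eqxx mulr1 big1 ?addr0 // => j /eqP jr.
have [h2|] := eqVneq (qtake j u) r; last by rewrite mulr0.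
case: jr; apply: val_inj; rewrite /= -h2 qlen_take //.
by rewrite -ltnS.
Qed.

Lemma path_eltM0 (q r : qpath) :
  walk_end (val r).1 (val r).2 != (val q).1 -> path_elt q * path_elt r = 0.
Proof.
move=> /eqP e; apply: val_inj; rewrite rmorphM /=; apply/funext => p.
rewrite [LHS](_ : _ = pf_mul (delta q) (delta r) p) // /pf_mul /delta.
apply: big1 => j _; have [h1|] := eqVneq (qdrop j p) q; last by rewrite mul0r.
have [h2|] := eqVneq (qtake j p) r; last by rewrite mulr0.
by case: e; rewrite -h1 -h2.
Qed.

Lemma arrow_idem a j :
  arrow_elt a * idem_elt j = if source a == j then arrow_elt a else 0.
Proof.
case: eqVneq => [e|ne]; last by apply: path_eltM0; rewrite /= eq_sym.
rewrite /arrow_elt /idem_elt path_eltM /= ?e ?eqxx // => h; congr path_elt.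
by apply: val_inj; rewrite /= e.
Qed.

Lemma idem_arrow a j :
  idem_elt j * arrow_elt a = if target a == j then arrow_elt a else 0.
Proof.
case: eqVneq => [e|ne]; last exact: path_eltM0.
rewrite /arrow_elt /idem_elt path_eltM /= ?eqxx // => h; congr path_elt.
exact: val_inj.
Qed.

Lemma arrow_arrow0 b a : target a != source b -> arrow_elt b * arrow_elt a = 0.
Proof. by move=> h; apply: path_eltM0. Qed.

Lemma path_elt_nil i h :
  path_elt (exist (fun p => walk p.1 p.2) (i, [::]) h) = idem_elt i.
Proof. by congr path_elt; apply: val_inj. Qed.

Lemma path_elt_cons i a s (h : walk i (a :: s)) (h' : walk (target a) s) :
  path_elt (exist (fun p => walk p.1 p.2) (i, a :: s) h) =
  path_elt (exist (fun p => walk p.1 p.2) (target a, s) h') * arrow_elt a.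
Proof.
have e : source a = i by case/andP: h => /eqP.
rewrite /arrow_elt path_eltM /= ?eqxx // => h2; congr path_elt.
by apply: val_inj; rewrite /= e.
Qed.

Lemma path_alg_sum (f : path_alg) :
  exists s : seq qpath, f = \sum_(p <- s) strmap (path_coef f p) * path_elt p.
Proof.
have /fin_suppP[s hs] := path_fin f; exists (undup s).
apply: val_inj; rewrite rmorph_sum /=; apply/funext => q.
have ev : forall (r : seq qpath) (F : qpath -> pathfun),
    (\sum_(p <- r) F p) q = \sum_(p <- r) F p q.
  by move=> r F; elim: r => [|p r IH]; rewrite ?big_nil // !big_cons -IH.
rewrite ev (eq_bigr (fun p => path_coef f p * (q == p)%:R)); last first.
  move=> p _.
  by rewrite [LHS](_ : _ = pf_mul (pf_const (path_coef f p)) (delta p) q) // pf_mul_const_l.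
have [qs|qs] := boolP (q \in undup s).
  rewrite (bigD1_seq q) ?undup_uniq //= eqxx mulr1 big1 ?addr0 // => p.
  by rewrite eq_sym => /negbTE->; rewrite mulr0.
rewrite big_seq big1 ?hs //; first by rewrite mem_undup in qs.
by move=> p ps; case: eqVneq => [e|]; [rewrite e ps in qs|rewrite mulr0].
Qed.

End PathAlgebra.

Arguments path_elt {k Q} p.
Arguments idem_elt {k Q} i.
Arguments arrow_elt {k Q} a.

Record complete_gentle (k : fieldType) (Q : quiver) (I : ideal (path_alg k Q)) : Prop := {
  gentle_out : forall i : vertex Q, #|[set a : arrow Q | source a == i]| = 2;
  gentle_in : forall i : vertex Q, #|[set a : arrow Q | target a == i]| = 2;
  gentle_next : forall b : arrow Q, exists! c, ~ I (arrow_elt c * arrow_elt b);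
  gentle_prev : forall b : arrow Q, exists! a, ~ I (arrow_elt b * arrow_elt a);
  gentle_quadratic : exists P : arrow Q -> arrow Q -> Prop,
    (forall b a, P b a -> target a = source b) /\
    forall x, I x <-> ideal_gen
      (fun y => exists b a, P b a /\ y = arrow_elt b * arrow_elt a) x }.

Record gentle_quiver (k : fieldType) := GentleQuiver {
  gq_quiver :> quiver;
  gq_ideal : ideal (path_alg k gq_quiver);
  gq_gentle : complete_gentle gq_ideal }.

Section Sigma.
Variables (k : fieldType) (Q : gentle_quiver k).
Local Notation I := (gq_ideal Q).

Definition next_arrow (a : arrow Q) : arrow Q :=
  sval (cid (gentle_next (gq_gentle Q) a)).

Lemma next_arrowP (a : arrow Q) : ~ I (arrow_elt (next_arrow a) * arrow_elt a).
Proof. by rewrite /next_arrow; case: cid => c []. Qed.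

Lemma next_arrow_uniq (a c : arrow Q) :
  ~ I (arrow_elt c * arrow_elt a) -> next_arrow a = c.
Proof. by rewrite /next_arrow; case: cid => c' [/= _ h] /h. Qed.

Lemma next_arrow_inj : injective next_arrow.
Proof.
move=> a b e; have [c [_ h]] := gentle_prev (gq_gentle Q) (next_arrow a).
by rewrite -(h a (@next_arrowP a)) (h b) // e; exact: next_arrowP.
Qed.

Definition sigma : {perm arrow Q} := perm next_arrow_inj.

Lemma target_sigma a : target a = source (sigma a).
Proof.
apply/eqP/negPn/negP => ne; case: (@next_arrowP a); rewrite permE in ne.
by rewrite (arrow_arrow0 _ ne); exact: ideal0.
Qed.

Lemma sigma_uniq a b : b != sigma a -> I (arrow_elt b * arrow_elt a).
Proof.
move=> ne; apply: contrapT => /next_arrow_uniq e.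
by rewrite -e permE eqxx in ne.
Qed.

(* The nodes of the graph of the quiver are the orbits of sigma. *)
Definition node : finType := {v : {set arrow Q} | v \in porbits sigma}.

Definition node_of (a : arrow Q) : node :=
  exist (fun v => v \in porbits sigma) (porbit sigma a) (imset_f _ (isT : a \in arrow Q)).

Record multiplicity := Multiplicity {
  mult :> node -> nat;
  mult_gt0 : forall v, (0 < mult v)%N }.

Definition orbit_len (a : arrow Q) : nat := #|porbit sigma a|.

End Sigma.

Arguments sigma {k Q}.

Section Cycles.
Variables (k : fieldType) (Q : gentle_quiver k) (m : multiplicity Q).
Variables (A : pzRingType) (x : arrow Q -> A).

(* The value of the cycle c_a = sigma^(n(a)-1)(a) ... sigma(a) a when each arrow
   b takes the value x b. *)
Definition cyc (a : arrow Q) : A :=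
  \prod_(b <- rev (traject sigma a (orbit_len a))) x b.

Definition cyc_pow (a : arrow Q) : A := cyc a ^+ m (node_of a).

Lemma orbit_len_gt0 (a : arrow Q) : (0 < orbit_len a)%N.
Proof. by apply/card_gt0P; exists a; exact: porbit_id. Qed.

Lemma cyc_right a : exists y, cyc_pow a = y * x a.
Proof.
rewrite /cyc_pow -(prednK (mult_gt0 m _)) exprSr /cyc.
rewrite -(prednK (orbit_len_gt0 a)) trajectS rev_cons big_rcons /=.
by rewrite mulrA; eexists.
Qed.

Lemma iter_orbit_len (a : arrow Q) : iter (orbit_len a) sigma a = a.
Proof. exact: iter_porbit. Qed.

Lemma cyc_left a : exists2 b, sigma b = a & exists y, cyc_pow a = x b * y.
Proof.
exists (iter (orbit_len a).-1 sigma a).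
  by rewrite -iterS prednK ?orbit_len_gt0 // iter_orbit_len.
rewrite /cyc_pow -(prednK (mult_gt0 m _)) exprS /cyc.
rewrite -[X in traject _ _ X](prednK (orbit_len_gt0 a)) trajectSr rev_rcons big_cons.
by rewrite -mulrA; eexists.
Qed.

Lemma porbit_sigma (a : arrow Q) : porbit sigma (sigma a) = porbit sigma a.
Proof. by apply/eqP; rewrite eq_porbit_mem (mem_porbit sigma 1). Qed.

Lemma cyc_comm a : cyc (sigma a) * x a = x a * cyc a.
Proof.
rewrite /cyc {1}/orbit_len porbit_sigma -/(orbit_len a).
transitivity (\prod_(b <- rev (traject sigma a (orbit_len a).+1)) x b).
  by rewrite trajectS rev_cons big_rcons.
by rewrite trajectSr rev_rcons big_cons iter_orbit_len.
Qed.

Lemma cyc_pow_comm a : cyc_pow (sigma a) * x a = x a * cyc_pow a.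
Proof.
rewrite /cyc_pow (_ : node_of (sigma a) = node_of a); last first.
  by apply: val_inj; exact: porbit_sigma.
elim: (mult m _) => [|n IH]; first by rewrite !expr0 mul1r mulr1.
by rewrite exprSr -mulrA cyc_comm mulrA IH -mulrA -exprSr.
Qed.

End Cycles.

Lemma cyc_pow_morph (k : fieldType) (Q : gentle_quiver k) (m : multiplicity Q)
    (A B : pzRingType) (f : {rmorphism A -> B}) (x : arrow Q -> A) a :
  cyc_pow m (f \o x) a = f (cyc_pow m x a).
Proof. by rewrite /cyc_pow rmorphXn /cyc rmorph_prod. Qed.

Section RibbonGraphOrder.
Variables (k : fieldType) (Q : gentle_quiver k).
Local Notation I := (gq_ideal Q).

Definition gentle_alg := quot I.
HB.instance Definition _ := AlgebraOver.on gentle_alg.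

Definition gentle_arrow (a : arrow Q) : gentle_alg := qpi I (arrow_elt a).

Definition arrow_ideal : ideal gentle_alg :=
  ideal_gen (fun y => exists a, y = gentle_arrow a).

Definition ribbon : Type := completion arrow_ideal.
HB.instance Definition _ := AlgebraOver.on ribbon.

Definition ribbon_idem (i : vertex Q) : ribbon :=
  to_completion arrow_ideal (qpi I (idem_elt i)).
Definition ribbon_arrow (a : arrow Q) : ribbon :=
  to_completion arrow_ideal (gentle_arrow a).

Section Multiplicity.
Variable m : multiplicity Q.

Definition ribbon_z : ribbon := \sum_(a : arrow Q) cyc_pow m ribbon_arrow a.

Let z0 : gentle_alg := \sum_(a : arrow Q) cyc_pow m gentle_arrow a.

Let ribbon_zE : ribbon_z = to_completion arrow_ideal z0.
Proof.
rewrite /z0 rmorph_sum; apply: eq_bigr => a _.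
exact: (cyc_pow_morph m (to_completion arrow_ideal)).
Qed.

Let z0_ideal : arrow_ideal z0.
Proof.
apply: ideal_sum => a _; have [y ->] := cyc_right m gentle_arrow a.
by apply: idealMl; apply: mem_ideal_gen; exists a.
Qed.

Let arrow0 a b : b != sigma a -> gentle_arrow b * gentle_arrow a = 0.
Proof.
move=> ne; rewrite -[LHS]rmorphM -[RHS](rmorph0 (qpi I)); apply: qpi_eq.
by rewrite subr0; exact: sigma_uniq.
Qed.

Let z0_arrow b : z0 * gentle_arrow b = gentle_arrow b * z0.
Proof.
rewrite mulr_suml mulr_sumr (bigD1 (sigma b)) //= [RHS](bigD1 b) //= cyc_pow_comm.
congr (_ + _); rewrite !big1 // => a ne.
  have [c e [y ->]] := cyc_left m gentle_arrow a.
  by rewrite mulrA arrow0 ?mul0r // e eq_sym.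
have [y ->] := cyc_right m gentle_arrow a.
by rewrite -mulrA arrow0 ?mulr0.
Qed.

Let gentle_arrow_idem a j :
  gentle_arrow a * qpi I (idem_elt j) = if source a == j then gentle_arrow a else 0.
Proof. by rewrite -qpiM arrow_idem; case: ifP => // _; rewrite rmorph0. Qed.

Let idem_gentle_arrow a j :
  qpi I (idem_elt j) * gentle_arrow a = if target a == j then gentle_arrow a else 0.
Proof. by rewrite -qpiM idem_arrow; case: ifP => // _; rewrite rmorph0. Qed.

Let z0_idem j : z0 * qpi I (idem_elt j) = qpi I (idem_elt j) * z0.
Proof.
rewrite mulr_suml mulr_sumr; apply: eq_bigr => a _.
transitivity (if source a == j then cyc_pow m gentle_arrow a else 0).
  have [y ->] := cyc_right m gentle_arrow a.
  by rewrite -mulrA gentle_arrow_idem; case: ifP => // _; rewrite mulr0.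
have [c e [y ->]] := cyc_left m gentle_arrow a.
by rewrite mulrA idem_gentle_arrow target_sigma e; case: ifP => // _; rewrite mul0r.
Qed.

Let z0_central u : z0 * u = u * z0.
Proof.
elim/quot_ind: u => f; have [s ->] := path_alg_sum f.
rewrite rmorph_sum [LHS]mulr_sumr [RHS]mulr_suml; apply: eq_bigr => p _.
rewrite rmorphM mulrA.
have -> : z0 * qpi I (strmap (path_coef f p)) = qpi I (strmap (path_coef f p)) * z0.
  exact/esym/(strmap_central (path_coef f p) z0).
rewrite -!mulrA; congr (_ * _).
case: p => -[i r]; elim: r i => [|a r IH] i h; first by rewrite path_elt_nil z0_idem.
have h' : walk (target a) r by case/andP: h.
rewrite (path_elt_cons k h h') rmorphM mulrA IH -!mulrA; congr (_ * _).
exact: z0_arrow.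
Qed.

Lemma ribbon_z_nil n : lev ribbon_z n ^+ n = 0.
Proof.
rewrite ribbon_zE /= -rmorphXn -[RHS](rmorph0 (qpi _)); apply: qpi_eq.
by rewrite subr0; apply: ideal_exp_pow.
Qed.

Lemma ribbon_z_central (u : ribbon) : ribbon_z * u = u * ribbon_z.
Proof.
rewrite ribbon_zE; apply: completionP => n.
rewrite [LHS](_ : _ = qpi _ z0 * lev u n) // [RHS](_ : _ = lev u n * qpi _ z0) //.
by elim/quot_ind: (lev u n) => y; rewrite -!rmorphM z0_central.
Qed.

(* The ribbon graph order as a k[[t]]-algebra via t |-> z. *)
Definition ribbon_order : algebraOver (power_series k) :=
  order_via ribbon_z_nil ribbon_z_central.

Definition twisted_brauer_alg : algebraOver k :=
  quot (ideal_central ribbon_z_central).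

End Multiplicity.

(* [eps a] is true when the sign of a is minus. *)
Record polarization := Polarization {
  pol_sign :> arrow Q -> bool;
  pol_source : forall a b, a != b -> source a = source b -> pol_sign a != pol_sign b }.

Definition is_involution (m : multiplicity Q) (eps : polarization)
    (f : ribbon_order m -> ribbon_order m) : Prop :=
  [/\ alg_morphism f,
      forall i, f (ribbon_idem i) = ribbon_idem i &
      forall a, f (ribbon_arrow a) =
        (-1) ^+ eps (sigma a) * (-1) ^+ eps a * ribbon_arrow a].

Definition ribbon_w (m : multiplicity Q) (eps : polarization) : ribbon :=
  \sum_(a : arrow Q) (-1) ^+ eps a * cyc_pow m ribbon_arrow a.

Definition ribbon_mod_w (m : multiplicity Q) (eps : polarization) : algebraOver k :=
  quot (ideal_gen (fun y : ribbon => y = ribbon_w m eps)).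

(* The algebra kQ / (I + J_-). *)
Definition brauer_ideal (m : multiplicity Q) : ideal (path_alg k Q) :=
  ideal_add I (ideal_gen (fun y => exists a b : arrow Q, source a = source b /\
    y = cyc_pow m arrow_elt a - cyc_pow m arrow_elt b)).

Definition brauer_quiver_alg (m : multiplicity Q) : algebraOver k :=
  quot (brauer_ideal m).

End RibbonGraphOrder.

(* An edge is incident to the nodes in [ends e]: two nodes, or one for a loop. *)
Record multigraph := Multigraph {
  gnode : finType;
  gedge : finType;
  ends : gedge -> {set gnode} }.

Definition bipartite (G : multigraph) : Prop :=
  exists color : gnode G -> bool, forall e : gedge G,
    exists u v, [/\ u \in ends e, v \in ends e & color u != color v].

Definition gentle_graph (k : fieldType) (Q : gentle_quiver k) : multigraph :=
  @Multigraph (node Q) (vertex Q)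
    (fun i => [set node_of a | a : arrow Q & source a == i]).

Record fgmod (A : pzRingType) := FGMod {
  fgmod_sort :> lmodType A;
  fgmod_gen : exists s : seq fgmod_sort, forall x, exists c : 'I_(size s) -> A,
    x = \sum_(i < size s) c i *: s`_i }.

Section Morita.
Variable k : fieldType.

(* k-linear functors between categories of finitely generated left modules *)
Record mod_functor (A B : algebraOver k) := ModFunctor {
  fobj :> fgmod A -> fgmod B;
  fmap : forall M N : fgmod A, {linear M -> N} -> {linear fobj M -> fobj N};
  fmap_id : forall (M : fgmod A) (x : fobj M), fmap idfun x = x;
  fmap_comp : forall (M N P : fgmod A) (g : {linear N -> P}) (f : {linear M -> N}) x,
    fmap (g \o f) x = fmap g (fmap f x);
  fmap_linear : forall (M N : fgmod A) (c : k) (f g h : {linear M -> N}),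
    (forall x, h x = strmap c *: f x + g x) ->
    forall x, fmap h x = strmap c *: fmap f x + fmap g x }.

Definition morita_equivalent (A B : algebraOver k) : Prop :=
  exists (F : mod_functor A B) (G : mod_functor B A),
    (exists eta : forall M : fgmod A, {linear M -> G (F M)},
      (forall M, bijective (eta M)) /\
      forall (M N : fgmod A) (f : {linear M -> N}) x,
        eta N (f x) = fmap G (fmap F f) (eta M x)) /\
    (exists theta : forall M : fgmod B, {linear M -> F (G M)},
      (forall M, bijective (theta M)) /\
      forall (M N : fgmod B) (f : {linear M -> N}) x,
        theta N (f x) = fmap F (fmap G f) (theta M x)).

Definition is_brauer_graph_algebra (B : algebraOver k) : Prop :=
  findim B /\ exists (Q : gentle_quiver k) (m : multiplicity Q),
    morita_equivalent B (brauer_quiver_alg m).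

End Morita.

(* Main.v *)
Require Import Defs.
From HB Require Import structures.
From mathcomp Require Import all_boot all_order all_algebra.
From mathcomp Require Import perm generic_quotient ring_quotient boolp functions.

(** An element x of Lambda amounts to its coefficients x(a, n) at the paths
    sigma^(n-1)(a) ... sigma(a) a of length n, which are the paths outside I.
    The coefficient x(a, 0) is taken at the trivial path of the vertex s(a), so
    it agrees on the two arrows starting at a vertex; any family with this
    property occurs (rcoefP, rcoef_rmk). Products are convolutions along the
    orbits. With N_a the length of c_a^m(v_a), the ideals of Lambda generated by z
    and by w consist of the x with x(a, n) = 0 for n < N_a and
    x(a, N_a) = c x(b, N_b) for the two arrows a, b at each vertex, where c = 1
    for z and c = -1 for w (ideal_zP, ideal_wP).

    The symmetry of Lambda, the symmetry of A, the condition on G and k, and the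
    triviality of some involution are each equivalent to one condition: the signs
    of some polarization, read in k, are constant on the orbits of sigma
    (orbit_signs). For the graph, such signs are a two-colouring of the nodes,
    unless 1 = -1 in k (bipartite_orbit_signs). The involution multiplies an arrow
    a by the product of the signs of a and sigma(a)
    (trivial_involution_orbit_signs).

    A symmetrizing form of Lambda or of A yields a symmetric k-linear form lam on
    Lambda whose radical is z Lambda and which vanishes there. The cycles c_a^m
    and c_sigma(a)^m are rotations of each other, hence lam(c_a^m) depends on the
    node of a only. It is nonzero, because modulo z Lambda every multiple of c_a^m
    is a scalar multiple. Since c_a^m + c_b^m lies in z Lambda, the two arrows at a
    vertex have opposite values. Unless 1 = -1 in k, choosing one element in each
    pair of opposite elements of k turns these values into signs
    (trace_form_orbit_signs).
    Conversely, from signs s_a constant on the orbits, the power series with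
    coefficients sum_a s_a x(a, (j+1) N_a) defines a symmetrizing form of Lambda
    over k[[t]], and its constant term one of A (order_symmetric,
    twisted_symmetric).

    For a Brauer graph algebra the relations are c_a^m - c_b^m, and the form that
    adds up the coefficients of all cycles c_a^m, without signs, is symmetric and
    nondegenerate (brauer_nondeg_trace). The existence of such a form is a Morita
    invariant: if F is an equivalence, F(A) is a retract of a free module, and the
    trace of matrices transfers the form to End(F(A)), the opposite of A
    (morita_nondeg_trace). So if A is isomorphic to a Brauer graph algebra, then A
    carries such a form, which gives constant signs. Moreover, Lambda modulo w is
    the Brauer graph algebra kQ/(I + J_-), because both ideals are described by the
    same condition on coefficients (brauer_quiver_iso). Finally, if the signs are constant
    and the roots exist, multiplying one arrow of each negative orbit by a root
    of x^m + 1 is an automorphism of Lambda that maps z Lambda onto the ideal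
    generated by w (twisted_iso_ribbon_mod_w). *)

Set Implicit Arguments.
Unset Strict Implicit.
Unset Printing Implicit Defensive.

Import GRing.Theory.
Local Open Scope ring_scope.

#[local] Arguments strmap : simpl never.

(** * Arrows and orbits *)

Lemma sum_nat_only (V : nmodType) (n i : nat) (F : nat -> V) :
    (forall j, (j <= n)%N -> j != i -> F j = 0) ->
  \sum_(0 <= j < n.+1) F j = if (i <= n)%N then F i else 0.
Proof.
move=> F0; rewrite big_mkord; case: leqP => hi.
  have lt_i : (i < n.+1)%N by [].
  rewrite (bigD1 (Ordinal lt_i)) //= big1 ?addr0 // => j ne.
  by apply: F0; rewrite // -ltnS ltn_ord.
by rewrite big1 // => j _; apply: F0; rewrite ?neq_ltn ?(leq_trans (ltn_ord j)) // -ltnS.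
Qed.

(** The length of the path c_a^m(v_a). *)
HB.lock Definition height (k : fieldType) (Q : gentle_quiver k) (m : multiplicity Q)
  (a : arrow Q) : nat := (orbit_len a * m (node_of a))%N.

Section ArrowCombinatorics.
Variables (k : fieldType) (Q : gentle_quiver k).
Implicit Types (a b : arrow Q) (i : vertex Q).

Lemma arrows_at i : exists a b : arrow Q,
  [/\ a != b, source a = i, source b = i & forall c, source c = i -> (c == a) || (c == b)].
Proof.
have two : #|[set c : arrow Q | source c == i]| = 2%N := gentle_out (gq_gentle Q) i.
have /eqP/cards2P[a [b [ab e]]] := two.
have h c : (source c == i) = (c == a) || (c == b).
  by move/setP/(_ c): e; rewrite !inE.
exists a, b; split=> //; [by apply/eqP; rewrite h eqxx|by apply/eqP; rewrite h eqxx orbT|].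
by move=> c /eqP; rewrite h.
Qed.

Lemma other_arrow a : exists b, a != b /\ source a = source b.
Proof.
have [b [c [bc sb sc h]]] := arrows_at (source a).
have /orP[/eqP->|/eqP->] := h a (erefl _); first by exists c; rewrite sb sc.
by exists b; rewrite eq_sym sb sc.
Qed.

Lemma arrow_at i : exists a : arrow Q, source a == i.
Proof. by have [a [_ [_ /eqP ? _ _]]] := arrows_at i; exists a. Qed.

(** Each vertex is the source of exactly two arrows, so a sum over the arrows
    runs over disjoint pairs. *)
Lemma sum_source_pairs (V : nmodType) (F : arrow Q -> V) :
  (forall a b, a != b -> source a = source b -> F a + F b = 0) -> \sum_a F a = 0.
Proof.
move=> F0; rewrite (partition_big (@source Q) xpredT) //=; apply: big1 => i _.
have [a [b [ab sa sb hc]]] := arrows_at i.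
rewrite (bigD1 a) ?sa //= (bigD1 b) /=; last by rewrite sb eqxx eq_sym.
rewrite big1 ?addr0 => [|c /andP[/andP[/eqP/hc h ca] cb]]; first by rewrite F0 ?sa.
by rewrite (negbTE ca) (negbTE cb) in h.
Qed.

Variable m : multiplicity Q.

Local Notation height := (height m).

Lemma height_gt0 a : (0 < height a)%N.
Proof. by rewrite height.unlock muln_gt0 orbit_len_gt0 mult_gt0. Qed.

Lemma node_of_sigma a : node_of (sigma a) = node_of a.
Proof. by apply: val_inj; exact: porbit_sigma. Qed.

Lemma node_of_iter n a : node_of (iter n sigma a) = node_of a.
Proof. by elim: n => //= n IH; rewrite node_of_sigma. Qed.

Lemma height_iter n a : height (iter n sigma a) = height a.
Proof.
rewrite height.unlock node_of_iter; congr (_ * _)%N.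
by elim: n => //= n IH; rewrite /orbit_len porbit_sigma.
Qed.

Lemma iter_mul_height j a : iter (j * height a) sigma a = a.
Proof.
rewrite height.unlock [(_ * m _)%N]mulnC mulnA; elim: (j * _)%N => //= n IH.
by rewrite mulSn iterD IH iter_orbit_len.
Qed.

Lemma iter_height a : iter (height a) sigma a = a.
Proof. by rewrite -{1}[height a]mul1n iter_mul_height. Qed.

Lemma iter_sigma_inj n : injective (iter n (@sigma k Q)).
Proof. by elim: n => //= n IH a b /perm_inj/IH. Qed.

End ArrowCombinatorics.

(** * Coefficients in the path algebra *)

Section PathCoefficients.
Variables (k : fieldType) (Q : gentle_quiver k).
Local Notation I := (gq_ideal Q).
Implicit Types (a b : arrow Q) (f g : path_alg k Q).

Lemma walk_traject a n : walk (source a) (traject sigma a n).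
Proof. by elim: n a => //= n IH a; rewrite eqxx target_sigma; exact: IH. Qed.

Lemma walk_end_traject a n : walk_end (source a) (traject sigma a n) = source (iter n sigma a).
Proof.
case: n => // n; rewrite /walk_end trajectSr map_rcons last_rcons target_sigma.
by rewrite iterS.
Qed.

(** The path of length n outside I that starts with the arrow a. *)
Definition spath a n : qpath Q :=
  exist (fun p => walk p.1 p.2) (source a, traject sigma a n) (walk_traject a n).

Lemma qlen_spath a n : qlen (spath a n) = n.
Proof. by rewrite /qlen size_traject. Qed.

Lemma drop_traject (T : Type) (h : T -> T) x i n : (i <= n)%N ->
  drop i (traject h x n) = traject h (iter i h x) (n - i).
Proof.
elim: n i x => [|n IH] [|i] x //= hi.
by rewrite IH // -iterSr.
Qed.

Lemma qtake_spath a j n : (j <= n)%N -> qtake j (spath a n) = spath a j.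
Proof. by move=> h; apply: val_inj; rewrite /= take_traject. Qed.

Lemma qdrop_spath a j n :
  (j <= n)%N -> qdrop j (spath a n) = spath (iter j sigma a) (n - j).
Proof.
by move=> h; apply: val_inj; rewrite /= take_traject // walk_end_traject drop_traject.
Qed.

Lemma spathS_inj a b n : spath a n.+1 = spath b n.+1 -> a = b.
Proof. by move/(congr1 val) => -[]. Qed.

(** At n = 0 this is the coefficient of the trivial path of the vertex s(a). *)
Definition pcoef f a n : k := path_coef f (spath a n).
#[local] Arguments pcoef : simpl never.

Lemma pcoefB f g a n : pcoef (f - g) a n = pcoef f a n - pcoef g a n.
Proof. by rewrite /pcoef -[path_coef (f - g)]/(\val (f - g)) rmorphB. Qed.

Lemma pcoefD f g a n : pcoef (f + g) a n = pcoef f a n + pcoef g a n.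
Proof. by rewrite /pcoef -[path_coef (f + g)]/(\val (f + g)) rmorphD. Qed.

Lemma pcoef_zero a n : pcoef 0 a n = 0.
Proof. by rewrite -(subrr 0) pcoefB subrr. Qed.

(** A path of length n outside I splits only into initial and final pieces
    outside I. *)
Lemma pcoefM f g a n :
  pcoef (f * g) a n = \sum_(0 <= j < n.+1) pcoef f (iter j sigma a) (n - j) * pcoef g a j.
Proof.
rewrite /pcoef -[path_coef (f * g)]/(\val (f * g)) rmorphM [LHS]/(pf_mul _ _ _) /pf_mul qlen_spath.
rewrite big_mkord; apply: eq_bigr => j _; have h : (j <= n)%N by rewrite -ltnS.
by rewrite qtake_spath // qdrop_spath.
Qed.

Lemma pcoef_str c a n : pcoef (strmap c) a n = if n == 0%N then c else 0.
Proof. by rewrite [LHS](_ : _ = pf_const c (spath a n)) // /pf_const qlen_spath. Qed.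

Lemma pcoef_source f a b : source a = source b -> pcoef f a 0 = pcoef f b 0.
Proof. by move=> e; congr (path_coef f _); apply: val_inj; rewrite /= e. Qed.

Lemma pcoef_arrow a b n : pcoef (arrow_elt a) b n = ((b == a) && (n == 1%N))%:R.
Proof.
rewrite /pcoef /= /delta -val_eqE /= xpair_eqE; congr (nat_of_bool _)%:R.
case: n => [|[|n]] /=; rewrite ?andbF ?andbT ?eqseq_cons ?andbF ?andbT //.
by have [->|] := eqVneq b a; rewrite ?eqxx ?andbF.
Qed.

(** For n = 0 the product is 1, whose coefficient is 1 at every trivial path. *)
Lemma pcoef_prod a n b l :
  pcoef (\prod_(c <- rev (traject sigma a n)) arrow_elt c) b l =
  ((l == n) && ((n == 0%N) || (b == a)))%:R.
Proof.
elim: n a b l => [|n IH] a b l.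
  have e : strmap 1 = 1 :> path_alg k Q by rewrite rmorph1.
  rewrite big_nil -e pcoef_str andbT.
  by case: (l == 0%N).
rewrite trajectS rev_cons big_rcons /= pcoefM.
rewrite (@sum_nat_only _ _ 1) => [|j _ ne]; last first.
  by rewrite pcoef_arrow (negbTE ne) andbF mulr0.
rewrite pcoef_arrow andbT; case: l => [|l] //=.
have [->|ne] := eqVneq b a; last by rewrite andbF mulr0.
by rewrite IH subn1 /= eqxx orbT eqSS mulr1.
Qed.

(** A path lies in I as soon as some arrow in it is followed by another arrow than
    its image under sigma. *)
Lemma exists_spath_or_ideal (p : qpath Q) :
  (exists a, p = spath a (qlen p)) \/ I (path_elt p).
Proof.
case: p => -[i s]; elim: s i => [|a s IH] i h.
  by left; have [a /eqP e] := arrow_at i; exists a; apply: val_inj; rewrite /= e.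
have h' : walk (target a) s by case/andP: h.
have ei : source a = i by case/andP: h => /eqP.
rewrite (path_elt_cons k h h'); case: s IH h h' => [|b s] IH h h'.
  by left; exists a; apply: val_inj; rewrite /= ei.
have [[c e]|Ip] := IH _ h'; last by right; exact: Defs.idealMr.
have {c e} e : s = traject sigma (sigma b) (size s).
  by move/(congr1 val): e => /= -[_ <- <-].
have [eb|nb] := eqVneq b (sigma a).
  by left; exists a; apply: val_inj; rewrite /= ei -eb -e.
right; have h'' : walk (target b) s by case/andP: h'.
by rewrite (path_elt_cons k h' h'') -mulrA; apply: idealMl; exact: sigma_uniq.
Qed.

(** I is generated by paths of length two, and each of them differs from every
    sigma(a) a, so it has no coefficient at the paths outside I. *)
Lemma ideal_pcoefP f : I f <-> forall a n, pcoef f a n = 0.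
Proof.
split=> [If a n|f0]; last first.
  have [s ->] := path_alg_sum f; apply: ideal_sum => p _.
  have [[a ->]|] := exists_spath_or_ideal p; last exact: idealMl.
  rewrite (_ : path_coef _ _ = 0); last exact: f0.
  by rewrite rmorph0 mul0r; exact: ideal0.
have [P [_ genI]] := gentle_quadratic (gq_gentle Q).
pose KP (g : path_alg k Q) := forall a n, pcoef g a n = 0.
have K0 : KP 0 by move=> b j; exact: pcoef_zero.
have KD x y : KP x -> KP y -> KP (x + y).
  by move=> hx hy b j; rewrite pcoefD hx hy addr0.
have KMl c x : KP x -> KP (c * x).
  by move=> hx b j; rewrite pcoefM big1 // => l _; rewrite hx mulr0.
have KMr x c : KP x -> KP (x * c).
  by move=> hx b j; rewrite pcoefM big1 // => l _; rewrite hx mul0r.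
move: a n; have /genI/(_ (Ideal K0 KD KMl KMr)) /= := If; apply.
move=> y [b [a [Pba ->]]] c n.
have Iba : I (arrow_elt b * arrow_elt a) by apply/genI/mem_ideal_gen; exists b, a.
rewrite pcoefM big1 // => j _; rewrite !pcoef_arrow.
have [/andP[/eqP-> /eqP->]|] := boolP ((c == a) && (j == 1%N :> nat)); last by rewrite mulr0.
rewrite /=; have [/andP[/eqP e _]|] := boolP (_ && _); last by rewrite mul0r.
by case: (@next_arrowP _ _ a); move: Iba; rewrite -e permE.
Qed.

Section Truncation.
Variables (F : arrow Q -> nat -> k) (n : nat).

(* A trivial path is spath a 0 for both arrows a at its vertex, so an arrow is
   picked; the family F is meant to be constant on them. *)
Let trunc_fun (p : qpath Q) : k :=
  if [pick a | (qlen p < n)%N && (p == spath a (qlen p))] is Some a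
  then F a (qlen p) else 0.

Let trunc_fin : trunc_fun \in @fin_supp k Q.
Proof.
apply/fin_suppP; exists [seq spath a j | a <- enum (arrow Q), j <- iota 0 n] => p hp.
rewrite /trunc_fun; case: pickP => // a /andP[hl /eqP e]; case/negP: hp.
by apply/allpairsP; exists (a, qlen p); rewrite mem_enum mem_iota.
Qed.

Definition ptrunc : path_alg k Q := PathAlg trunc_fin.

Lemma pcoef_ptrunc : (forall a b, source a = source b -> F a 0 = F b 0) ->
  forall a j, pcoef ptrunc a j = if (j < n)%N then F a j else 0.
Proof.
move=> F0 a j; rewrite /pcoef /= /trunc_fun qlen_spath.
case: pickP => [b /andP[-> /eqP e]|/(_ a)]; last by rewrite eqxx andbT => ->.
case: j e => [|j] e; first by apply: F0; move/(congr1 val): e => /= -[].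
by rewrite (spathS_inj e).
Qed.

End Truncation.

End PathCoefficients.

#[local] Arguments pcoef : simpl never.

(** * Coefficients in the ribbon graph order *)

Lemma qpi0 (S : comPzRingType) (A : algebraOver S) (L : ideal A) x : L x -> qpi L x = 0.
Proof. by move=> Lx; rewrite -(rmorph0 (qpi L)); apply: qpi_eq; rewrite subr0. Qed.

(** The powers of an ideal are built by multiplication on the left; here the new
    factor is on the right, as paths are extended at their start. *)
Lemma ideal_exp_mulr (A : pzRingType) (L : ideal A) n (x y : A) :
  ideal_exp L n x -> L y -> ideal_exp L n.+1 (x * y).
Proof.
elim: n x y => [|n IH] x y.
  move=> _ Ly; apply: mem_ideal_gen; exists (x * y); first exact: Defs.idealMl.
  by exists 1; rewrite ?mulr1.
pose E (u : A) := forall y, L y -> ideal_exp L n.+2 (u * y).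
have E0 : E 0 by move=> v _; rewrite mul0r; exact: Defs.ideal0.
have ED u v : E u -> E v -> E (u + v).
  by move=> hu hv t Lt; rewrite mulrDl; apply: Defs.idealD; [exact: hu|exact: hv].
have EMl c u : E u -> E (c * u).
  by move=> hu t Lt; rewrite -mulrA; apply: Defs.idealMl; exact: hu.
have EMr u c : E u -> E (u * c).
  by move=> hu t Lt; rewrite -mulrA; apply: hu; exact: Defs.idealMl.
move=> hx; apply: (hx (Ideal E0 ED EMl EMr)) => _ [u Lu [v Lv ->]] t Lt.
by apply: mem_ideal_gen; exists u => //; exists (v * t); [exact: IH|rewrite mulrA].
Qed.

Lemma ideal_exp_leq (A : pzRingType) (L : ideal A) n l (x : A) :
  (n <= l)%N -> ideal_exp L l x -> ideal_exp L n x.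
Proof.
move=> /subnK <-; elim: (l - n)%N => //= d IH h.
by apply: IH; exact: ideal_expS h.
Qed.

Section GentleCoefficients.
Variables (k : fieldType) (Q : gentle_quiver k).
Local Notation I := (gq_ideal Q).
Local Notation J := (arrow_ideal Q).
Implicit Types (a b : arrow Q) (x y : gentle_alg Q).

Definition gcoef x a n : k := pcoef (repr x) a n.
#[local] Arguments gcoef : simpl never.

Lemma gcoef_qpi f a n : gcoef (qpi I f) a n = pcoef f a n.
Proof.
apply/eqP; rewrite -subr_eq0 -pcoefB; apply/eqP.
by move: a n; apply/ideal_pcoefP; exact: qrepr.
Qed.

Lemma gcoefB x y a n : gcoef (x - y) a n = gcoef x a n - gcoef y a n.
Proof.
by elim/quot_ind: x => f; elim/quot_ind: y => g; rewrite -rmorphB !gcoef_qpi pcoefB.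
Qed.

Lemma gcoefD x y a n : gcoef (x + y) a n = gcoef x a n + gcoef y a n.
Proof.
by elim/quot_ind: x => f; elim/quot_ind: y => g; rewrite -rmorphD !gcoef_qpi pcoefD.
Qed.

Lemma gcoefM x y a n : gcoef (x * y) a n =
  \sum_(0 <= j < n.+1) gcoef x (iter j sigma a) (n - j) * gcoef y a j.
Proof.
elim/quot_ind: x => f; elim/quot_ind: y => g; rewrite -rmorphM gcoef_qpi pcoefM.
by apply: eq_bigr => j _; rewrite !gcoef_qpi.
Qed.

Lemma gcoef_str c a n : gcoef (strmap c) a n = if n == 0%N then c else 0.
Proof. by rewrite -(pcoef_str c a n) -gcoef_qpi. Qed.

Lemma gcoef_source x a b : source a = source b -> gcoef x a 0 = gcoef x b 0.
Proof. exact: pcoef_source. Qed.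

Lemma gcoef0 a n : gcoef 0 a n = 0.
Proof. by rewrite -(subrr 0) gcoefB subrr. Qed.

#[local] Obligation Tactic := idtac.

Definition low_ideal_mem n x := forall a j, (j < n)%N -> gcoef x a j = 0.

Program Definition low_ideal n : ideal (gentle_alg Q) :=
  @Ideal _ (low_ideal_mem n) _ _ _ _.
Next Obligation. by move=> n a j _; rewrite gcoef0. Qed.
Next Obligation. by move=> n x y h1 h2 a j hj; rewrite gcoefD h1 ?h2 ?addr0. Qed.
Next Obligation.
move=> n y x h a j hj; rewrite gcoefM big_nat big1 // => l /andP[_ hl].
by rewrite h ?mulr0 // (leq_trans _ hj).
Qed.
Next Obligation.
move=> n x y h a j hj; rewrite gcoefM big_nat big1 // => l /andP[_ hl].
by rewrite h ?mul0r // (leq_ltn_trans (leq_subr _ _) hj).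
Qed.

Lemma arrow_ideal_low x : J x -> low_ideal 1 x.
Proof.
apply=> _ [a ->] b [|//] _; by rewrite gcoef_qpi pcoef_arrow andbF.
Qed.

Lemma ideal_exp_low n x : ideal_exp J n x -> low_ideal n x.
Proof.
elim: n x => [|n IH] x; first by move=> _ a [].
apply=> _ [y /arrow_ideal_low hy [z /IH hz ->]] a j hj.
rewrite gcoefM big_nat big1 // => l /andP[_ hl].
have [lt_ln|le_nl] := ltnP l n; first by rewrite hz ?mulr0.
have -> : (j - l = 0)%N by apply/eqP; rewrite subn_eq0 (leq_trans _ le_nl).
by rewrite hy ?mul0r.
Qed.

Lemma path_elt_exp (p : qpath Q) : ideal_exp J (qlen p) (qpi I (path_elt p)).
Proof.
case: p => -[i s]; elim: s i => [//|a s IH] i h.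
have h' : walk (target a) s by case/andP: h.
rewrite (path_elt_cons k h h') rmorphM; apply: ideal_exp_mulr; first exact: IH.
by apply: mem_ideal_gen; exists a.
Qed.

(** Thus a compatible sequence modulo the powers of the arrow ideal is the same
    as a family of coefficients, fixed level by level. *)
Lemma ideal_expP n x : ideal_exp J n x <-> low_ideal n x.
Proof.
split; first exact: ideal_exp_low.
elim/quot_ind: x => f hf; have [s ->] := path_alg_sum f.
rewrite rmorph_sum; apply: ideal_sum => p _; rewrite rmorphM.
have [le_np|lt_pn] := leqP n (qlen p).
  by apply: Defs.idealMl; apply: ideal_exp_leq le_np _; exact: path_elt_exp.
have [[a e]|Ip] := exists_spath_or_ideal p.
  rewrite (_ : path_coef f p = 0) ?rmorph0 ?mul0r; first exact: Defs.ideal0.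
  by rewrite -(hf a _ lt_pn) gcoef_qpi /pcoef -e.
rewrite [X in _ * X](_ : _ = 0) ?mulr0; first exact: Defs.ideal0.
exact: qpi0.
Qed.

End GentleCoefficients.

Section RibbonCoefficients.
Variables (k : fieldType) (Q : gentle_quiver k).
Local Notation I := (gq_ideal Q).
Local Notation J := (arrow_ideal Q).
Implicit Types (a b : arrow Q) (x y : ribbon Q).

(** Level n + 1 of the inverse limit is the first that sees paths of length n. *)
Definition rcoef x a n : k := gcoef (repr (lev x n.+1)) a n.
#[local] Arguments rcoef : simpl never.

(** Every level above j gives the same coefficients at length j. *)
Lemma rcoef_qpi x n u a j :
  lev x n = qpi _ u -> (j < n)%N -> rcoef x a j = gcoef u a j.
Proof.
move=> e /subnK h; rewrite -h in e; elim: (n - j.+1)%N u e => [|d IH] u e.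
  apply/eqP; rewrite /rcoef -subr_eq0 -gcoefB; apply/eqP.
  have : ideal_exp J j.+1 (repr (lev x j.+1) - u) by rewrite e; exact: qrepr.
  by move/ideal_exp_low; apply.
apply: IH; rewrite -lev_compat -level_map_qpi; congr level_map.
exact: e.
Qed.

Lemma rcoef_to_completion u a n : rcoef (to_completion J u) a n = gcoef u a n.
Proof. exact: (@rcoef_qpi _ n.+1). Qed.

Lemma rcoefE x n : exists2 u, lev x n = qpi _ u &
  forall a j, (j < n)%N -> rcoef x a j = gcoef u a j.
Proof.
exists (repr (lev x n)); first by rewrite qreprK.
by move=> a j; apply: rcoef_qpi; rewrite qreprK.
Qed.

Lemma rcoef_lev x y n a j : lev x n = lev y n -> (j < n)%N -> rcoef x a j = rcoef y a j.
Proof.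
move=> e h; have [u eu hu] := rcoefE y n; rewrite hu //.
by apply: rcoef_qpi h; rewrite e.
Qed.

Lemma rcoefB x y a n : rcoef (x - y) a n = rcoef x a n - rcoef y a n.
Proof.
have [u ex hx] := rcoefE x n.+1; have [v ey hy] := rcoefE y n.+1.
rewrite hx // hy // -gcoefB; apply: (@rcoef_qpi _ n.+1) => //.
by rewrite qpi_zmod -ex -ey.
Qed.

Lemma rcoefD x y a n : rcoef (x + y) a n = rcoef x a n + rcoef y a n.
Proof.
have [u ex hx] := rcoefE x n.+1; have [v ey hy] := rcoefE y n.+1.
rewrite hx // hy // -gcoefD; apply: (@rcoef_qpi _ n.+1) => //.
by rewrite qpiD -ex -ey.
Qed.

Lemma rcoefM x y a n : rcoef (x * y) a n =
  \sum_(0 <= j < n.+1) rcoef x (iter j sigma a) (n - j) * rcoef y a j.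
Proof.
have [u ex hx] := rcoefE x n.+1; have [v ey hy] := rcoefE y n.+1.
rewrite (@rcoef_qpi _ n.+1 (u * v)) //; last by rewrite qpiM -ex -ey.
rewrite gcoefM big_nat [RHS]big_nat; apply: eq_bigr => j /andP[_ hj].
by rewrite hx ?hy // ltnS leq_subr.
Qed.

Lemma rcoef0 a n : rcoef 0 a n = 0.
Proof. by rewrite -(subrr 0) rcoefB subrr. Qed.

Lemma rcoefN x a n : rcoef (- x) a n = - rcoef x a n.
Proof. by rewrite -sub0r rcoefB rcoef0 sub0r. Qed.

Lemma rcoef_sum (T : Type) (r : seq T) (P : pred T) (F : T -> ribbon Q) a n :
  rcoef (\sum_(i <- r | P i) F i) a n = \sum_(i <- r | P i) rcoef (F i) a n.
Proof. by apply: (big_morph (fun x => rcoef x a n)) => [x y|]; rewrite ?rcoefD ?rcoef0. Qed.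

Lemma rcoef_strM (c : k) x a n : rcoef (strmap c * x) a n = c * rcoef x a n.
Proof.
have str j b : rcoef (strmap c) b j = if j == 0%N then c else 0.
  by rewrite -(gcoef_str c b) -rcoef_to_completion.
rewrite rcoefM (@sum_nat_only _ _ n) ?leqnn ?subnn ?str // => j jn ne.
by rewrite str subn_eq0 leqNgt ltn_neqAle ne jn mul0r.
Qed.

Lemma rcoef_source x a b : source a = source b -> rcoef x a 0 = rcoef x b 0.
Proof. by rewrite /rcoef; exact: gcoef_source. Qed.

Lemma rcoefP x y : (forall a n, rcoef x a n = rcoef y a n) -> x = y.
Proof.
move=> e; apply: completionP => n.
have [u ex hx] := rcoefE x n; have [v ey hy] := rcoefE y n.
rewrite ex ey; apply: qpi_eq; apply/ideal_expP => a j hj.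
by rewrite gcoefB -hx // -hy // e subrr.
Qed.

Section Mk.
Variables (F : arrow Q -> nat -> k).
Hypothesis F0 : forall a b, source a = source b -> F a 0 = F b 0.

Let mk_level n : quot (ideal_exp J n) := qpi _ (qpi I (ptrunc F n)).

Let mk_compat n : level_map (mk_level n.+1) = mk_level n.
Proof.
rewrite level_map_qpi; apply: qpi_eq; apply/ideal_expP => a j hj.
by rewrite gcoefB !gcoef_qpi !pcoef_ptrunc // hj ltnW ?subrr // ltnS ltnW.
Qed.

Lemma rcoef_exists : exists x, forall a n, rcoef x a n = F a n.
Proof.
exists (Completion mk_compat) => a n.
by rewrite (@rcoef_qpi _ n.+1 (qpi I (ptrunc F n.+1))) // gcoef_qpi pcoef_ptrunc ?leqnn.
Qed.

End Mk.

(** A family F that is not constant at length 0 on the arrows with a common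
    source is no family of coefficients, and then rmk F = 0. *)
Definition rmk (F : arrow Q -> nat -> k) : ribbon Q :=
  if pselect (exists x, forall a n, rcoef x a n = F a n) is left h then sval (cid h) else 0.

Lemma rcoef_rmk F : (forall a b, source a = source b -> F a 0 = F b 0) ->
  forall a n, rcoef (rmk F) a n = F a n.
Proof.
move=> F0; rewrite /rmk; case: pselect => [h|]; first by case: cid.
by case; exact: rcoef_exists.
Qed.

End RibbonCoefficients.

(** * The ideals of z and w *)

Section PathElements.
Variables (k : fieldType) (Q : gentle_quiver k) (m : multiplicity Q).
Local Notation I := (gq_ideal Q).
Local Notation J := (arrow_ideal Q).
Local Notation N := (height m).
Implicit Types (a b : arrow Q) (x y : ribbon Q).

Lemma pcoef_spath a r b j : pcoef (path_elt (spath a r)) b j =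
  ((j == r) && (if r == 0%N then source b == source a else b == a))%:R.
Proof.
rewrite /pcoef /= /delta; congr (nat_of_bool _)%:R; apply/eqP/andP => [e|[/eqP-> h]].
  have /(congr1 (@qlen Q)) := e; rewrite !qlen_spath => ejr; rewrite ejr in e *.
  split=> //; case: r e {ejr} => [|r] e /=; first by move/(congr1 val): e => -[->].
  by rewrite (spathS_inj e).
case: r h => [|r] /eqP e; last by rewrite e.
by apply: val_inj; rewrite /= e.
Qed.

(** For r = 0 this is the idempotent of the source of a. *)
Definition upath a r : ribbon Q := to_completion J (qpi I (path_elt (spath a r))).

Lemma rcoef_upath a r b j : rcoef (upath a r) b j =
  ((j == r) && (if r == 0%N then source b == source a else b == a))%:R.
Proof. by rewrite rcoef_to_completion gcoef_qpi pcoef_spath. Qed.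

Lemma rcoef_upathS a r b j : (0 < r)%N ->
  rcoef (upath a r) b j = ((j == r) && (b == a))%:R.
Proof. by case: r => // r _; rewrite rcoef_upath. Qed.

Lemma rcoef_upath0 a b j :
  rcoef (upath a 0) b j = ((j == 0%N) && (source b == source a))%:R.
Proof. by rewrite rcoef_upath. Qed.

(** Multiplication by a path shifts the coefficients along the one orbit that
    the path belongs to. *)
Lemma rcoef_upathM a r x b l : (0 < r)%N -> rcoef (upath a r * x) b l =
  if (r <= l)%N && (iter (l - r) sigma b == a) then rcoef x b (l - r) else 0.
Proof.
move=> r0; rewrite rcoefM; case: leqP => [le_rl|lt_lr] /=.
  rewrite (@sum_nat_only _ _ (l - r)) ?leq_subr => [|j jl ne].
    rewrite rcoef_upathS // subKn // eqxx /=.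
    by case: (_ == a); rewrite ?mul1r ?mul0r.
  rewrite rcoef_upathS // (_ : _ == _ = false) ?mul0r //.
  by apply: contraNF ne => /eqP <-; rewrite subKn.
rewrite big_nat big1 // => j _; rewrite rcoef_upathS // (_ : _ == _ = false) ?mul0r //.
by apply/negbTE; rewrite neq_ltn (leq_ltn_trans (leq_subr _ _) lt_lr).
Qed.

Lemma rcoef_upath0M a x b l :
  rcoef (upath a 0 * x) b l = if source (iter l sigma b) == source a then rcoef x b l else 0.
Proof.
rewrite rcoefM (@sum_nat_only _ _ l) ?leqnn => [|j jl ne].
  by rewrite rcoef_upath0 subnn /=; case: eqP; rewrite ?mul1r ?mul0r.
by rewrite rcoef_upath0 subn_eq0 leqNgt ltn_neqAle ne jl mul0r.
Qed.

Lemma rcoef_ribbon_arrow a b n : rcoef (ribbon_arrow a) b n = ((b == a) && (n == 1%N))%:R.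
Proof. by rewrite rcoef_to_completion gcoef_qpi pcoef_arrow. Qed.

Lemma prod_rev_traject (A : pzRingType) (F : arrow Q -> A) a j :
  cyc F a ^+ j = \prod_(b <- rev (traject sigma a (j * orbit_len a))) F b.
Proof.
elim: j => [|j IH]; first by rewrite expr0 big_nil.
by rewrite exprSr IH mulSn trajectD iter_orbit_len rev_cat big_cat.
Qed.

Lemma pcoef_cyc_pow a b n : pcoef (cyc_pow m arrow_elt a) b n = ((b == a) && (n == N b))%:R.
Proof.
have e : (m (node_of a) * orbit_len a)%N = N a by rewrite height.unlock mulnC.
rewrite /cyc_pow prod_rev_traject pcoef_prod e andbC.
rewrite gtn_eqF ?height_gt0 //=.
by case: eqP => //= ->.
Qed.

Lemma rcoef_cyc_pow a b n :
  rcoef (cyc_pow m (@ribbon_arrow k Q) a) b n = ((b == a) && (n == N b))%:R.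
Proof.
have e1 : cyc_pow m (@gentle_arrow k Q) a = qpi I (cyc_pow m arrow_elt a).
  exact: (cyc_pow_morph m (qpi I) arrow_elt a).
have e2 : cyc_pow m (@ribbon_arrow k Q) a = to_completion J (cyc_pow m (@gentle_arrow k Q) a).
  exact: (cyc_pow_morph m (to_completion J) (@gentle_arrow k Q) a).
by rewrite e2 e1 rcoef_to_completion gcoef_qpi pcoef_cyc_pow.
Qed.

Lemma rcoef_z a n : rcoef (ribbon_z m) a n = (n == N a)%:R.
Proof.
rewrite rcoef_sum (bigD1 a) //= rcoef_cyc_pow eqxx big1 ?addr0 // => b ne.
by rewrite rcoef_cyc_pow eq_sym (negbTE ne).
Qed.

Lemma rcoef_signM (e : bool) x a n : rcoef ((-1) ^+ e * x) a n = (-1) ^+ e * rcoef x a n.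
Proof. by case: e; rewrite ?mul1r // !mulN1r rcoefN. Qed.

Lemma rcoef_w (eps : polarization Q) a n :
  rcoef (ribbon_w m eps) a n = (-1) ^+ eps a * (n == N a)%:R.
Proof.
rewrite rcoef_sum (bigD1 a) //= rcoef_signM rcoef_cyc_pow eqxx big1 ?addr0 // => b ne.
by rewrite rcoef_signM rcoef_cyc_pow eq_sym (negbTE ne) mulr0.
Qed.

(** The hypothesis says that y is the sum of the F a c_a^m; z and w are of this
    form. *)
Lemma rcoef_mul_cycles (F : arrow Q -> k) x y a n :
    (forall b j, rcoef y b j = F b * (j == N b)%:R) ->
  rcoef (x * y) a n = if (N a <= n)%N then rcoef x a (n - N a) * F a else 0.
Proof.
move=> hy; rewrite rcoefM (@sum_nat_only _ _ (N a)) => [|j _ /negbTE ne].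
  by rewrite hy eqxx mulr1 iter_height.
by rewrite hy ne !mulr0.
Qed.

Lemma rcoef_mulz x a n :
  rcoef (x * ribbon_z m) a n = if (N a <= n)%N then rcoef x a (n - N a) else 0.
Proof.
rewrite (@rcoef_mul_cycles (fun=> 1)) => [|b j]; last by rewrite rcoef_z mul1r.
by rewrite mulr1.
Qed.

(** The condition on coefficients that cuts out the ideal of z for c = 1 and that
    of w for c = -1. *)
Definition socle_rel (c : k) (F : arrow Q -> nat -> k) : Prop :=
  (forall a n, (n < N a)%N -> F a n = 0) /\
  (forall a b, a != b -> source a = source b -> F a (N a) = c * F b (N b)).

Lemma socle_relD c F G :
  socle_rel c F -> socle_rel c G -> socle_rel c (fun a n => F a n + G a n).
Proof.
move=> [F0 F1] [G0 G1]; split=> [a n h|a b ne e]; first by rewrite F0 ?G0 ?addr0.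
by rewrite (F1 _ b) // (G1 _ b) // mulrDr.
Qed.

Definition conv (F G : arrow Q -> nat -> k) a n :=
  \sum_(0 <= j < n.+1) F (iter j sigma a) (n - j)%N * G a j.

(** Up to length N_a a product with a family that vanishes below it only involves
    the trivial paths of the other factor, and these agree at the two arrows of
    a vertex. *)
Lemma socle_rel_conv_l c F G :
    (forall a b, source a = source b -> F a 0 = F b 0) ->
  socle_rel c G -> socle_rel c (conv F G).
Proof.
move=> F0 [G0 G1]; have low a n : (n <= N a)%N -> conv F G a n = F (iter n sigma a) 0 * G a n.
  move=> h; rewrite /conv (@sum_nat_only _ _ n) ?leqnn ?subnn // => j jn ne.
  by rewrite G0 ?mulr0 // (leq_trans _ h) // ltn_neqAle ne.
split=> [a n h|a b ne e]; first by rewrite low ?(ltnW h) ?(G0 a n h) ?mulr0.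
by rewrite !low ?leqnn // !iter_height (F0 a b e) (G1 a b ne e) mulrCA.
Qed.

Lemma socle_rel_conv_r c F G :
    (forall a b, source a = source b -> G a 0 = G b 0) ->
  socle_rel c F -> socle_rel c (conv F G).
Proof.
move=> G0 [F0 F1]; have low a n : (n <= N a)%N -> conv F G a n = F a n * G a 0.
  move=> h; rewrite /conv (@sum_nat_only _ _ 0) ?subn0 // => j jn ne.
  rewrite F0 ?mul0r // height_iter (leq_trans _ h) // ltn_subrL lt0n ne /=.
  by apply: leq_trans jn; rewrite lt0n.
split=> [a n h|a b ne e]; first by rewrite low ?(ltnW h) ?(F0 a n h) ?mul0r.
by rewrite !low ?leqnn // (G0 a b e) (F1 a b ne e) mulrA.
Qed.

Lemma socle_rel_low c F : (forall a n, (n <= N a)%N -> F a n = 0) -> socle_rel c F.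
Proof.
move=> F0; split=> [a n h|a b _ _]; first by rewrite F0 ?(ltnW h).
by rewrite !F0 ?mulr0.
Qed.

Lemma socle_ideal (A : pzRingType) (coef : A -> arrow Q -> nat -> k) c :
    (forall a n, coef 0 a n = 0) ->
    (forall u v a n, coef (u + v) a n = coef u a n + coef v a n) ->
    (forall u v a n, coef (u * v) a n = conv (coef u) (coef v) a n) ->
    (forall u a b, source a = source b -> coef u a 0 = coef u b 0) ->
  exists K : ideal A, forall u, K u <-> socle_rel c (coef u).
Proof.
move=> coef0 coefD coefM coef_source.
have ext (F G : arrow Q -> nat -> k) : (forall a n, F a n = G a n) -> F = G.
  by move=> h; apply/funext => a; apply/funext.
pose K u := socle_rel c (coef u).
have K0 : K 0 by apply: socle_rel_low => a n _.
have KD u v : K u -> K v -> K (u + v).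
  by move=> hu hv; rewrite /K (ext _ _ (coefD u v)); exact: socle_relD.
have KMl u v : K v -> K (u * v).
  by move=> hv; rewrite /K (ext _ _ (coefM u v)); exact: socle_rel_conv_l (coef_source u) hv.
have KMr u v : K u -> K (u * v).
  by move=> hu; rewrite /K (ext _ _ (coefM u v)); exact: socle_rel_conv_r (coef_source v) hu.
by exists (Ideal K0 KD KMl KMr).
Qed.

(** Multiplication by z shifts the coefficients at a by N_a, so the quotient by z
    is found by shifting back; the relation makes the result agree at length 0. *)
Lemma ideal_zP x : ideal_central (@ribbon_z_central k Q m) x <-> socle_rel 1 (rcoef x).
Proof.
split=> [[y ->]|[x0 x1]].
  rewrite ribbon_z_central; split=> [a n h|a b ne e]; rewrite !rcoef_mulz ?leqnn.
    by rewrite leqNgt h.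
  by rewrite !subnn mul1r; exact: rcoef_source.
exists (rmk (fun a n => rcoef x a (n + N a))); rewrite ribbon_z_central.
apply: rcoefP => a n; rewrite rcoef_mulz; case: leqP => h; last by rewrite x0.
rewrite rcoef_rmk ?subnK // => {h}{a} a b e.
by have [->//|ne] := eqVneq a b; rewrite !add0n (x1 a b) ?mul1r.
Qed.

Lemma sign_opp (eps : polarization Q) a b : a != b -> source a = source b ->
  (-1) ^+ eps a = - (-1) ^+ eps b :> k.
Proof.
move=> ne e; have := pol_source eps ne e.
by case: (eps a); case: (eps b); rewrite //= ?opprK.
Qed.

Lemma sqr_sign_eq1 (e : bool) : (-1) ^+ e * (-1) ^+ e = 1 :> k.
Proof. by rewrite -expr2 sqrr_sign. Qed.

(** The signs of w at the two arrows of a vertex are opposite, whichever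
    polarization is used. Every element of the ideal is even a left multiple of w,
    obtained by shifting back the coefficients with the signs of eps. *)
Lemma ideal_wP (eps : polarization Q) x :
  ideal_gen (fun y => y = ribbon_w m eps) x <-> socle_rel (-1) (rcoef x).
Proof.
split=> [|[x0 x1]]; last first.
  pose F a n := (-1) ^+ eps a * rcoef x a (n + N a).
  have F0 a b : source a = source b -> F a 0 = F b 0.
    have [->//|ne e] := eqVneq a b.
    by rewrite /F !add0n (x1 a b) // mulN1r (sign_opp eps ne e) mulrNN.
  have -> : x = rmk F * ribbon_w m eps.
    apply: rcoefP => a n; rewrite (rcoef_mul_cycles _ _ _ (rcoef_w eps)).
    case: leqP => h; last by rewrite x0.
    by rewrite rcoef_rmk // /F subnK // mulrAC sqr_sign_eq1 mul1r.
  by apply: Defs.idealMl; exact: mem_ideal_gen.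
have [K KE] := @socle_ideal (ribbon Q) (@rcoef k Q) (-1) (@rcoef0 k Q) (@rcoefD k Q)
  (@rcoefM k Q) (@rcoef_source k Q).
move=> /(_ K) hx; apply/KE/hx => _ ->; apply/KE; split=> [a n h|a b ne e]; rewrite !rcoef_w.
  by rewrite ltn_eqF ?mulr0.
by rewrite !eqxx !mulr1 mulN1r; exact: sign_opp.
Qed.

Section Trace.
Variables (s : arrow Q -> k) (s_sigma : forall a, s (sigma a) = s a).

Lemma s_iter n a : s (iter n sigma a) = s a.
Proof. by elim: n => //= n IH; rewrite s_sigma. Qed.

(** The coefficient at c_a^q of a product pairs complementary arcs of the cycle;
    exchanging the factors rotates the starting point within the orbit. *)
Lemma conv_trace_sym q F G :
  \sum_a s a * conv F G a (q * N a) = \sum_a s a * conv G F a (q * N a).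
Proof.
(* A common bound for the lengths lets the two sums be exchanged. *)
pose B := (\max_a (q * N a)).+1.
have widen a (H : nat -> k) : \sum_(0 <= j < (q * N a).+1) H j =
    \sum_(j < B) if (j <= q * N a)%N then H j else 0.
  rewrite big_mkord (big_ord_widen B H) ?big_mkcond //.
  by rewrite ltnS (leq_bigmax (F := fun a => q * N a)%N).
have -> : \sum_a s a * conv F G a (q * N a) =
    \sum_a s a * \sum_(0 <= j < (q * N a).+1)
      F (iter (q * N a - j) sigma a) j * G a (q * N a - j)%N.
  apply: eq_bigr => a _; congr (_ * _); rewrite /conv big_nat_rev /= big_nat [RHS]big_nat.
  by apply: eq_bigr => j /andP[_ hj]; rewrite add0n subSS subKn.
under eq_bigr => a _ do rewrite widen big_distrr /=.
under [in RHS]eq_bigr => a _ do rewrite /conv widen big_distrr /=.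
rewrite exchange_big [RHS]exchange_big /=; apply: eq_bigr => j _.
rewrite (reindex_inj (@iter_sigma_inj k Q j)); apply: eq_bigr => a _ /=.
rewrite s_iter height_iter; congr (_ * _); case: leqP => // h.
by rewrite -iterD subnK // iter_mul_height mulrC.
Qed.

End Trace.

End PathElements.

(** * Signs along orbits *)

Section Signs.
Variables (k : fieldType) (Q : gentle_quiver k) (m : multiplicity Q).
Local Notation J := (arrow_ideal Q).
Local Notation N := (height m).
Implicit Types (a b : arrow Q) (x y : ribbon Q) (e : polarization Q).

(** Equality in k: in characteristic two it always holds. *)
Definition orbit_signs e := forall a, (-1) ^+ e (sigma a) = (-1) ^+ e a :> k.

Lemma sign_pchar2 (n : bool) : 2%N \in [pchar k] -> (-1) ^+ n = 1 :> k.
Proof. by move=> h; rewrite oppr_pchar2 // expr1n. Qed.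

Lemma sign_inj : 2%N \notin [pchar k] -> forall c d : bool, (-1) ^+ c = (-1) ^+ d :> k -> c = d.
Proof.
rewrite inE /= => n2.
have ne : -1 != 1 :> k.
  by apply: contra n2 => /eqP e; rewrite mulr2n -{1}e addNr.
by case=> -[] //=; rewrite expr0 expr1 => /eqP; rewrite ?[1 == _]eq_sym (negbTE ne).
Qed.

Lemma orbit_signs_node e : 2%N \notin [pchar k] -> orbit_signs e ->
  forall a b, node_of a = node_of b -> e a = e b.
Proof.
move=> n2 he a b /(congr1 val) /= /eqP; rewrite eq_porbit_mem => /porbitP[n ->].
elim: n => [|n IH]; first by rewrite expg0 perm1.
by rewrite expgSr permM (sign_inj n2 (he _)).
Qed.

(** The edge of a vertex joins the nodes of the two arrows starting there, so a
    two-colouring of the nodes is a polarization that is constant on orbits. *)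
Lemma bipartite_orbit_signs (eps : polarization Q) :
  bipartite (gentle_graph Q) \/ 2%N \in [pchar k] <-> exists e, orbit_signs e.
Proof.
split=> [[[color hc]|h2]|[e he]].
- have pol a b : a != b -> source a = source b ->
      color (node_of a) != color (node_of b).
    move=> ne eab; have [u [v [/imsetP[c + ->] /imsetP[d + ->] huv]]] := hc (source a).
    rewrite !inE => /eqP sc /eqP sd.
    have [x [y [_ sx sy hxy]]] := arrows_at (source a).
    have := hxy _ sc; have := hxy _ sd; have := hxy _ (esym eab); have := hxy _ (erefl (source a)).
    move=> /orP[]/eqP ? /orP[]/eqP ? /orP[]/eqP ? /orP[]/eqP ?; subst; subst;
      by rewrite ?eqxx // in ne huv *; rewrite // eq_sym.
  exists (Polarization pol) => a /=; by rewrite node_of_sigma.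
- by exists eps => a; rewrite !sign_pchar2.
- have [h2|n2] := boolP (2%N \in [pchar k]); [by right|left].
  pose color (v : node Q) := [exists a, (node_of a == v) && e a].
  have colorE c : color (node_of c) = e c.
    apply/existsP/idP => [[d /andP[/eqP h]]|h]; last by exists c; rewrite eqxx.
    by rewrite (orbit_signs_node n2 he h).
  exists color => i; have [a [b [ne sa sb _]]] := arrows_at i.
  exists (node_of a), (node_of b); split.
  + by apply: imset_f; rewrite inE sa.
  + by apply: imset_f; rewrite inE sb.
  + have h : e a != e b by apply: pol_source; rewrite ?sa ?sb.
    by rewrite -(colorE a) -(colorE b) in h.
Qed.

(** The involution maps a to the product of the signs of sigma(a) and a times a,
    and a is nonzero in Lambda. *)
Lemma trivial_involution_orbit_signs :
  (exists (e : polarization Q) (f : ribbon_order m -> ribbon_order m),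
    is_involution e f /\ f =1 id) <-> exists e, orbit_signs e.
Proof.
split=> [[e [f [[_ _ fa] fid]]]|[e he]]; exists e.
  move=> a; have /(congr1 (fun x => rcoef x a 1)) : ribbon_arrow a =
      (-1) ^+ e (sigma a) * (-1) ^+ e a * ribbon_arrow a :> ribbon Q.
    by rewrite -{1}[LHS]fid fa.
  rewrite -mulrA !rcoef_signM rcoef_ribbon_arrow !eqxx mulr1 => h.
  by have := congr1 (fun c => c * (-1) ^+ e a) h; rewrite mul1r -mulrA sqr_sign_eq1 mulr1.
exists id; split=> //; split=> // a; apply: rcoefP => b n.
by rewrite -mulrA !rcoef_signM he mulrA sqr_sign_eq1 mul1r.
Qed.

Lemma upathM a r s : upath (iter r sigma a) s * upath a r = upath a (r + s).
Proof.
rewrite /upath -!rmorphM; congr (to_completion J (qpi _ _)).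
have e : traject sigma a r ++ traject sigma (iter r sigma a) s = traject sigma a (r + s).
  by rewrite trajectD.
have h : walk (source a) (traject sigma a r ++ traject sigma (iter r sigma a) s).
  by rewrite e walk_traject.
rewrite (@path_eltM k Q (spath (iter r sigma a) s) (spath a r) h).
  by congr path_elt; apply: val_inj; rewrite /= e.
by rewrite /= walk_end_traject.
Qed.

Lemma rcoef_cycle a b n : rcoef (upath a (N a)) b n = ((n == N a) && (b == a))%:R.
Proof. by rewrite rcoef_upathS ?height_gt0. Qed.


Lemma rcoef_cycle_low a b n : (n < N b)%N -> rcoef (upath a (N a)) b n = 0.
Proof.
move=> h; rewrite rcoef_cycle; have [<-|_] := eqVneq b a; last by rewrite andbF.
by rewrite ltn_eqF.
Qed.

(** The sum is e_i z for the common source i of a and b. *)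
Lemma cycle_pair_socle a b : a != b -> source a = source b ->
  socle_rel m 1 (rcoef (upath a (N a) + upath b (N b))).
Proof.
move=> ne e; split=> [c n h|c d ncd ecd].
  by rewrite rcoefD !(rcoef_cycle_low _ h) addr0.
rewrite mul1r !rcoefD !rcoef_cycle.
have [x [y [_ _ _ h]]] := arrows_at (source a).
have aux v : ((N v == N a) && (v == a))%:R + ((N v == N b) && (v == b))%:R
    = (source v == source a)%:R :> k.
  have [->|na] := eqVneq v a; first by rewrite !eqxx (negbTE ne) andbF addr0.
  have [->|nb] := eqVneq v b; first by rewrite andbF e !eqxx add0r.
  rewrite !andbF addr0; case: eqP => // sv.
  have := h _ sv; have := h _ (esym e); have := h _ (erefl (source a)).
  move=> /orP[]/eqP ? /orP[]/eqP ? /orP[]/eqP ?; subst;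
   by rewrite ?eqxx // in ne na nb.
by rewrite !aux ecd.
Qed.

(** A symmetrizing form of Lambda/z Lambda, pulled back to Lambda. *)
Record trace_form (lam : ribbon Q -> k) : Prop := {
  traceD : forall x y, lam (x + y) = lam x + lam y;
  traceZ : forall c x, lam (strmap c * x) = c * lam x;
  traceC : forall x y, lam (x * y) = lam (y * x);
  trace_z : forall x, socle_rel m 1 (rcoef x) -> lam x = 0;
  trace_nondeg : forall x, (forall u, lam (u * x) = 0) -> socle_rel m 1 (rcoef x) }.

Section FromTrace.
Variables (lam : ribbon Q -> k) (lamP : trace_form lam).

Let f a := lam (upath a (N a)).

(** If p is the rest of the cycle, then c_a^m = p a and c_sigma(a)^m = a p. *)
Lemma trace_cycle_sigma a : f (sigma a) = f a.
Proof.
have e : height m (sigma a) = height m a := height_iter m 1 a.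
have n0 := height_gt0 m a.
rewrite /f e.
have -> : upath (sigma a) (N a) = upath a 1 * upath (sigma a) (N a).-1.
  have := upathM (sigma a) (N a).-1 1; rewrite addn1 prednK // -iterSr prednK //.
  by rewrite iter_height.
have -> : upath a (N a) = upath (sigma a) (N a).-1 * upath a 1.
  by rewrite (upathM a 1) add1n prednK.
exact: traceC.
Qed.

(** Modulo z Lambda, u c_a^m is the multiple of c_a^m by the constant coefficient
    of u. If the form vanished on c_a^m, then c_a^m would lie in z Lambda, whose
    elements have equal coefficients at c_a^m and c_b^m. *)
Lemma trace_cycle_neq0 a : f a != 0.
Proof.
apply/eqP => f0.
have [|c0 c1] := @trace_nondeg _ lamP (upath a (N a)).
  move=> u; pose y := u * upath a (N a) - strmap (rcoef u a 0) * upath a (N a).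
  have -> : u * upath a (N a) = y + strmap (rcoef u a 0) * upath a (N a) by rewrite subrK.
  rewrite (traceD lamP) (traceZ lamP) -/(f a) f0 mulr0 addr0; apply: (trace_z lamP).
  have y0 b n : (n <= N b)%N -> rcoef y b n = 0.
    move=> le_nN; rewrite rcoefB rcoef_strM rcoefM rcoef_cycle.
    rewrite (@sum_nat_only _ _ (N a)) => [|j _ ne]; last first.
      by rewrite rcoef_cycle (negbTE ne) mulr0.
    rewrite rcoef_cycle eqxx /=; have [eb|ne] := eqVneq b a; last first.
      by rewrite andbF !mulr0 subr0; case: ifP.
    rewrite {}eb in le_nN *; rewrite andbT iter_height; have [->|ne] := eqVneq n (N a).
      by rewrite leqnn subnn subrr.
    by rewrite leqNgt ltn_neqAle ne le_nN /= mulr0 subrr.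
  exact: socle_rel_low.
have [b [nab eab]] := other_arrow a.
have := c1 _ _ nab eab; rewrite !rcoef_cycle !eqxx [b == a]eq_sym (negbTE nab) andbF mulr0.
by move/eqP; rewrite oner_eq0.
Qed.

Lemma trace_cycle_opp a b : a != b -> source a = source b -> f a = - f b.
Proof.
move=> ne e; apply/eqP; rewrite -addr_eq0 -(traceD lamP); apply/eqP/(trace_z lamP).
exact: cycle_pair_socle.
Qed.

(** The values of the form on the cycles are nonzero, constant on orbits and
    opposite along edges. Outside characteristic two, a choice of one element in
    every pair of opposite elements of k therefore colours the nodes, without any
    normalization on the connected components. *)
Lemma trace_form_orbit_signs (eps : polarization Q) : exists e, orbit_signs e.
Proof.
have [h2|n2] := boolP (2%N \in [pchar k]).
  by exists eps => a; rewrite !sign_pchar2.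
pose P a := [pred x | (x == f a) || (x == - f a)].
pose g a := choose (P a) (f a).
have Pf a : P a (f a) by rewrite /= eqxx.
have gP a : P a (g a) by exact: chooseP.
have pol a b : a != b -> source a = source b -> (f a != g a) != (f b != g b).
  move=> ne e; have fab := trace_cycle_opp ne e.
  have Pab (c : k) : P a c = P b c by rewrite /= fab opprK orbC.
  have -> : g b = g a.
    by rewrite /g -(eq_choose Pab); apply: choose_id => //; rewrite Pab.
  have nfab : f a != f b.
    rewrite fab -subr_eq0 -opprD oppr_eq0 -mulr2n -mulr_natl mulf_eq0 negb_or.
    by rewrite trace_cycle_neq0 andbT; move: n2; rewrite inE /=.
  have := gP a; rewrite /= => /orP[] /eqP ->; rewrite -?fab ?eqxx //=.
    by rewrite [f b == _]eq_sym nfab.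
  by rewrite fab opprK eqxx -fab nfab.
exists (Polarization pol) => a /=.
by rewrite /g /P trace_cycle_sigma.
Qed.

End FromTrace.
End Signs.

(** * Symmetric algebras and bilinear forms *)

Lemma linear_ext (R : pzRingType) (U : lmodType R) (V : zmodType)
    (s : GRing.Scale.law R V) (f g : {linear U -> V | s}) :
  (forall x, f x = g x) -> f = g.
Proof.
case: f => f [[fD] [fZ]]; case: g => g [[gD] [gZ]] /= /funext e.
move: fD fZ gD gZ; rewrite e => fD fZ gD gZ.
by rewrite (Prop_irrelevance fD gD) (Prop_irrelevance fZ gZ).
Qed.

Section SymmetricForms.
Variables (S : comPzRingType) (A : algebraOver S).

Record nondeg_trace (lam : A -> S) : Prop := {
  symD : forall x y, lam (x + y) = lam x + lam y;
  symZ : forall c x, lam (strmap c * x) = c * lam x;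
  symC : forall x y, lam (x * y) = lam (y * x);
  sym_nondeg : forall x, (forall u, lam (u * x) = 0) -> x = 0 }.

(** The last condition is the surjectivity of the map from A to its dual that
    sends x to lam(- x). *)
Record symmetrizing_form (lam : A -> S) : Prop := {
  sym_trace :> nondeg_trace lam;
  sym_repr : forall psi : A -> S, (forall x y, psi (x + y) = psi x + psi y) ->
    (forall c x, psi (strmap c * x) = c * psi x) ->
    exists x, forall u, psi u = lam (u * x) }.

(** A bimodule isomorphism phi from A to its dual is determined by phi(1): the
    two module structures give phi(x)(u) = phi(1)(u x) = phi(1)(x u). *)
Lemma symmetric_algP : symmetric_alg A <-> exists lam, symmetrizing_form lam.
Proof.
have mkL (psi : A -> S) : (forall x y, psi (x + y) = psi x + psi y) ->
    (forall c x, psi (strmap c * x) = c * psi x) ->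
    exists f : {linear alg_mod A -> S^o}, forall x, f x = psi x.
  move=> hD hZ; have lin : linear (psi : alg_mod A -> S^o).
    by move=> c x y; rewrite hD; congr (_ + _); exact: hZ.
  pose L := GRing.isLinear.Build S (alg_mod A) S^o _ psi lin.
  by pose f : {linear alg_mod A -> S^o} := HB.pack psi L; exists f.
split=> [[phi [phi_bij phiD phiM]]|[lam lamP]].
  have phiE x u : phi x u = phi 1 (u * x).
    by have := phiM x 1 1 u; rewrite !mulr1 mul1r.
  have phiE' x u : phi x u = phi 1 (x * u).
    by have := phiM 1 1 x u; rewrite !mul1r mulr1.
  exists (phi 1); split; first split.
  - by move=> x y; exact: (linearD (phi 1)).
  - by move=> c x; exact: (linearZ_LR (phi 1) c x).
  - by move=> x y; rewrite -phiE' phiE.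
  - move=> x hx; apply: (bij_inj phi_bij); apply: linear_ext => u.
    have := phiD 0 0 u; rewrite addr0 => /eqP; rewrite -subr_eq0 opprD addNKr oppr_eq0 => /eqP->.
    by rewrite phiE hx.
  - move=> psi hD hZ; have [f fE] := mkL psi hD hZ; have [g gK Kg] := phi_bij.
    by exists (g f) => u; rewrite -phiE Kg fE.
have ex x : exists f : {linear alg_mod A -> S^o}, forall u, f u = lam (u * x).
  apply: mkL => [u v|c u]; first by rewrite mulrDl (symD lamP).
  by rewrite -mulrA (symZ lamP).
pose phi x := sval (cid (ex x)); have phiE x u : phi x u = lam (u * x).
  by rewrite /phi; case: cid.
have lam0 : lam 0 = 0 by have := symZ lamP 0 0; rewrite mulr0 mul0r.
have lamB x y : lam (x - y) = lam x - lam y.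
  by apply/eqP; rewrite eq_sym subr_eq -(symD lamP) subrK.
exists phi; split.
- have inj x y : phi x = phi y -> x = y.
    move=> e; apply/eqP; rewrite -subr_eq0; apply/eqP; apply: (sym_nondeg lamP) => u.
    by rewrite mulrBr lamB -!phiE e subrr.
  have sur f : exists x, phi x = f.
    have [x hx] := sym_repr lamP (psi := f) (linearD f) (fun c => linearZ_LR f c).
    by exists x; apply: linear_ext => u; rewrite phiE -hx.
  exists (fun f => sval (cid (sur f))) => x; last by case: cid.
  by apply: inj; case: cid.
- by move=> x y u; rewrite !phiE mulrDr (symD lamP).
- by move=> a x b u; rewrite !phiE !mulrA (symC lamP) !mulrA.
Qed.

End SymmetricForms.

(** * The action of k[[t]] on the ribbon graph order *)

Section PowerSeriesAction.
Variables (k : fieldType) (Q : gentle_quiver k) (m : multiplicity Q).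
Local Notation J := (arrow_ideal Q).
Local Notation N := (height m).
Local Notation L := (ribbon_order m).
Local Notation R := (power_series k).
Implicit Types (a b : arrow Q) (x y : ribbon Q) (r p : R).

Lemma rcoef_mulz_exp x i a n : rcoef (x * ribbon_z m ^+ i) a n =
  if (i * N a <= n)%N then rcoef x a (n - i * N a) else 0.
Proof.
elim: i n => [|i IH] n; first by rewrite expr0 mulr1 mul0n leq0n subn0.
rewrite exprSr mulrA rcoef_mulz; case: leqP => [h|h].
  rewrite IH mulSn subnDA; congr (if _ then _ else _).
  by rewrite addnC leq_subRL // addnC.
by rewrite leqNgt (leq_trans h) // mulSn leq_addr.
Qed.

Lemma ps_mulE r p n : (r * p) n = \sum_(0 <= i < n.+1) r i * p (n - i)%N.
Proof. by rewrite big_mkord. Qed.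

Definition ps_var : R := fun n => (n == 1%N)%:R.

Lemma ps_var_mul0 r : (ps_var * r) 0 = 0.
Proof. by rewrite ps_mulE big_nat1 mul0r. Qed.

Lemma ps_var_mulS r n : (ps_var * r) n.+1 = r n.
Proof.
rewrite ps_mulE (@sum_nat_only _ _ 1) => [|j _ /negbTE ne]; last by rewrite /ps_var ne mul0r.
by rewrite /ps_var mul1r subn1.
Qed.

(** Up to length n only the powers z^i with i <= n contribute, so the series may
    be replaced by a polynomial. *)
Lemma rcoef_psM r (x : L) a n : rcoef (strmap r * x : L) a n =
  \sum_(0 <= i < n.+1) if (i * N a <= n)%N then r i * rcoef x a (n - i * N a) else 0.
Proof.
pose P : ribbon Q := \sum_(i < n.+1) strmap (r i) * ribbon_z m ^+ i.
have levP : lev P n.+1 = lev (strmap r : L) n.+1.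
  rewrite -[LHS]/(lev_at n.+1 P) rmorph_sum; apply: eq_bigr => i _.
  by rewrite rmorphM rmorphXn.
have -> : rcoef (strmap r * x : L) a n = rcoef (P * x) a n.
  apply: (@rcoef_lev _ _ _ _ n.+1); last exact: ltnSn.
  rewrite -[LHS]/(lev (strmap r : L) n.+1 * lev x n.+1).
  by rewrite -levP.
rewrite mulr_suml rcoef_sum big_mkord; apply: eq_bigr => i _.
have zC : ribbon_z m ^+ i * x = x * ribbon_z m ^+ i.
  have h : GRing.comm (x : ribbon Q) (ribbon_z m) by exact: esym (ribbon_z_central m x).
  exact: esym (commrX i h).
rewrite -mulrA zC rcoef_strM rcoef_mulz_exp; case: ifP => //; by rewrite mulr0.
Qed.

Lemma ps_var_action (x : L) : strmap ps_var * x = x * ribbon_z m :> ribbon Q.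
Proof.
apply: rcoefP => a n; rewrite [LHS]rcoef_psM rcoef_mulz.
rewrite (@sum_nat_only _ _ 1) => [|j _ /negbTE ne]; last first.
  by rewrite /ps_var ne mul0r; case: ifP.
rewrite /ps_var mul1n mul1r; case: n => [|n] //.
by rewrite [(N a <= 0)%N]leqNgt height_gt0.
Qed.

Definition ps_const (c : k) : R := fun n => if n == 0%N then c else 0.

Lemma ps_const_action (c : k) x :
  (strmap (ps_const c) : L) * x =
  (strmap c : ribbon Q) * x :> ribbon Q.
Proof.
apply: rcoefP => a n; rewrite [LHS]rcoef_psM rcoef_strM.
rewrite (@sum_nat_only _ _ 0) => [|j _ /negbTE ne]; last first.
  by rewrite /ps_const ne mul0r; case: ifP.
by rewrite mul0n !leq0n subn0.
Qed.

(** The coefficients of v along the arithmetic progression of the lengths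
    congruent to r modulo N_a. *)
Definition ps_part (v : ribbon Q) a (r : nat) : R := fun i => rcoef v a (i * N a + r).

(** Since z^i shifts lengths by i N_a, the paths of length 1 to N_a generate all
    elements without trivial paths over k[[t]]. *)
Lemma upath_span (v : L) : (forall a, rcoef v a 0 = 0) ->
  v = \sum_a \sum_(1 <= r < (N a).+1)
        strmap (ps_part v a r) * (upath a r : L).
Proof.
move=> v0; apply: (@rcoefP k Q) => b n; rewrite [RHS]rcoef_sum (bigD1 b) //=.
have coefE a (r : nat) : (0 < r)%N ->
    rcoef (strmap (ps_part v a r) * (upath a r : L) : L) b n =
    if b == a then \sum_(0 <= i < n.+1) (if n == (i * N b + r)%N then rcoef v b n else 0) else 0.
  move=> r0; rewrite rcoef_psM; have [<-|ne] := eqVneq b a; last first.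
    apply: big1 => i _; rewrite rcoef_upathS // (negbTE ne) andbF mulr0.
    by case: ifP.
  apply: eq_bigr => i _; rewrite rcoef_upathS // eqxx andbT.
  have -> : (n == (i * N b + r))%N = (i * N b <= n)%N && (n - i * N b == r)%N.
    case: leqP => h /=; first by rewrite -{1}(subnKC h) eqn_add2l.
    by rewrite ltn_eqF // (leq_trans h) // leq_addr.
  case: (i * N b <= n)%N (@subnKC (i * N b) n) => //= h.
  by case: eqP => [<-|_]; rewrite ?mulr0 // /ps_part h // mulr1.
rewrite [X in _ = _ + X]big1 ?addr0 => [|a ne]; last first.
  rewrite rcoef_sum big_nat big1 // => r /andP[r0 _].
  by rewrite coefE // eq_sym (negbTE ne).
rewrite rcoef_sum big_nat; under eq_bigr => r /andP[r0 _] do rewrite coefE // eqxx.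
rewrite -big_nat exchange_big /=; case: n {coefE} => [|n].
  rewrite v0 big1 // => i _; rewrite big1 // => r _; by case: ifP.
(* Lengths r run over 1, ..., N_b, so n + 1 = q N_b + r has q = n / N_b and
   r = n mod N_b + 1. *)
pose q := (n %/ N b)%N; have Nb := height_gt0 m b.
have en : n.+1 = (q * N b + (n %% N b).+1)%N by rewrite addnS -divn_eq.
rewrite (@sum_nat_only _ _ q) => [|i _ ne]; last first.
  rewrite big_nat big1 // => r /andP[r0 rN]; case: eqP => // e.
  case/eqP: ne; rewrite /q; move: e; case: r r0 rN => // r _ rN; rewrite addnS => -[->].
  by rewrite divnMDl // divn_small ?addn0.
rewrite ifT; last by rewrite ltnW // ltnS leq_div.
rewrite big_add1 /= big_mkord (bigD1 (Ordinal (ltn_pmod n Nb))) //= -en eqxx.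
rewrite big1 ?addr0 // => r ne; case: eqP => // e; case/eqP: ne; apply: val_inj => /=.
by move: e; rewrite {1}en => /eqP; rewrite eqn_add2l eqSS => /eqP.
Qed.

End PowerSeriesAction.

(** * Symmetrizing forms and constant signs *)

Section OrderToTrace.
Variables (k : fieldType) (Q : gentle_quiver k) (m : multiplicity Q).
Local Notation L := (ribbon_order m).
Local Notation R := (power_series k).
Variables (lam : L -> R) (lamP : symmetrizing_form lam).

Lemma lam_mulz (x : ribbon Q) : lam (x * ribbon_z m) = ps_var k * lam x.
Proof. by rewrite -(symZ lamP); congr lam; rewrite -ps_var_action. Qed.

Lemma lamB (x y : L) : lam (x - y) = lam x - lam y.
Proof. by apply/eqP; rewrite eq_sym subr_eq -(symD lamP) subrK. Qed.

(** The constant term of lam kills z Lambda because lam(z x) = t lam(x). If all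
    lam(u x) are divisible by t, the quotients define a form, represented by some
    y, and then x = z y. *)
Lemma order_trace_form : trace_form m (fun x => lam x 0).
Proof.
split.
- by move=> x y; rewrite (symD lamP).
- move=> c x; transitivity (lam ((strmap (ps_const c) : L) * x) 0).
    by congr (lam _ 0); rewrite ps_const_action.
  by rewrite (symZ lamP) ps_mulE big_nat1.
- by move=> x y; rewrite (symC lamP).
- by move=> x /ideal_zP[y ->]; rewrite ribbon_z_central lam_mulz ps_var_mul0.
move=> x hx; apply/ideal_zP.
pose psi (u : L) : R := fun n => lam (u * x) n.+1.
have lamE u : lam (u * x) = ps_var k * psi u.
  by apply/funext => -[|n]; rewrite ?ps_var_mul0 ?ps_var_mulS ?hx.
have t_inj (r s : R) : ps_var k * r = ps_var k * s -> r = s.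
  by move=> e; apply/funext => n; rewrite -(ps_var_mulS r) -(ps_var_mulS s) e.
have [u v||y hy] := @sym_repr _ _ _ lamP psi.
- by apply: t_inj; rewrite mulrDr -!lamE mulrDl (symD lamP).
- by move=> c u; apply: t_inj; rewrite mulrCA -!lamE -mulrA (symZ lamP).
exists y; apply/eqP; rewrite -subr_eq0; apply/eqP; apply: (sym_nondeg lamP) => u.
rewrite mulrBr lamB lamE hy ribbon_z_central.
have -> : u * (y * ribbon_z m) = (u * y) * ribbon_z m :> ribbon Q by exact: mulrA.
by rewrite lam_mulz subrr.
Qed.

End OrderToTrace.

Section TwistedToTrace.
Variables (k : fieldType) (Q : gentle_quiver k) (m : multiplicity Q).
Local Notation A := (twisted_brauer_alg m).
Local Notation pi := (qpi (ideal_central (@ribbon_z_central k Q m))).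

Lemma twisted_trace_form (lam : A -> k) :
  nondeg_trace lam -> trace_form m (fun x => lam (pi x)).
Proof.
move=> [lamD lamZ lamC lamN]; split.
- by move=> x y; rewrite qpiD lamD.
- by move=> c x; rewrite qpiM -lamZ.
- by move=> x y; rewrite !qpiM lamC.
- move=> x /ideal_zP hx; rewrite qpi0 //.
  by have := lamZ 0 0; rewrite mulr0 mul0r.
move=> x hx; apply/ideal_zP; rewrite -[x]subr0; apply/qpiP; apply/eqP.
rewrite [RHS](rmorph0 pi); apply: lamN; elim/quot_ind => u.
by rewrite -qpiM hx.
Qed.

End TwistedToTrace.

Section Approximation.
Variables (k : fieldType) (Q : gentle_quiver k) (m : multiplicity Q).
Local Notation N := (height m).
Implicit Types (a b : arrow Q) (x : ribbon Q) (e : polarization Q).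

(** The trivial path of a vertex is upath a 0 for two arrows a; it is counted at
    the one of sign minus. *)
Definition approx_coef e x a n : k :=
  if n == 0%N then if e a then rcoef x a 0 else 0 else rcoef x a n.

Lemma upath_approx e x M b n : (n < M)%N ->
  rcoef (x - \sum_a \sum_(r < M) strmap (approx_coef e x a r) * upath a r) b n = 0.
Proof.
move=> lt_nM; rewrite rcoefB rcoef_sum.
have coefE a : rcoef (\sum_(r < M) strmap (approx_coef e x a r) * upath a r) b n =
    approx_coef e x a n * (if n == 0%N then source b == source a else b == a)%:R.
  rewrite rcoef_sum (bigD1 (Ordinal lt_nM)) //= rcoef_strM rcoef_upath eqxx /=.
  rewrite big1 ?addr0 // => r ne; rewrite rcoef_strM rcoef_upath.
  rewrite (_ : (n == r) = false) ?mulr0 //; apply: contraNF ne => /eqP er.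
  exact/eqP/val_inj.
rewrite (eq_bigr _ (fun a _ => coefE a)) /approx_coef.
case: eqP => [n0|_]; last first.
  rewrite (bigD1 b) //= eqxx mulr1 big1 ?addr0 ?subrr // => a ne.
  by rewrite eq_sym (negbTE ne) mulr0.
have [a1 [a2 [ne s1 s2 h]]] := arrows_at (source b).
have [c [ec sc hc]] : exists c, [/\ e c, source c = source b &
    forall a, e a -> source a = source b -> a = c].
  have := pol_source e ne (etrans s1 (esym s2)).
  case e1: (e a1); case e2: (e a2) => // _.
    by exists a1; split=> // a ea /h /orP[]/eqP ea'; rewrite // ea' e2 in ea.
  by exists a2; split=> // a ea /h /orP[]/eqP ea'; rewrite // ea' e1 in ea.
rewrite (bigD1 c) //= ec sc eqxx mulr1 n0 (rcoef_source x sc) big1 ?addr0 ?subrr // => a ac.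
case: ifP => ea; last by rewrite mul0r.
case: eqP => [sa|]; last by rewrite mulr0.
by rewrite (hc a ea (esym sa)) eqxx in ac.
Qed.

Lemma long_upath_socle (c : k) a r : (N a < r)%N -> socle_rel m c (rcoef (upath a r)).
Proof.
move=> lt_Nr; have r0 := leq_ltn_trans (leq0n _) lt_Nr.
apply: socle_rel_low => b n le_nN; rewrite rcoef_upathS //.
have [eb|_] := eqVneq b a; last by rewrite andbF.
by rewrite ltn_eqF // (leq_ltn_trans le_nN) // eb.
Qed.

End Approximation.

Section OrbitTrace.
Variables (k : fieldType) (Q : gentle_quiver k) (m : multiplicity Q).
Local Notation N := (height m).
Variables (s : arrow Q -> k) (s_sigma : forall a, s (sigma a) = s a).
Implicit Types (a b : arrow Q) (x y u : ribbon Q).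

Definition orbit_trace q x : k := \sum_a s a * rcoef x a (q * N a).

Lemma orbit_traceD q x y : orbit_trace q (x + y) = orbit_trace q x + orbit_trace q y.
Proof.
rewrite /orbit_trace -big_split; apply: eq_bigr => a _.
by rewrite rcoefD mulrDr.
Qed.

Lemma orbit_traceZ q c x : orbit_trace q (strmap c * x) = c * orbit_trace q x.
Proof.
rewrite /orbit_trace mulr_sumr; apply: eq_bigr => a _.
by rewrite rcoef_strM mulrCA.
Qed.

Lemma orbit_traceC q x y : orbit_trace q (x * y) = orbit_trace q (y * x).
Proof.
have E u v : orbit_trace q (u * v) = \sum_a s a * conv (rcoef u) (rcoef v) a (q * N a).
  by apply: eq_bigr => a _; rewrite rcoefM.
by rewrite !E; exact: conv_trace_sym.
Qed.

(** Multiplication by a path isolates the coefficient at the complementary arc of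
    the cycle. *)
Lemma orbit_trace_upath q a r x : (0 < r <= q * N a)%N ->
  orbit_trace q (upath a r * x) =
  s (iter r sigma a) * rcoef x (iter r sigma a) (q * N a - r).
Proof.
move=> /andP[r0 rq]; rewrite /orbit_trace (bigD1 (iter r sigma a)) //= height_iter.
rewrite rcoef_upathM // rq -iterD subnK // iter_mul_height eqxx big1 ?addr0 // => b ne.
rewrite rcoef_upathM //; case: ifP => [/andP[rb /eqP eb]|]; last by rewrite mulr0.
by case/eqP: ne; rewrite -eb -iterD subnKC // iter_mul_height.
Qed.

(** The shortest path that completes the path of length n at a to a full power of
    the cycle. *)
Lemma orbit_trace_coef a n x :
  orbit_trace (n %/ N a).+1 (upath (iter n sigma a) (N a - n %% N a) * x) =
  s a * rcoef x a n.
Proof.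
have Na := height_gt0 m a; have hr := ltnW (ltn_pmod n Na).
have e1 : ((n %/ N a).+1 * N a = (N a - n %% N a) + n)%N.
  by rewrite [in RHS]addnC {2}(divn_eq n (N a)) -addnA addnC mulSn subnKC.
set r := (N a - n %% N a)%N in e1 *.
have er : iter r sigma (iter n sigma a) = a by rewrite -iterD -e1 iter_mul_height.
have [-> ->] : s a = s (iter r sigma (iter n sigma a)) /\ rcoef x a n =
    rcoef x (iter r sigma (iter n sigma a)) ((n %/ N a).+1 * N (iter n sigma a) - r).
  by rewrite height_iter e1 addKn er.
by apply: orbit_trace_upath; rewrite height_iter e1 leq_addr subn_gt0 ltn_pmod.
Qed.

Lemma orbit_trace_idem a b x : a != b -> source a = source b ->
  orbit_trace 1 (upath a 0 * x) = s a * rcoef x a (N a) + s b * rcoef x b (N b).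
Proof.
move=> ne eab; rewrite /orbit_trace (bigD1 a) //= (bigD1 b) 1?eq_sym //=.
rewrite big1 ?addr0 => [|c /andP[ca cb]]; last first.
  rewrite rcoef_upath0M mul1n iter_height; case: eqP => [sc|]; last by rewrite mulr0.
  have [x1 [x2 [_ _ _ h]]] := arrows_at (source a).
  move: (h _ sc) (h _ (esym eab)) (h _ (erefl _)) ca cb ne.
  by do 3 (move=> /orP[]/eqP->); rewrite eqxx.
by rewrite !rcoef_upath0M !mul1n !iter_height eab eqxx.
Qed.

End OrbitTrace.

Section FromSigns.
Variables (k : fieldType) (Q : gentle_quiver k) (m : multiplicity Q).
Local Notation N := (height m).
Local Notation L := (ribbon_order m).
Local Notation R := (power_series k).
Local Notation A := (twisted_brauer_alg m).
Local Notation pi := (qpi (ideal_central (@ribbon_z_central k Q m))).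
Variables (e : polarization Q) (he : orbit_signs e).
Implicit Types (a b : arrow Q) (x y u : ribbon Q).

Let s a : k := (-1) ^+ e a.
Let s_sigma a : s (sigma a) = s a. Proof. exact: he. Qed.
Let ss a : s a * s a = 1. Proof. exact: sqr_sign_eq1. Qed.
Let s_opp a b : a != b -> source a = source b -> s a = - s b.
Proof. exact: sign_opp. Qed.

Local Notation signed_trace := (orbit_trace m s).

(** This is where opposite signs at a vertex are needed: it makes the form below
    compatible with the action of t. *)
Lemma signed_trace0 x : signed_trace 0 x = 0.
Proof.
apply: sum_source_pairs => a b ne eab.
by rewrite !mul0n (rcoef_source x eab) (s_opp ne eab) mulNr addNr.
Qed.

Let lam x : R := fun j => signed_trace j.+1 x.

Lemma lamZ (r : R) x : lam ((strmap r : L) * x) = r * lam x.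
Proof.
apply/funext => j; rewrite ps_mulE /lam /orbit_trace.
transitivity (\sum_a \sum_(0 <= i < j.+2) r i * (s a * rcoef x a ((j.+1 - i) * N a))).
  apply: eq_bigr => a _; rewrite rcoef_psM mulr_sumr.
  have Na := height_gt0 m a.
  rewrite (big_cat_nat (n := j.+2)) //= ?ltnS ?leq_pmulr //.
  rewrite [X in _ + X]big_nat [X in _ + X]big1 ?addr0 => [|i /andP[hi _]]; last first.
    by rewrite leq_pmul2r // leqNgt hi mulr0.
  rewrite big_nat [RHS]big_nat; apply: eq_bigr => i /andP[_ hi].
  by rewrite leq_pmul2r // -ltnS hi -mulnBl mulrCA.
rewrite exchange_big; transitivity (\sum_(0 <= i < j.+2) r i * signed_trace (j.+1 - i) x).
  by apply: eq_bigr => i _; rewrite -mulr_sumr.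
rewrite big_nat_recr //= subnn signed_trace0 mulr0 addr0.
rewrite big_nat [RHS]big_nat; apply: eq_bigr => i /andP[_ hi].
by rewrite subSn.
Qed.

(** Nondegeneracy and the choice of the element representing a form psi both come
    from orbit_trace_coef, which forces the coefficients of the representing
    element. *)
Lemma order_symmetric : symmetric_alg L.
Proof.
have lamD x y : lam (x + y) = lam x + lam y.
  by apply/funext => j; exact: orbit_traceD.
apply/symmetric_algP; exists lam; split; first split=> //.
- exact: lamZ.
- by move=> x y; apply/funext => j; exact: orbit_traceC.
- move=> x hx; apply: (@rcoefP k Q) => a n; rewrite rcoef0.
  have := orbit_trace_coef m s a n x.
  rewrite -[LHS]/(lam (upath (iter n sigma a) (N a - n %% N a) * x) (n %/ N a)%N) hx => h.
  by rewrite -[RHS](mulr0 (s a)) -[LHS]mul1r -(ss a) -mulrA -h.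
move=> psi psiD psiZ.
have psi_z (u : L) : psi ((u : ribbon Q) * ribbon_z m) = ps_var k * psi u.
  by rewrite -psiZ; congr psi; rewrite -ps_var_action.
pose F a n := s a * psi (upath (iter n sigma a) (N a - n %% N a)) (n %/ N a)%N.
(* psi(c_a^m + c_b^m) is divisible by t. *)
have F0 a b : source a = source b -> F a 0 = F b 0.
  have [->//|ne eab] := eqVneq a b.
  rewrite /F !mod0n !div0n !subn0 /= (s_opp ne eab) mulNr -mulrN; congr (_ * _).
  have /ideal_zP[y hy] := cycle_pair_socle m ne eab.
  apply/eqP; rewrite eq_sym -addr_eq0 addrC; apply/eqP.
  transitivity (psi ((upath a (N a) + upath b (N b) : ribbon Q) : L) 0); first by rewrite psiD.
  by rewrite hy ribbon_z_central psi_z ps_var_mul0.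
pose x := rmk F; exists x.
have hpath a r : (0 < r <= N a)%N -> psi (upath a r) = lam (upath a r * x).
  move=> /andP[r0 rN]; apply/funext => j; have Na := height_gt0 m a.
  rewrite /lam orbit_trace_upath; last by rewrite r0 (leq_trans rN) // leq_pmull.
  rewrite rcoef_rmk // /F height_iter mulrA ss mul1r.
  have lt_r : (N a - r < N a)%N by rewrite ltn_subrL r0.
  have -> : (j.+1 * N a - r = j * N a + (N a - r))%N by rewrite mulSn addnC addnBA.
  rewrite modnMDl divnMDl // modn_small // divn_small // addn0 subKn //.
  by rewrite -iterD -addnA subnK // addnC -mulSn iter_mul_height.
pose D (u : L) : R := psi u - lam (u * x).
have DD (u v : L) : D (u + v) = D u + D v.
  by rewrite /D psiD mulrDl lamD opprD addrACA.
have DZ (c : R) (u : L) : D (strmap c * u) = c * D u.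
  by rewrite /D psiZ -mulrA lamZ mulrBr.
have D0 : D 0 = 0 by have := DZ 0 0; rewrite mulr0 mul0r.
have Dsum (I : Type) (t : seq I) (P : pred I) (G : I -> L) :
    (forall i, P i -> D (G i) = 0) -> D (\sum_(i <- t | P i) G i) = 0.
  move=> h; apply: (big_ind (fun u => D u = 0)); [exact: D0|move=> u v hu hv|exact: h].
  by rewrite DD hu hv addr0.
have Dlow (v : L) : (forall a, rcoef v a 0 = 0) -> D v = 0.
  move=> v0; rewrite (upath_span v0); apply: (Dsum) => a _; rewrite big_nat_cond.
  apply: Dsum => r; rewrite andbT ltnS => hr; by rewrite DZ /D hpath // subrr mulr0.
(* The paths of positive length do not generate u itself, but t u is in their
   span, and t is not a zero divisor. *)
move=> u; apply/eqP; rewrite -subr_eq0; apply/eqP; apply/funext => n.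
rewrite -/(D u) -[LHS]ps_var_mulS -DZ.
rewrite Dlow // => a; rewrite ps_var_action rcoef_mulz leqn0 gtn_eqF ?height_gt0 //.
Qed.

Lemma signed_trace_socle x : socle_rel m 1 (rcoef x) -> signed_trace 1 x = 0.
Proof.
move=> [_ x1]; apply: sum_source_pairs => a b ne eab.
by rewrite !mul1n (x1 a b ne eab) mul1r (s_opp ne eab) mulNr addNr.
Qed.

Lemma socle_mulr x y : socle_rel m 1 (rcoef x) -> socle_rel m 1 (rcoef (x * y)).
Proof. by move=> /ideal_zP hx; apply/ideal_zP; exact: Defs.idealMr. Qed.

(** As for the order, with lengths bounded by N_a. At length N_a the value of psi on
    the idempotent of a vertex has to be matched by the sum over its two arrows; it
    is put at the arrow of sign minus. *)
Lemma twisted_symmetric : symmetric_alg A.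
Proof.
have pi0 x : socle_rel m 1 (rcoef x) -> pi x = 0.
  by move=> /ideal_zP; exact: qpi0.
pose tr (v : A) : k := signed_trace 1 (generic_quotient.repr v).
have trE x : tr (pi x) = signed_trace 1 x.
  have /ideal_zP hx := qrepr (ideal_central (@ribbon_z_central k Q m)) x.
  rewrite /tr -[generic_quotient.repr _](subrK x) orbit_traceD.
  by rewrite (signed_trace_socle hx) add0r.
apply/symmetric_algP; exists tr; split; first split.
- by elim/quot_ind=> x; elim/quot_ind=> y; rewrite -qpiD !trE orbit_traceD.
- move=> c; elim/quot_ind=> x.
  by rewrite -[strmap c]/(pi (strmap c)) -qpiM !trE orbit_traceZ.
- by elim/quot_ind=> x; elim/quot_ind=> y; rewrite -!qpiM !trE (orbit_traceC m s_sigma).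
- elim/quot_ind=> x hx; apply: pi0.
  have hc u : signed_trace 1 (u * x) = 0 by rewrite -trE qpiM hx.
  split=> [a n hn|a b ne eab].
    have := orbit_trace_coef m s a n x; rewrite divn_small // hc => h.
    by rewrite -[RHS](mulr0 (s a)) -[LHS]mul1r -(ss a) -mulrA -h.
  have := hc (upath a 0); rewrite (orbit_trace_idem _ _ _ ne eab) (s_opp ne eab) mulNr.
  rewrite addrC => /eqP; rewrite subr_eq0 => /eqP h.
  by rewrite mul1r -[LHS]mul1r -(ss b) -mulrA -h mulrA ss mul1r.
move=> psi psiD psiZ.
pose F a n : k := if (n < N a)%N then s a * psi (pi (upath (iter n sigma a) (N a - n)))
  else if (n == N a) && e a then s a * psi (pi (upath a 0)) else 0.
have psi0 : psi 0 = 0 by have := psiZ 0 0; rewrite mulr0 mul0r.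
have F0 a b : source a = source b -> F a 0 = F b 0.
  have [->//|ne eab] := eqVneq a b.
  rewrite /F !height_gt0 /= !subn0 (s_opp ne eab) mulNr -mulrN; congr (_ * _).
  apply/eqP; rewrite eq_sym -addr_eq0 addrC -psiD -qpiD; apply/eqP.
  by rewrite pi0 //; exact: cycle_pair_socle.
pose x := rmk F; have xE a n : rcoef x a n = F a n by exact: rcoef_rmk.
exists (pi x).
pose D (u : ribbon Q) : k := psi (pi u) - signed_trace 1 (u * x).
suff D0 u : D u = 0.
  by elim/quot_ind=> u; rewrite -qpiM trE; apply/eqP; rewrite -subr_eq0 -/(D u) D0.
have DD v w : D (v + w) = D v + D w.
  by rewrite /D qpiD psiD mulrDl orbit_traceD opprD addrACA.
have DZ c v : D (strmap c * v) = c * D v.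
  by rewrite /D -mulrA orbit_traceZ mulrBr qpiM -psiZ.
have Dz : D 0 = 0 by have := DZ 0 0; rewrite mulr0 mul0r.
have Dsocle v : socle_rel m 1 (rcoef v) -> D v = 0.
  by move=> hv; rewrite /D (pi0 v hv) psi0 (signed_trace_socle (socle_mulr x hv)) subrr.
have Dpath a r : (0 < r <= N a)%N -> D (upath a r) = 0.
  move=> /andP[r0 rN]; rewrite /D orbit_trace_upath ?mul1n ?r0 // xE /F height_iter.
  rewrite ltn_subrL r0 height_gt0 /= mulrA ss mul1r subKn // -iterD subnK //.
  by rewrite iter_height subrr.
have Didem a : D (upath a 0) = 0.
  have [b [ne eab]] := other_arrow a.
  have up : upath b 0 = upath a 0 by apply: rcoefP => c n; rewrite !rcoef_upath0 eab.
  rewrite /D (orbit_trace_idem _ _ _ ne eab) !xE /F !ltnn !eqxx /= up.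
  have := pol_source e ne eab.
  by case: (e a) (e b) (ss a) (ss b) => [] [] // h1 h2 _;
    rewrite mulr0 ?addr0 ?add0r mulrA ?h1 ?h2 mul1r subrr.
have Dsum (I : Type) (t : seq I) (P : pred I) (G : I -> ribbon Q) :
    (forall i, P i -> D (G i) = 0) -> D (\sum_(i <- t | P i) G i) = 0.
  move=> h; apply: (big_ind (fun v => D v = 0)); [exact: Dz|move=> v w hv hw|exact: h].
  by rewrite DD hv hw addr0.
pose M := (\max_a N a).+1.
have ltNM a : (N a < M)%N by rewrite ltnS (leq_bigmax (F := N)).
pose v := \sum_a \sum_(r < M) strmap (approx_coef e u a r) * upath a r.
have Dv : D v = 0.
  apply: (Dsum) => a _; apply: (Dsum) => r _; rewrite DZ.
  case: r => -[|r] /= _; first by rewrite Didem mulr0.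
  have [le_rN|lt_Nr] := leqP r.+1 (N a); first by rewrite Dpath ?mulr0.
  by rewrite Dsocle ?mulr0 //; exact: long_upath_socle.
rewrite -[u](subrK v) DD Dv addr0; apply: Dsocle.
apply: socle_rel_low => b n hn.
by apply: upath_approx; apply: leq_ltn_trans hn (ltNM b).
Qed.

End FromSigns.

(** * Morita invariance of symmetrizing forms *)

Record submodule (A : pzRingType) (M : lmodType A) := Submodule {
  submod_pred :> zmodClosed M;
  submod_scale : forall (c : A) (x : M), x \in submod_pred -> c *: x \in submod_pred }.

Section ModuleQuotient.
Local Open Scope quotient_scope.
Variables (A : pzRingType) (M : lmodType A) (I : submodule M).

Definition mod_quot : Type := Quotient.quot I.
HB.instance Definition _ := GRing.Zmodule.on mod_quot.

Definition mod_pi (x : M) : mod_quot := \pi_(Quotient.quot I) x.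

Lemma mod_pi_eq x y : mod_pi x = mod_pi y <-> x - y \in I.
Proof. by rewrite (Quotient.idealrBE I); split=> [e|/eqP]; first exact/eqP. Qed.

Lemma mod_piD x y : mod_pi (x + y) = mod_pi x + mod_pi y.
Proof. exact: (raddfD \pi_(Quotient.quot I)). Qed.

Definition mod_scale (c : A) (u : mod_quot) : mod_quot := mod_pi (c *: repr u).

Lemma mod_piZ c x : mod_scale c (mod_pi x) = mod_pi (c *: x).
Proof.
apply/mod_pi_eq; rewrite -scalerBr; apply: submod_scale; apply/mod_pi_eq.
exact: reprK.
Qed.

Lemma mod_quot_ind (P : mod_quot -> Prop) : (forall x, P (mod_pi x)) -> forall u, P u.
Proof. by move=> h u; rewrite -[u]reprK. Qed.

Fact mod_scaleA a b u : mod_scale a (mod_scale b u) = mod_scale (a * b) u.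
Proof. by elim/mod_quot_ind: u => x; rewrite !mod_piZ scalerA. Qed.
Fact mod_scale1 : left_id 1 mod_scale.
Proof. by elim/mod_quot_ind=> x; rewrite mod_piZ scale1r. Qed.
Fact mod_scaleDr : right_distributive mod_scale +%R.
Proof.
move=> c; elim/mod_quot_ind=> x; elim/mod_quot_ind=> y.
by rewrite -mod_piD !mod_piZ -mod_piD scalerDr.
Qed.
Fact mod_scaleDl u : {morph mod_scale^~ u : a b / a + b}.
Proof. by elim/mod_quot_ind: u => x a b; rewrite !mod_piZ -mod_piD scalerDl. Qed.

HB.instance Definition _ := GRing.Zmodule_isLmodule.Build A mod_quot
  mod_scaleA mod_scale1 mod_scaleDr mod_scaleDl.

Fact mod_pi_linear : linear mod_pi.
Proof. by move=> c x y; rewrite mod_piD -mod_piZ. Qed.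
HB.instance Definition _ := GRing.isLinear.Build A M mod_quot _ mod_pi mod_pi_linear.

End ModuleQuotient.

Section LinearMaps.
Variables (A : pzRingType).
Implicit Types (U V : lmodType A).

Lemma linear_of U V (f : U -> V) : linear f -> exists g : {linear U -> V}, forall x, g x = f x.
Proof.
move=> fL; pose L := GRing.isLinear.Build A U V _ f fL.
by pose g : {linear U -> V} := HB.pack f L; exists g.
Qed.

Lemma linear_bij_inv U V (f : {linear U -> V}) : bijective f ->
  exists g : {linear V -> U}, (forall x, g (f x) = x) /\ (forall y, f (g y) = y).
Proof.
move=> [h hK Kh]; have [|g gE] := @linear_of V U h.
  by move=> c x y; apply: (can_inj hK); rewrite Kh linearP !Kh.
by exists g; split=> [x|y]; rewrite gE.
Qed.

Lemma regular_fg : exists s : seq (A^o), forall x : A^o, exists c : 'I_(size s) -> A,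
  x = \sum_(i < size s) c i *: s`_i.
Proof. by exists [:: 1] => x; exists (fun=> x); rewrite big_ord1 /= [RHS]mulr1. Qed.

Definition regular_mod : fgmod A := FGMod regular_fg.

Lemma free_fg n : exists s : seq ('rV[A]_n), forall x : 'rV[A]_n,
  exists c : 'I_(size s) -> A, x = \sum_(i < size s) c i *: s`_i.
Proof.
have e : size [seq delta_mx 0 i : 'rV[A]_n | i <- enum 'I_n] = n.
  by rewrite size_map size_enum_ord.
exists [seq delta_mx 0 i : 'rV[A]_n | i <- enum 'I_n] => x.
exists (fun i => x 0 (cast_ord e i)); rewrite {1}(row_sum_delta x).
rewrite (reindex (cast_ord e)) /=; last first.
  by exists (cast_ord (esym e)) => i _; [rewrite cast_ordK|rewrite cast_ordKV].
apply: eq_bigr => i _; congr (_ *: _).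
have hi : (i < n)%N := leq_trans (ltn_ord i) (eq_leq e).
rewrite (nth_map (cast_ord e i)) ?size_enum_ord //; congr (delta_mx _ _).
by apply: val_inj; rewrite /= nth_enum_ord.
Qed.

Definition free_mod n : fgmod A := FGMod (free_fg n).

Lemma free_mod_map (M : lmodType A) n (s : 'I_n -> M) :
  exists f : {linear free_mod n -> M}, forall x, f x = \sum_(i < n) (x : 'rV[A]_n) 0 i *: s i.
Proof.
apply: linear_of => c x y; rewrite scaler_sumr -big_split; apply: eq_bigr => i _.
by rewrite !mxE scalerDl scalerA.
Qed.

Lemma quot_fg (M : fgmod A) (I : submodule M) :
  exists s : seq (mod_quot I), forall x, exists c : 'I_(size s) -> A,
    x = \sum_(i < size s) c i *: s`_i.
Proof.
have [s hs] := fgmod_gen M; exists (map (@mod_pi A M I) s).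
elim/mod_quot_ind=> x; have [c ->] := hs x.
exists (fun i => c (cast_ord (size_map _ _) i)); rewrite (linear_sum (@mod_pi A M I)).
rewrite (reindex (cast_ord (size_map (@mod_pi A M I) s))) /=; last first.
  by exists (cast_ord (esym (size_map _ _))) => i _; [rewrite cast_ordK|rewrite cast_ordKV].
apply: eq_bigr => i _; rewrite linearZ (nth_map 0) //.
exact: leq_trans (ltn_ord i) (eq_leq (size_map _ _)).
Qed.

Definition quot_mod (M : fgmod A) (I : submodule M) : fgmod A := FGMod (quot_fg I).

(** The test map h is the projection onto the cokernel. *)
Lemma surj_of_cokernel (M N : fgmod A) (f : {linear M -> N}) :
    (forall (X : fgmod A) (h : {linear N -> X}), (forall x, h (f x) = 0) -> forall y, h y = 0) ->
  forall y, exists x, f x = y.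
Proof.
move=> h0 y; pose im : {pred N} := fun y => `[< exists x, f x = y >].
have imP : zmod_closed im.
  split=> [|u v /asboolP[x <-] /asboolP[x' <-]]; apply/asboolP.
    by exists 0; rewrite linear0.
  by exists (x - x'); rewrite linearB.
pose imZ : zmodClosed N := HB.pack im (GRing.isZmodClosed.Build N im imP).
have imS (c : A) (u : N) : u \in imZ -> c *: u \in imZ.
  by move=> /asboolP[x <-]; apply/asboolP; exists (c *: x); rewrite linearZ.
pose I := Submodule imS.
have piL : linear (@mod_pi A N I : N -> quot_mod I) by exact: mod_pi_linear.
have [p pE] := linear_of piL.
have /= := h0 (quot_mod I) p _ y; rewrite pE => h.
suff : y - 0 \in I by rewrite subr0 => /asboolP.
apply/mod_pi_eq; rewrite h => [|x]; first by rewrite (linear0 (@mod_pi A N I)).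
rewrite pE -(linear0 (@mod_pi A N I)); apply/mod_pi_eq.
by rewrite subr0; apply/asboolP; exists x.
Qed.

End LinearMaps.

Section Functor.
Variables (k : fieldType) (A B : algebraOver k) (F : mod_functor A B).

Lemma fmap_ext (M N : fgmod A) (f g : {linear M -> N}) :
  (forall x, f x = g x) -> forall x, fmap F f x = fmap F g x.
Proof. by move=> /linear_ext->. Qed.

(** The linearity of F with scalar -1, for the zero map, gives
    F(0) = - F(0) + F(0). *)
Lemma fmap0 (M N : fgmod A) (f : {linear M -> N}) :
  (forall x, f x = 0) -> forall x, fmap F f x = 0.
Proof.
move=> f0 x; have /= h := @fmap_linear _ _ _ F M N (-1) f f f.
rewrite h => [|y]; last by rewrite !f0 scaler0 addr0.
by rewrite rmorphN rmorph1 scaleN1r addNr.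
Qed.

End Functor.

Section Equivalence.
Variables (k : fieldType) (A B : algebraOver k).
Variables (F : mod_functor A B) (G : mod_functor B A).
Variable eta : forall M : fgmod A, {linear M -> G (F M)}.
Hypothesis eta_bij : forall M, bijective (eta M).
Hypothesis eta_nat : forall (M N : fgmod A) (f : {linear M -> N}) x,
  eta N (f x) = fmap G (fmap F f) (eta M x).
Variable theta : forall M : fgmod B, {linear M -> F (G M)}.
Hypothesis theta_bij : forall M, bijective (theta M).
Hypothesis theta_nat : forall (M N : fgmod B) (f : {linear M -> N}) x,
  theta N (f x) = fmap F (fmap G f) (theta M x).

Lemma equiv_faithful (M N : fgmod A) (f : {linear M -> N}) :
  (forall x, fmap F f x = 0) -> forall x, f x = 0.
Proof.
move=> f0 x; apply: (bij_inj (eta_bij N)).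
by rewrite eta_nat (fmap0 f0) linear0.
Qed.

Lemma equiv_faithful_eq (M N : fgmod B) (f g : {linear M -> N}) :
  (forall x, fmap G f x = fmap G g x) -> forall x, f x = g x.
Proof.
move=> e x; apply: (bij_inj (theta_bij N)).
by rewrite !theta_nat; apply: fmap_ext.
Qed.

(** G f, transported along eta, has the right image under G F, and G is
    faithful. *)
Lemma equiv_full (M N : fgmod A) (f : {linear F M -> F N}) :
  exists g : {linear M -> N}, forall x, fmap F g x = f x.
Proof.
have [etai [etaiK Ketai]] := linear_bij_inv (eta_bij N).
exists (etai \o fmap G f \o eta M); apply: equiv_faithful_eq => y.
have [etaM [_ KetaM]] := linear_bij_inv (eta_bij M).
by rewrite -(KetaM y) -eta_nat /= Ketai.
Qed.

(** Surjections are the epimorphisms, and an equivalence preserves these. *)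
Lemma equiv_surj (M N : fgmod B) (f : {linear M -> N}) :
  (forall y, exists x, f x = y) -> forall y, exists x, fmap G f x = y.
Proof.
move=> f_surj; apply: surj_of_cokernel => X h hf; apply: equiv_faithful => w.
have [thetai [_ Kthetai]] := linear_bij_inv (theta_bij N).
have [x fx] := f_surj (thetai w).
rewrite -(Kthetai w) -fx theta_nat -fmap_comp; apply: fmap0 => v.
exact: hf.
Qed.

Let P := F (regular_mod A).

(** F(A) is generated by finitely many elements, that is, by a surjection g from a
    free module. By equiv_surj, G g hits eta(1), so the map eta from A to G F A
    lifts along G g, because A is free. Applying F splits g up to isomorphism. *)
Lemma regular_image_retract : exists n (g : {linear free_mod B n -> P})
  (s : {linear P -> free_mod B n}), forall p, g (s p) = p.
Proof.
have [t ht] := fgmod_gen P; pose n := size t; exists n.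
have [g gE] := free_mod_map (fun i : 'I_n => t`_i).
have g_surj p : exists v, g v = p.
  have [c ->] := ht p; exists (\row_i c i); rewrite gE.
  by apply: eq_bigr => i _; rewrite mxE.
have [y hy] := @equiv_surj (free_mod B n) P g g_surj (eta (regular_mod A) (1 : A^o)).
have [sig sigE] : exists sig : {linear regular_mod A -> G (free_mod B n)},
    forall b, sig b = (b : A) *: y.
  by apply: linear_of => c u v; rewrite scalerDl scalerA.
have [thetai [thetaiK Kthetai]] := linear_bij_inv (theta_bij (free_mod B n)).
have [etai [etaiK Ketai]] := linear_bij_inv (eta_bij (regular_mod A)).
exists (fmap F etai \o theta P \o g), (thetai \o fmap F sig) => p.
rewrite -[LHS]/(fmap F etai (theta P (g (thetai (fmap F sig p))))).
rewrite (@theta_nat (free_mod B n) P g) Kthetai -fmap_comp -fmap_comp.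
rewrite -[RHS]fmap_id; apply: fmap_ext => b.
rewrite /= sigE linearZ hy -linearZ /= etaiK.
exact: mulr1.
Qed.

Section TransferForm.
Variables (lam : B -> k) (lamP : nondeg_trace lam).
Variables (n : nat) (g : {linear free_mod B n -> P}) (s : {linear P -> free_mod B n}).
Hypothesis gs : forall p, g (s p) = p.

Let sumlam (I : Type) (t : seq I) (Pr : pred I) (H : I -> B) :
  lam (\sum_(i <- t | Pr i) H i) = \sum_(i <- t | Pr i) lam (H i).
Proof.
apply: (big_morph lam (symD lamP)).
by have := symZ lamP 0 0; rewrite mulr0 mul0r.
Qed.

(* The matrix of h acts on row vectors, and lam is applied to its trace. *)
Local Notation End_free := {linear free_mod B n -> free_mod B n}.

Let tr (h : End_free) : k :=
  \sum_(i < n) lam ((h (delta_mx 0 i : 'rV[B]_n) : 'rV[B]_n) 0 i).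

Let entry (h : End_free) (v : 'rV[B]_n) i :
  (h v : 'rV[B]_n) 0 i = \sum_j v 0 j * (h (delta_mx 0 j : 'rV[B]_n) : 'rV[B]_n) 0 i.
Proof.
rewrite {1}(row_sum_delta v) linear_sum summxE; apply: eq_bigr => j _.
by rewrite linearZ mxE.
Qed.

Let trC (h h' : End_free) : tr (h \o h') = tr (h' \o h).
Proof.
have E (u v : End_free) : tr (u \o v) = \sum_(i < n) \sum_(j < n)
    lam ((v (delta_mx 0 i : 'rV[B]_n) : 'rV[B]_n) 0 j *
         (u (delta_mx 0 j : 'rV[B]_n) : 'rV[B]_n) 0 i).
  by apply: eq_bigr => i _; rewrite /= entry sumlam.
rewrite !E exchange_big; apply: eq_bigr => i _; apply: eq_bigr => j _.
exact: symC.
Qed.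

Let tr_ext (h h' : End_free) : (forall v, h v = h' v) -> tr h = tr h'.
Proof. by move=> e; apply: eq_bigr => i _; rewrite e. Qed.

(* The endomorphisms of A as a left module are the right multiplications. *)
Let rho_linear (b : A) : linear (fun x : regular_mod A => (x : A) * b : regular_mod A).
Proof. by move=> c x y; rewrite mulrDl -[in LHS]mulrA. Qed.

Let rho (b : A) : {linear regular_mod A -> regular_mod A} :=
  sval (cid (linear_of (rho_linear b))).

Let rhoE b x : rho b x = (x : A) * b.
Proof. by rewrite /rho; case: cid => f /= ->. Qed.

Let E (b : A) : End_free := s \o fmap F (rho b) \o g.

Definition transfer_form (b : A) : k := tr (E b).

(** The form is symmetric like the trace of matrices. If it vanishes on all u b,
    then fullness of F makes the trace of E b h vanish for every endomorphism h of the
    free module; taking matrix units for h gives E b = 0, hence b = 0. *)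
Lemma transfer_form_trace : nondeg_trace transfer_form.
Proof.
have lin (c : k) (x y z : A) : z = strmap c * x + y ->
    transfer_form z = c * transfer_form x + transfer_form y.
  move=> ez; rewrite /transfer_form /tr mulr_sumr -big_split; apply: eq_bigr => i _ /=.
  rewrite (@fmap_linear _ _ _ F _ _ c (rho x) (rho y) (rho z)); last first.
    move=> u; rewrite !rhoE ez.
    rewrite -[RHS]/(strmap c * ((u : A) * x) + (u : A) * y) mulrDr !mulrA.
    by congr (_ * _ + _); exact: esym (strmap_central c (u : A)).
  have sP (p q : P) : s (strmap c *: p + q) = strmap c *: s p + s q by exact: linearP.
  by rewrite sP !mxE (symD lamP) (symZ lamP).
split.
- by move=> x y; rewrite (lin 1 x y) ?mul1r // rmorph1 mul1r.
- move=> c x; rewrite (lin c x 0) ?addr0 // [X in _ + X](_ : _ = 0) ?addr0 //.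
  by have := lin (-1) 0 0 0; rewrite mulr0 addr0 => /(_ erefl) ->; rewrite mulN1r addNr.
- move=> x y; transitivity (tr (E y \o E x)); last first.
    transitivity (tr (E x \o E y)); first exact: trC.
    apply: tr_ext => v; rewrite /= gs; congr (s _); rewrite -fmap_comp.
    by apply: fmap_ext => u; rewrite /= !rhoE mulrA.
  apply: tr_ext => v; rewrite /= gs; congr (s _); rewrite -fmap_comp.
  by apply: fmap_ext => u; rewrite /= !rhoE mulrA.
move=> b hb.
have trE0 (h : End_free) : tr (E b \o h) = 0.
  have [q qE] := @equiv_full (regular_mod A) (regular_mod A) (g \o h \o s).
  have hu := hb (q (1 : A)); rewrite -{}hu.
  have qrho x : q x = rho (q (1 : A)) x.
    by rewrite rhoE -[in LHS](mulr1 (x : A)) -[_ * _]/((x : A) *: (1 : A^o)) linearZ.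
  transitivity (tr ((s \o g) \o (E b \o h))).
    by apply: tr_ext => v; rewrite /= gs.
  rewrite trC; apply: tr_ext => v /=.
  have := qE (g v); rewrite (fmap_ext qrho) /= => e.
  rewrite -e; congr (s _); rewrite -fmap_comp; apply: fmap_ext => u.
  by rewrite /= !rhoE mulrA.
have Eb0 v : E b v = 0.
  have ebij i j : ((E b (delta_mx 0 j : 'rV[B]_n)) : 'rV[B]_n) 0 i = 0.
    apply: (sym_nondeg lamP) => c.
    have [h hE] := free_mod_map (fun l : 'I_n =>
      (if l == i then c *: (delta_mx 0 j : 'rV[B]_n) else 0) : free_mod B n).
    have hd l : h (delta_mx 0 l : 'rV[B]_n) =
        if l == i then c *: (delta_mx 0 j : 'rV[B]_n) else 0.
      rewrite hE (bigD1 l) //= mxE !eqxx scale1r big1 ?addr0 // => l' ne.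
      by rewrite mxE eqxx (negbTE ne) scale0r.
    rewrite -(trE0 h) /tr (bigD1 i) //= hd eqxx big1 ?addr0 => [|l ne].
      have EZ : E b (c *: (delta_mx 0 j : 'rV[B]_n) : 'rV[B]_n) =
          c *: (E b (delta_mx 0 j : 'rV[B]_n) : 'rV[B]_n) by exact: linearZ.
      by rewrite -[RHS]/(lam ((E b (c *: (delta_mx 0 j : 'rV[B]_n) : 'rV[B]_n) : 'rV[B]_n) 0 i)) EZ mxE.
    rewrite hd (negbTE ne) !linear0 mxE.
    by have := symZ lamP 0 0; rewrite mulr0 mul0r.
  apply/rowP => i; rewrite entry mxE big1 // => j _.
  by rewrite ebij mulr0.
have Frho0 p : fmap F (rho b) p = 0.
  by have := Eb0 (s p); rewrite /E /= gs => e; rewrite -[LHS]gs e linear0.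
by have := equiv_faithful Frho0 (1 : A); rewrite rhoE mul1r.
Qed.

End TransferForm.
End Equivalence.

Lemma morita_nondeg_trace (k : fieldType) (A B : algebraOver k) (lam : B -> k) :
  morita_equivalent A B -> nondeg_trace lam -> exists lam' : A -> k, nondeg_trace lam'.
Proof.
move=> [F [G [[eta [eta_bij eta_nat]] [theta [theta_bij theta_nat]]]]] lamP.
have [n [g [s gs]]] := regular_image_retract eta_bij eta_nat theta_bij theta_nat.
exists (transfer_form lam g s).
have h := transfer_form_trace eta_bij eta_nat theta_bij theta_nat lamP gs.
exact h.
Qed.

(** * Isomorphic algebras *)

Lemma inj_surj_bij (T U : Type) (f : T -> U) :
  injective f -> (forall y, exists x, f x = y) -> bijective f.
Proof.
move=> inj sur; exists (fun y => sval (cid (sur y))) => [x|y]; last by case: cid.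
by apply: inj; case: cid.
Qed.

Lemma alg_morphismD (S : comPzRingType) (A B : algebraOver S) (f : A -> B) :
  alg_morphism f -> forall x y, f (x + y) = f x + f y.
Proof.
move=> [fB _ _] x y; have f0 : f 0 = 0 by rewrite -[X in f X](subrr 0) fB subrr.
have fN : f (- y) = - f y by rewrite -sub0r fB f0 sub0r.
by rewrite -{1}(opprK y) fB fN opprK.
Qed.

Lemma quot_alg_iso (S : comPzRingType) (A B : algebraOver S) (I : ideal A) (J : ideal B)
    (f : A -> B) :
    alg_morphism f -> (forall x, I x <-> J (f x)) -> (forall y, exists x, J (y - f x)) ->
  alg_iso (quot I) (quot J).
Proof.
move=> [fB [f1 fM] fstr] fIJ fsur.
pose g (u : quot I) : quot J := qpi J (f (generic_quotient.repr u)).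
have gE x : g (qpi I x) = qpi J (f x).
  by apply: qpi_eq; rewrite -fB; apply/fIJ; exact: qrepr.
exists g; split; [split|].
- by elim/quot_ind=> x; elim/quot_ind=> y; rewrite -qpi_zmod !gE fB qpi_zmod.
- split; first by rewrite -[1]/(qpi I 1) gE f1.
  by elim/quot_ind=> x; elim/quot_ind=> y; rewrite -qpiM !gE fM qpiM.
- by move=> c; rewrite -[strmap c]/(qpi I (strmap c)) gE fstr.
apply: inj_surj_bij.
  elim/quot_ind=> x; elim/quot_ind=> y; rewrite !gE => /eqP/qpiP.
  by rewrite -fB => /fIJ; exact: qpi_eq.
elim/quot_ind=> y; have [x hx] := fsur y; exists (qpi I x).
by rewrite gE; apply/esym/qpi_eq.
Qed.

Section Restriction.
Variables (k : fieldType) (A B : algebraOver k) (f : A -> B).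
Variables (fP : alg_morphism f) (fsur : forall y, exists x, f x = y).

Section Object.
Variable M : fgmod B.

(** The module M with A acting through f; the argument makes the action part of
    the type. *)
Definition restr of (alg_morphism f) : Type := M.
HB.instance Definition _ := GRing.Zmodule.on (restr fP).

Definition restr_scale (c : A) (x : restr fP) : restr fP := f c *: (x : M).

Fact restr_scaleA a b x : restr_scale a (restr_scale b x) = restr_scale (a * b) x.
Proof. have [_ [_ fM] _] := fP; by rewrite /restr_scale fM scalerA. Qed.
Fact restr_scale1 : left_id 1 restr_scale.
Proof. have [_ [f1 _] _] := fP; by move=> x; rewrite /restr_scale f1 scale1r. Qed.
Fact restr_scaleDr : right_distributive restr_scale +%R.
Proof. by move=> c x y; exact: (@scalerDr _ M). Qed.
Fact restr_scaleDl x : {morph restr_scale^~ x : a b / a + b}.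
Proof.
move=> a b; have fD := alg_morphismD fP a b.
by rewrite /restr_scale fD; exact: (@scalerDl _ M).
Qed.

HB.instance Definition _ := GRing.Zmodule_isLmodule.Build A (restr fP)
  restr_scaleA restr_scale1 restr_scaleDr restr_scaleDl.

Fact restr_fg : exists s : seq (restr fP), forall x, exists c : 'I_(size s) -> A,
  x = \sum_(i < size s) c i *: s`_i.
Proof.
have [s hs] := fgmod_gen M; exists s => x; have [c ex] := hs x.
exists (fun i => sval (cid (fsur (c i)))); rewrite {1}ex; apply: eq_bigr => i _.
by case: (cid (fsur (c i))) => d /= <-.
Qed.

Definition restr_mod : fgmod A := FGMod restr_fg.

End Object.

Lemma restr_map (M N : fgmod B) (h : {linear M -> N}) :
  exists h' : {linear restr_mod M -> restr_mod N}, forall x : M, h' x = h x.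
Proof. by apply: linear_of => c x y; exact: (linearP h (f c) x y). Qed.

Definition restr_fmap (M N : fgmod B) (h : {linear M -> N}) :
    {linear restr_mod M -> restr_mod N} := sval (cid (restr_map h)).

Lemma restr_fmapE (M N : fgmod B) (h : {linear M -> N}) (x : M) : restr_fmap h x = h x.
Proof. by rewrite /restr_fmap; case: cid => h' /= ->. Qed.

Fact restr_fmap_linear (M N : fgmod B) (c : k) (h1 h2 h : {linear M -> N}) :
    (forall x, h x = strmap c *: h1 x + h2 x) ->
  forall x : restr_mod M, restr_fmap h x = strmap c *: restr_fmap h1 x + restr_fmap h2 x.
Proof.
move=> hE x; rewrite !restr_fmapE hE.
rewrite -[RHS]/(f (strmap c) *: (h1 x : N) + h2 x).
by have [_ _ ->] := fP.
Qed.

Fact restr_fmap_id (M : fgmod B) (x : restr_mod M) : restr_fmap idfun x = x.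
Proof. exact: restr_fmapE. Qed.

Fact restr_fmap_comp (M N P : fgmod B) (h : {linear N -> P}) (h' : {linear M -> N})
    (x : restr_mod M) : restr_fmap (h \o h') x = restr_fmap h (restr_fmap h' x).
Proof. by rewrite !restr_fmapE. Qed.

Definition restriction : mod_functor B A :=
  ModFunctor restr_fmap_id restr_fmap_comp restr_fmap_linear.

End Restriction.

(** Restriction along f and along its inverse are mutually inverse, with identity
    maps as natural isomorphisms. *)
Lemma morita_of_iso (k : fieldType) (A B : algebraOver k) :
  alg_iso A B -> morita_equivalent A B.
Proof.
move=> [f [fP [g fK gK]]].
have fsur y : exists x, f x = y by exists (g y).
have gsur x : exists y, g y = x by exists (f x).
have gP : alg_morphism g.
  have [fB [f1 fM] fstr] := fP; split; [|split|].
  - by move=> x y; rewrite -[x in LHS]gK -[y in LHS]gK -fB fK.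
  - by rewrite -f1 fK.
  - by move=> x y; rewrite -[x in LHS]gK -[y in LHS]gK -fM fK.
  - by move=> c; rewrite -fstr fK.
exists (restriction gP gsur), (restriction fP fsur); split.
  have h (M : fgmod A) : exists eta : {linear M -> restriction fP fsur (restriction gP gsur M)},
      forall x : M, eta x = x.
    apply: linear_of => c x y.
    by rewrite -[RHS]/(g (f c) *: x + y) fK.
  exists (fun M => sval (cid (h M))); split=> [M|M N t x].
    by case: cid => eta /= etaE; exists id => x; rewrite ?etaE.
  by case: cid => u uE; case: cid => v vE; rewrite /= vE uE !restr_fmapE.
have h (M : fgmod B) : exists eta : {linear M -> restriction gP gsur (restriction fP fsur M)},
    forall x : M, eta x = x.
  apply: linear_of => c x y.
  by rewrite -[RHS]/(f (g c) *: x + y) gK.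
exists (fun M => sval (cid (h M))); split=> [M|M N t x].
  by case: cid => eta /= etaE; exists id => x; rewrite ?etaE.
by case: cid => u uE; case: cid => v vE; rewrite /= vE uE !restr_fmapE.
Qed.

(** * Brauer graph algebras *)

Lemma polarization_exists (k : fieldType) (Q : gentle_quiver k) : inhabited (polarization Q).
Proof.
pose c (i : vertex Q) := sval (cid (arrow_at i)).
have pol (a b : arrow Q) : a != b -> source a = source b ->
    (a == c (source a)) != (b == c (source b)).
  move=> ne eab; have sc : source (c (source b)) = source b by rewrite /c; case: cid => d /= /eqP.
  have [x [y [_ _ _ h]]] := arrows_at (source b); rewrite eab.
  move: (h _ sc) (h _ eab) (h _ (erefl _)) ne.
  by move=> /orP[]/eqP-> /orP[]/eqP-> /orP[]/eqP->; rewrite ?eqxx //= eq_sym => /negbTE->.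
by exists; exact: Polarization pol.
Qed.

Section BrauerIdeal.
Variables (k : fieldType) (Q : gentle_quiver k) (m : multiplicity Q).
Local Notation I := (gq_ideal Q).
Local Notation J := (arrow_ideal Q).
Local Notation N := (height m).
Implicit Types (a b : arrow Q) (f g : path_alg k Q).

Definition to_ribbon f : ribbon Q := to_completion J (qpi I f).

Lemma rcoef_to_ribbon f a n : rcoef (to_ribbon f) a n = pcoef f a n.
Proof. by rewrite rcoef_to_completion gcoef_qpi. Qed.

Lemma to_ribbonM f g : to_ribbon (f * g) = to_ribbon f * to_ribbon g.
Proof. by rewrite /to_ribbon !rmorphM. Qed.

Lemma to_ribbon_morphism : alg_morphism to_ribbon.
Proof.
split; last by [].
- by move=> f g; rewrite /to_ribbon !rmorphB.
- by split=> [|f g]; rewrite /to_ribbon ?rmorph1 // !rmorphM.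
Qed.

(** Modulo J_- the cycles of the two arrows at a vertex coincide and their signs
    cancel. *)
Lemma brauer_ideal_sum (eps : polarization Q) :
  brauer_ideal m (\sum_a (-1) ^+ eps a * cyc_pow m arrow_elt a).
Proof.
set w := \sum_a _; rewrite -[w]subr0; apply/qpiP; apply/eqP.
rewrite rmorph_sum rmorph0; apply: sum_source_pairs => a b ne eab.
have Iab : brauer_ideal m (cyc_pow m arrow_elt a - cyc_pow m arrow_elt b).
  exists 0; first exact: Defs.ideal0.
  exists (cyc_pow m arrow_elt a - cyc_pow m arrow_elt b); last by rewrite add0r.
  by apply: mem_ideal_gen; exists a, b.
rewrite -rmorphD -(rmorph0 (qpi (brauer_ideal m))); apply: qpi_eq; rewrite subr0.
have := pol_source eps ne eab; case: (eps a); case: (eps b) => // _.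
  by rewrite mulN1r mul1r addrC -opprB; exact: idealN.
by rewrite mulN1r mul1r.
Qed.

Lemma path_bound f : exists M, forall a n, (M <= n)%N -> pcoef f a n = 0.
Proof.
have /fin_suppP[s hs] := path_fin f; exists (\max_(p <- s) qlen p).+1 => a n h.
apply: hs; apply/negP => hin; move: h; rewrite ltnNge => /negP; apply.
by rewrite -{1}(qlen_spath a n) leq_bigmax_seq.
Qed.

(** As for the ideal of w in Lambda: shifting back the coefficients of f gives an
    element of the path algebra whose product with the analogue of w differs
    from f by an element of I. *)
Lemma brauer_idealP f : brauer_ideal m f <-> socle_rel m (-1) (pcoef f).
Proof.
split=> [[y Iy [z Jz ->]]|[f0 f1]].
  have /ideal_pcoefP y0 := Iy.
  have [K KE] := @socle_ideal _ _ m _ (@pcoef k Q) (-1) (@pcoef_zero k Q) (@pcoefD k Q)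
    (@pcoefM k Q) (@pcoef_source k Q).
  apply/KE; apply: Defs.idealD; first by apply/KE/socle_rel_low => a n _.
  apply: (Jz K) => _ [a [b [eab ->]]]; apply/KE; split=> [c n h|c d ncd ecd].
    by rewrite pcoefB !pcoef_cyc_pow !(ltn_eqF h) !andbF subrr.
  rewrite !pcoefB !pcoef_cyc_pow !eqxx !andbT.
  have [sc|nsc] := eqVneq (source c) (source a); last first.
    have nd x : source x = source a -> (c == x = false) /\ (d == x = false).
      move=> ex; split; apply/eqP => ec; case/eqP: nsc; first by rewrite ec ex.
      by rewrite ecd ec ex.
    by have [-> ->] := nd a erefl; have [-> ->] := nd b (esym eab); rewrite subrr mulr0.
  have [x [y' [nxy _ _ h]]] := arrows_at (source a).
  move: (h _ sc) (h _ (etrans (esym ecd) sc)) (h _ (erefl _)) (h _ (esym eab)) ncd nxy.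
  by move=> /orP[]/eqP-> /orP[]/eqP-> /orP[]/eqP-> /orP[]/eqP->; rewrite ?eqxx //= => _ /negbTE ne;
    rewrite ?ne ?[y' == x]eq_sym ?ne ?subrr ?mulr0 // ?mulN1r ?opprB ?subr0 ?sub0r ?opprK ?subrr ?mulr0.
have [eps] := polarization_exists Q.
have [M hM] := path_bound f.
pose F a n := (-1) ^+ eps a * pcoef f a (n + N a).
have F0 a b : source a = source b -> F a 0 = F b 0.
  have [->//|ne e] := eqVneq a b.
  by rewrite /F !add0n (f1 a b ne e) mulN1r (sign_opp eps ne e) mulrNN.
pose w := \sum_a (-1) ^+ eps a * cyc_pow m arrow_elt a : path_alg k Q.
have -> : f = (f - ptrunc F M * w) + ptrunc F M * w by rewrite subrK.
apply: Defs.idealD; last by apply: Defs.idealMl; exact: brauer_ideal_sum.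
exists (f - ptrunc F M * w); last by exists 0; [exact: Defs.ideal0|rewrite addr0].
apply/ideal_pcoefP => a n; rewrite pcoefB -!rcoef_to_ribbon to_ribbonM.
have -> : to_ribbon w = ribbon_w m eps.
  apply: rcoefP => b j; rewrite rcoef_to_ribbon rcoef_w.
  have pcoef_sum (G : arrow Q -> path_alg k Q) :
      pcoef (\sum_c G c) b j = \sum_c pcoef (G c) b j.
    by apply: (big_morph (fun x => pcoef x b j)) => [x y|]; rewrite ?pcoefD ?pcoef_zero.
  have pcoef_sign (e : bool) g : pcoef ((-1) ^+ e * g) b j = (-1) ^+ e * pcoef g b j.
    by case: e; rewrite ?mul1r // !mulN1r -sub0r pcoefB pcoef_zero sub0r.
  rewrite pcoef_sum (bigD1 b) //= pcoef_sign pcoef_cyc_pow eqxx big1 ?addr0 // => c ne.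
  by rewrite pcoef_sign pcoef_cyc_pow eq_sym (negbTE ne) mulr0.
rewrite (rcoef_mul_cycles _ _ _ (rcoef_w m eps)) !rcoef_to_ribbon.
case: leqP => h; last by rewrite f0 // subrr.
rewrite pcoef_ptrunc //; case: ltnP => hMn.
  by rewrite /F subnK // mulrAC sqr_sign_eq1 mul1r subrr.
by rewrite mul0r hM ?subrr // (leq_trans hMn) // leq_subr.
Qed.

(** The relation x(a, N_a) = - x(b, N_b) is what the form without signs
    kills. *)
Lemma brauer_nondeg_trace : exists lam : brauer_quiver_alg m -> k, nondeg_trace lam.
Proof.
pose one_ (a : arrow Q) : k := 1.
have one_sigma a : one_ (sigma a) = one_ a by [].
pose tr f := orbit_trace m one_ 1 (to_ribbon f).
have tr0 f : brauer_ideal m f -> tr f = 0.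
  move=> /brauer_idealP[_ f1]; apply: sum_source_pairs => a b ne eab.
  by rewrite /one_ !mul1r !mul1n !rcoef_to_ribbon (f1 a b ne eab) mulN1r addNr.
have trD f g : tr (f + g) = tr f + tr g.
  by rewrite /tr -orbit_traceD; congr orbit_trace; rewrite /to_ribbon !rmorphD.
pose lam (v : brauer_quiver_alg m) : k := tr (generic_quotient.repr v).
have lamE f : lam (qpi (brauer_ideal m) f) = tr f.
  rewrite /lam -[generic_quotient.repr _](subrK f) trD tr0 ?add0r //.
  exact: (qrepr (brauer_ideal m)).
exists lam; split.
- by elim/quot_ind=> f; elim/quot_ind=> g; rewrite -qpiD !lamE.
- move=> c; elim/quot_ind=> f.
  by rewrite -[strmap c]/(qpi (brauer_ideal m) (strmap c)) -qpiM !lamE /tr -orbit_traceZ to_ribbonM.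
- elim/quot_ind=> f; elim/quot_ind=> g; rewrite -!qpiM !lamE /tr !to_ribbonM.
  exact: orbit_traceC.
elim/quot_ind=> f hf; rewrite -(rmorph0 (qpi (brauer_ideal m))); apply: qpi_eq.
rewrite subr0; apply/brauer_idealP.
have hc a r : orbit_trace m one_ 1 (upath a r * to_ribbon f) = 0.
  by rewrite -[upath a r]/(to_ribbon (path_elt (spath a r))) -to_ribbonM -/(tr _) -lamE qpiM hf.
split=> [a n hn|a b ne eab]; rewrite -!rcoef_to_ribbon.
  have := orbit_trace_coef m one_ a n (to_ribbon f); rewrite divn_small // hc mul1r.
  by move=> ->.
have := hc a 0; rewrite (orbit_trace_idem _ _ _ ne eab) !mul1r => /eqP.
by rewrite addr_eq0 => /eqP->; rewrite mulN1r.
Qed.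

(** The ideals of kQ and Lambda are given by the same condition on coefficients,
    and modulo it an element of Lambda may be truncated beyond the longest N_a. *)
Lemma brauer_quiver_iso (eps : polarization Q) :
  alg_iso (brauer_quiver_alg m) (ribbon_mod_w m eps).
Proof.
apply: (quot_alg_iso to_ribbon_morphism) => [f|y].
  rewrite brauer_idealP ideal_wP (_ : rcoef (to_ribbon f) = pcoef f) //.
  by apply/funext => a; apply/funext => n; rewrite rcoef_to_ribbon.
pose M := (\max_a N a).+1; exists (ptrunc (rcoef y) M); apply/ideal_wP.
apply: socle_rel_low => a n h.
rewrite rcoefB rcoef_to_ribbon pcoef_ptrunc; last by move=> b c; exact: rcoef_source.
by rewrite ltnS (leq_trans h) ?subrr // (leq_bigmax (F := N)).
Qed.

Lemma ribbon_mod_w_findim (eps : polarization Q) : findim (ribbon_mod_w m eps).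
Proof.
pose M := (\max_a N a).+1.
pose T := (arrow Q * 'I_M)%type; pose w := ribbon_w m eps.
pose pi := qpi (ideal_gen (fun y : ribbon Q => y = w)).
pose G (p : T) : ribbon_mod_w m eps := pi (upath p.1 p.2).
exists [seq G p | p <- enum {: T}]; elim/quot_ind=> x.
have sz : size [seq G p | p <- enum {: T}] = #|{: T}| by rewrite size_map -cardE.
exists (fun i => approx_coef eps x (enum_val (cast_ord sz i)).1 (enum_val (cast_ord sz i)).2).
transitivity (\sum_(p : T) strmap (approx_coef eps x p.1 p.2) * G p).
  rewrite -(pair_bigA _ (fun a (r : 'I_M) => strmap (approx_coef eps x a r) * G (a, r))) /=.
  transitivity (pi (\sum_a \sum_(r < M) strmap (approx_coef eps x a r) * upath a r)).
    apply: qpi_eq; apply/ideal_wP/socle_rel_low => a n h.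
    by apply: upath_approx; rewrite ltnS (leq_trans h) // (leq_bigmax (F := N)).
  rewrite /pi rmorph_sum; apply: eq_bigr => a _; rewrite rmorph_sum; apply: eq_bigr => r _.
  exact: qpiM.
rewrite (reindex (fun i => enum_val (cast_ord sz i))) /=; last first.
  exists (fun p => cast_ord (esym sz) (enum_rank p)) => [i _|p _].
    by rewrite enum_valK cast_ordK.
  by rewrite cast_ordKV enum_rankK.
apply: eq_bigr => i _; congr (_ * _).
have hi : (i < size (enum {: T}))%N := leq_trans (ltn_ord i) (eq_leq (size_map _ _)).
rewrite (nth_map (enum_val (cast_ord sz i))) //; congr G.
exact: (enum_val_nth (enum_val (cast_ord sz i))).
Qed.

Lemma ribbon_mod_w_brauer (eps : polarization Q) :
  is_brauer_graph_algebra (ribbon_mod_w m eps).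
Proof.
split; first exact: ribbon_mod_w_findim.
exists Q, m; have [F [G [h1 h2]]] := morita_of_iso (brauer_quiver_iso eps).
by exists G, F.
Qed.

End BrauerIdeal.

(** * Rescaling arrows *)

Section Rescaling.
Variables (k : fieldType) (Q : gentle_quiver k) (m : multiplicity Q).
Local Notation N := (height m).
Implicit Types (a b : arrow Q) (x y : ribbon Q).

Section Automorphism.
Variables (h : arrow Q -> k) (h_neq0 : forall a, h a != 0).

Definition path_weight a n : k := \prod_(b <- traject sigma a n) h b.

Lemma path_weight_neq0 a n : path_weight a n != 0.
Proof.
apply: (big_ind (fun c => c != 0)) => [|c d|b _]; last exact: h_neq0.
  exact: oner_neq0.
exact: mulf_neq0.
Qed.

Lemma path_weightD a i j :
  path_weight a (i + j) = path_weight a i * path_weight (iter i sigma a) j.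
Proof. by rewrite /path_weight trajectD big_cat. Qed.

Lemma path_weight0 a : path_weight a 0 = 1.
Proof. by rewrite /path_weight big_nil. Qed.

(** The algebra endomorphism that multiplies each arrow a by h a. *)
Definition rescale x : ribbon Q := rmk (fun a n => path_weight a n * rcoef x a n).

Lemma rcoef_rescale x a n : rcoef (rescale x) a n = path_weight a n * rcoef x a n.
Proof.
apply: rcoef_rmk => {a}a b e.
by rewrite !path_weight0 (rcoef_source x e).
Qed.

Lemma rcoef_str (c : k) a n : rcoef (strmap c : ribbon Q) a n = if n == 0%N then c else 0.
Proof. by rewrite -(gcoef_str c a n) -rcoef_to_completion. Qed.

Lemma rescale_morphism : alg_morphism rescale.
Proof.
have str c : rescale (strmap c) = strmap c.
  apply: rcoefP => a n; rewrite rcoef_rescale rcoef_str.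
  by case: eqP => [->|_]; rewrite ?path_weight0 ?mul1r // mulr0.
split=> //.
  by move=> x y; apply: rcoefP => a n; rewrite rcoefB !rcoef_rescale rcoefB mulrBr.
split=> [|x y]; first by rewrite -(rmorph1 strmap) str.
apply: rcoefP => a n; rewrite rcoef_rescale !rcoefM mulr_sumr.
rewrite big_nat [RHS]big_nat; apply: eq_bigr => j /andP[_]; rewrite ltnS => hj.
rewrite !rcoef_rescale -{1}(subnKC hj) path_weightD.
by rewrite [path_weight a j * _]mulrC mulrACA.
Qed.

Lemma rescale_surj y : exists x, rescale x = y.
Proof.
exists (rmk (fun a n => (path_weight a n)^-1 * rcoef y a n)).
apply: rcoefP => a n; rewrite rcoef_rescale rcoef_rmk; last first.
  by move=> {a} a b e; rewrite !path_weight0 (rcoef_source y e).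
by rewrite mulrA mulfV ?mul1r ?path_weight_neq0.
Qed.

End Automorphism.

Variables (e : polarization Q) (he : orbit_signs e).
Hypothesis roots : forall v : node Q, exists x : k, root ('X^(m v) + 1) x.

Let e_node a b : node_of a = node_of b -> (-1) ^+ e a = (-1) ^+ e b :> k.
Proof.
move=> /(congr1 val) /= /eqP; rewrite eq_porbit_mem => /porbitP[n ->].
by elim: n => [|n IH]; rewrite ?expg0 ?perm1 // expgSr permM he.
Qed.

Lemma cycle_scaling_exists a : exists xi : k, xi ^+ m (node_of a) = (-1) ^+ e a.
Proof.
case: (e a); last by exists 1; rewrite expr1n.
have [x /rootP] := roots (node_of a); rewrite !hornerE => /eqP.
by rewrite addr_eq0 => /eqP h; exists x.
Qed.

Let rep a := choose (fun b => node_of b == node_of a) a.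

Let rep_node a : node_of (rep a) = node_of a.
Proof. by apply/eqP; exact: (@chooseP _ (fun b => node_of b == node_of a)). Qed.

Let rep_eq a b : node_of a = node_of b -> rep a = rep b.
Proof.
move=> eab; rewrite /rep eab; apply: choose_id => //=; by rewrite eab.
Qed.

(* Only one arrow in each orbit is rescaled, so c_a is multiplied by that factor
   once, and c_a^m by its m-th power. *)
Let h a : k := if a == rep a then sval (cid (cycle_scaling_exists (rep a))) else 1.

Let h_neq0 a : h a != 0.
Proof.
rewrite /h; case: ifP => _; last exact: oner_neq0.
case: cid => x /= hx; apply/eqP => x0; move: hx; rewrite x0.
rewrite expr0n eqn0Ngt mult_gt0 /= => /esym/eqP.
by rewrite signr_eq0.
Qed.

Lemma path_weight_height a : path_weight h a (N a) = (-1) ^+ e a.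
Proof.
have step n : path_weight h a (n * orbit_len a) = path_weight h a (orbit_len a) ^+ n.
  elim: n => [|n IH]; first by rewrite path_weight0.
  by rewrite mulSn path_weightD iter_orbit_len IH exprS.
have -> : N a = (m (node_of a) * orbit_len a)%N by rewrite height.unlock mulnC.
rewrite step.
have in_orbit b : (b \in traject sigma a (orbit_len a)) = (node_of b == node_of a).
  rewrite -porbit_traject -val_eqE /= -eq_porbit_mem eq_sym.
  by [].
have -> : path_weight h a (orbit_len a) = h (rep a).
  rewrite /path_weight (bigD1_seq (rep a)) ?uniq_traject_porbit ?in_orbit ?rep_node //=.
  rewrite big_seq_cond big1 ?mulr1 // => b /andP[+ ne]; rewrite in_orbit => /eqP eb.
  by rewrite /h (rep_eq eb) (negbTE ne).
have hrep : rep (rep a) = rep a by apply: rep_eq.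
rewrite /h hrep eqxx; case: cid => x /=; rewrite rep_node => ->.
by apply: e_node; rewrite rep_node.
Qed.

(** Rescaling multiplies the coefficient at c_a^m by the sign of a, which turns
    equal coefficients at a vertex into opposite ones. *)
Lemma twisted_iso_ribbon_mod_w (eps : polarization Q) :
  alg_iso (twisted_brauer_alg m) (ribbon_mod_w m eps).
Proof.
apply: (quot_alg_iso (rescale_morphism h)) => [x|y]; last first.
  have [x <-] := rescale_surj h_neq0 y; exists x; rewrite subrr; exact: Defs.ideal0.
rewrite ideal_zP ideal_wP; split=> -[x0 x1]; split=> [a n hn|a b ne eab].
- by rewrite rcoef_rescale x0 ?mulr0.
- rewrite !rcoef_rescale !path_weight_height (x1 a b ne eab) mul1r mulN1r.
  by rewrite (sign_opp e ne eab) mulNr.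
- have := x0 a n hn; rewrite rcoef_rescale => /eqP.
  by rewrite mulf_eq0 (negbTE (path_weight_neq0 h_neq0 a n)) => /eqP.
have := x1 a b ne eab; rewrite !rcoef_rescale !path_weight_height mulN1r.
rewrite (sign_opp e ne eab) mulNr => /oppr_inj /(congr1 (fun c => (-1) ^+ e b * c)).
by rewrite !mulrA !sqr_sign_eq1 !mul1r.
Qed.

End Rescaling.

(** Symmetry passes from kQ'/(I' + J_-) to the Morita equivalent algebra B and to
    the isomorphic algebra A, where it forces constant signs. *)
Lemma brauer_orbit_signs (k : fieldType) (Q : gentle_quiver k) (m : multiplicity Q)
    (eps : polarization Q) (B : algebraOver k) :
  is_brauer_graph_algebra B -> alg_iso (twisted_brauer_alg m) B ->
  exists e : polarization Q, orbit_signs e.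
Proof.
move=> [_ [Q' [m' mor]]] [f [fP [g fK gK]]]; have [fB [_ fM] fstr] := fP.
have [lamC lamCP] := brauer_nondeg_trace m'.
have [lam lamP] := morita_nondeg_trace mor lamCP.
apply: (trace_form_orbit_signs (lam := fun x => lam (f (qpi _ x))) _ eps).
apply: (@twisted_trace_form _ _ m (fun v => lam (f v))); split.
- by move=> x y; rewrite (alg_morphismD fP) (symD lamP).
- by move=> c x; rewrite fM fstr (symZ lamP).
- by move=> x y; rewrite !fM (symC lamP).
move=> x hx; apply: (can_inj fK); rewrite [RHS](_ : _ = 0); last first.
  by rewrite -[X in f X](subrr 0) fB subrr.
apply: (sym_nondeg lamP) => u; rewrite -(gK u) -fM; exact: hx.
Qed.

Theorem theorem3p18 (k : fieldType) (Q : gentle_quiver k) (m : multiplicity Q)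
    (eps : polarization Q) :
  let A := twisted_brauer_alg m in
  let c1 := symmetric_alg (ribbon_order m) in
  let c2 := symmetric_alg A in
  let c3 := bipartite (gentle_graph Q) \/ 2%N \in [pchar k] in
  let c4 := exists (e : polarization Q) (f : ribbon_order m -> ribbon_order m),
    is_involution e f /\ f =1 id in
  let c5 := exists B : algebraOver k, is_brauer_graph_algebra B /\ alg_iso A B in
  let c6 := alg_iso A (ribbon_mod_w m eps) in
  [/\ c1 <-> c2, c2 <-> c3, c3 <-> c4, (c5 -> c4) & (c6 -> c5)] /\
  ((forall v : node Q, exists x : k, root ('X^(m v) + 1) x) ->
    [/\ c1 <-> c2, c2 <-> c3, c3 <-> c4, c4 <-> c5 & c5 <-> c6]).
Proof.
move=> A c1 c2 c3 c4 c5 c6.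
pose signs := exists e : polarization Q, orbit_signs e.
have s1 : c1 <-> signs.
  split=> [/symmetric_algP[lam lamP]|[e he]]; last exact: order_symmetric he.
  exact: trace_form_orbit_signs (order_trace_form lamP) eps.
have s2 : c2 <-> signs.
  split=> [/symmetric_algP[lam lamP]|[e he]]; last exact: twisted_symmetric he.
  exact: trace_form_orbit_signs (twisted_trace_form lamP) eps.
have s3 : c3 <-> signs by exact: bipartite_orbit_signs eps.
have s4 : c4 <-> signs by exact: trivial_involution_orbit_signs.
have c54 : c5 -> c4.
  by move=> [B [hB isoB]]; apply/s4; exact: brauer_orbit_signs hB isoB.
have c65 : c6 -> c5.
  by move=> h; exists (ribbon_mod_w m eps); split=> //; exact: ribbon_mod_w_brauer.
have c12 : c1 <-> c2 by rewrite s1 s2.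
have c23 : c2 <-> c3 by rewrite s2 s3.
have c34 : c3 <-> c4 by rewrite s3 s4.
split=> // roots.
have c46 : c4 -> c6 by move=> /s4[e he]; exact: twisted_iso_ribbon_mod_w he roots eps.
have c45 : c4 <-> c5 by split=> [/c46/c65|/c54].
by have c56 : c5 <-> c6 by split=> [/c54/c46|/c65].
Qed.
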